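(* Let $\delta\in(0,1)$ and suppose $p=\tfrac12-c_p$ where $c_p\in(0,1/2]$ is an absolute constant. There are constants $C>1$ and $c>0$ depending only on $c_p$ such that, if assumptions (A1), (A2), (A3) hold with this $C$, then with probability at least $1-10\delta$ over the draw of the pre-training data $\{\mu_\tau,(x_{\tau,i},y_{\tau,i})_{i=1}^{N+1}\}_{\tau=1}^B$, the max-margin solution $W_{\mathrm{MM}}$ satisfies, for a freshly sampled test task $\{\mu,(x_i,y_i)_{i=1}^{M+1}\}$ (drawn from the test distribution, independently of the pre-training data), \[ \mathbb P_{(x_i,y_i)_{i=1}^{M+1},\,\mu}\big(\operatorname{sign}(\hat y(E;W_{\mathrm{MM}}))\neq y_{M+1}\big)\le \big(p+2e^{-cM}\big)\mathbf 1(p>0)+2\exp\!\big(-c\rho\sqrt d\big)+4\exp\!\Big(-\frac{c\rho\tilde R}{\|\Lambda^{1/2}\|_2}\Big)+2\exp\!\Big(-\frac{c\rho M^{1/2}\tilde R^2}{\|\Lambda\|_2\sqrt d}\Big), \] where $\rho:=\dfrac{c_B\wedge 1}{\log^2(2B^2/\delta)}$.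
   Context: Pre-training data: let $\Lambda\succ0$ be a symmetric positive-definite $d\times d$ matrix, $B,N\ge1$ integers, $R>0$. For $\tau=1,\dots,B$ and $i=1,\dots,N+1$: $\mu_\tau\sim\mathrm{Unif}(R\cdot\mathbb S^{d-1})$ i.i.d. (uniform on the sphere of radius $R$ in $\mathbb R^d$), $z_{\tau,i}\sim\mathcal N(0,\Lambda)$ i.i.d., $y_{\tau,i}\sim\mathrm{Unif}(\{\pm1\})$ i.i.d., all mutually independent, and $x_{\tau,i}=y_{\tau,i}\mu_\tau+z_{\tau,i}$. Write $\hat\mu_\tau=\frac1N\sum_{i=1}^N y_{\tau,i}x_{\tau,i}$, $x_\tau=x_{\tau,N+1}$, $y_\tau=y_{\tau,N+1}$. The max-margin solution is $W_{\mathrm{MM}}=\arg\min\{\|U\|_F^2:\ U\in\mathbb R^{d\times d},\ \hat\mu_\tau^\top U\,y_\tau x_\tau\ge1\ \forall \tau\in[B]\}$. Assumptions, for a constant $C>1$ and $\delta\in(0,1)$: (A1) $R^2\ge C^2\sqrt{d\,\mathrm{tr}(\Lambda^2)}\ \vee\ C^2\big(\tfrac{\mathrm{tr}(\Lambda)}{d}\vee\sqrt{\tfrac{\mathrm{tr}(\Lambda^2)}{N}}\vee\|\Lambda\|_2\big)\log(2B/\delta)$; (A2) $B\ge c_Bd$ for some $c_B>0$ (not necessarily constant); (A3) $d\ge C\log^4(2B^2/\delta)$. Here $a\vee b=\max(a,b)$, $a\wedge b=\min(a,b)$. Test distribution: for an integer $M\ge1$, $\tilde R>0$ and $p\in[0,1/2)$,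 and $i=1,\dots,M+1$: $\tilde y_i\sim\mathrm{Unif}(\{\pm1\})$; $y_i=\tilde y_i$ with probability $1-p$ and $y_i=-\tilde y_i$ with probability $p$; $\mu\sim\mathrm{Unif}(\tilde R\cdot\mathbb S^{d-1})$; $z_i\sim\mathcal N(0,\Lambda)$; $x_i=\tilde y_i\mu+z_i$; all these random variables mutually independent. The transformer prediction with parameter $W$ is $\hat y(E;W)=\big(\frac1M\sum_{i=1}^M y_ix_i\big)^\top W x_{M+1}$, where $E$ encodes $(x_i,y_i)_{i=1}^M$ and $x_{M+1}$. *)

(* Defs.v *)
From HB Require Import structures.
From mathcomp Require Import all_boot all_order all_algebra.
From mathcomp Require Import all_classical all_reals all_analysis.
Set Implicit Arguments.
Unset Strict Implicit.
Unset Printing Implicit Defensive.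
Import Order.TTheory GRing.Theory Num.Theory.
Local Open Scope classical_set_scope.
Local Open Scope ring_scope.

Section LinAlg.
Context {R : realType}.

Definition vnorm n (x : 'cV[R]_n) : R := Num.sqrt (\sum_i x i 0 ^+ 2).
Definition frob2 m n (U : 'M[R]_(m, n)) : R := \sum_i \sum_j U i j ^+ 2.
Definition opnorm m n (A : 'M[R]_(m, n)) : R :=
  sup [set vnorm (A *m x) | x in [set x : 'cV[R]_n | vnorm x = 1]].
Definition bil n (u : 'cV[R]_n) (A : 'M[R]_n) (v : 'cV[R]_n) : R := (u^T *m A *m v) 0 0.
Definition dotv n (t x : 'cV[R]_n) : R := (t^T *m x) 0 0.
Definition posdef n (A : 'M[R]_n) : Prop :=
  A^T = A /\ forall x : 'cV[R]_n, x != 0 -> 0 < bil x A x.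
Definition orthogonal_mx n (Q : 'M[R]_n) : Prop := Q^T *m Q = 1%:M.

Definition mm_feasible d B (muh : 'I_B -> 'cV[R]_d) (yq : 'I_B -> R)
  (xq : 'I_B -> 'cV[R]_d) (U : 'M[R]_d) : Prop :=
  forall t, 1 <= bil (muh t) U (yq t *: xq t).
Definition is_max_margin d B (muh : 'I_B -> 'cV[R]_d) (yq : 'I_B -> R)
  (xq : 'I_B -> 'cV[R]_d) (U : 'M[R]_d) : Prop :=
  mm_feasible muh yq xq U /\
  forall V, mm_feasible muh yq xq V -> frob2 U <= frob2 V.
End LinAlg.

Section Prob.
Context {R : realType} {dO : measure_display} {O : measurableType dO}
  (P : probability O R).

Definition rvec n (X : O -> 'cV[R]_n) : Prop :=
  forall k, measurable_fun setT (fun w => X w k 0).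
Definition rect_ev n (X : O -> 'cV[R]_n) (A : 'I_n -> set R) : set O :=
  [set w | forall k, A k (X w k 0)].
Definition scal (Y : O -> R) : O -> 'cV[R]_1 := fun w => const_mx (Y w).

(* mutual independence of a finite family of random vectors: the joint law
   factorizes on all Borel rectangles (a pi-system generating the joint
   sigma-algebra). *)
Definition indep_family (I : finType) (n : I -> nat)
  (X : forall i, O -> 'cV[R]_(n i)) : Prop :=
  (forall i, rvec (X i)) /\
  forall A : forall i, 'I_(n i) -> set R, (forall i k, measurable (A i k)) ->
    fine (P [set w | forall i, rect_ev (X i) (A i) w]) =
    \prod_(i : I) fine (P (rect_ev (X i) (A i))).

(* Z ~ N(0, L): every nonzero linear combination t^T Z is N(0, t^T L t)
   (Cramer-Wold definition of a centered Gaussian vector) *)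
Definition gaussian_vec n (L : 'M[R]_n) (Z : O -> 'cV[R]_n) : Prop :=
  rvec Z /\
  forall t : 'cV[R]_n, t != 0 -> forall A : set R, measurable A ->
    P [set w | A (dotv t (Z w))] = normal_prob 0 (Num.sqrt (bil t L t)) A.

Definition pm1_rv (q : R) (Y : O -> R) : Prop :=
  measurable_fun setT Y /\
  P [set w | Y w = 1] = (1 - q)%:E /\ P [set w | Y w = -1] = q%:E.

(* U ~ Unif(r S^{n-1}): the (unique) rotation-invariant law on the sphere of
   radius r *)
Definition unif_sphere n (r : R) (U : O -> 'cV[R]_n) : Prop :=
  rvec U /\ P [set w | vnorm (U w) = r] = 1%E /\
  forall Q : 'M[R]_n, orthogonal_mx Q ->
    forall A : 'I_n -> set R, (forall k, measurable (A k)) ->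
      P (rect_ev (fun w => Q *m U w) A) = P (rect_ev U A).
End Prob.

Section Pretrain.
Context {R : realType} {dO : measure_display} {O : measurableType dO}.
Variables (d B N : nat).

Definition pre_idx : finType := (('I_B + ('I_B * 'I_N.+1)) + ('I_B * 'I_N.+1))%type.
Definition pre_dim (i : pre_idx) : nat :=
  match i with inl (inl _) => d | inl (inr _) => d | inr _ => 1%N end.
Definition pre_blocks (mu : 'I_B -> O -> 'cV[R]_d)
  (z : 'I_B -> 'I_N.+1 -> O -> 'cV[R]_d) (y : 'I_B -> 'I_N.+1 -> O -> R) :
  forall i : pre_idx, O -> 'cV[R]_(pre_dim i) :=
  fun i => match i return O -> 'cV[R]_(pre_dim i) with
           | inl (inl t) => mu t
           | inl (inr ti) => z ti.1 ti.2
           | inr ti => scal (y ti.1 ti.2) end.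

Definition pretrain_law (P : probability O R) (Rad : R) (L : 'M[R]_d)
  (mu : 'I_B -> O -> 'cV[R]_d) (z : 'I_B -> 'I_N.+1 -> O -> 'cV[R]_d)
  (y : 'I_B -> 'I_N.+1 -> O -> R) : Prop :=
  (forall t, unif_sphere P Rad (mu t)) /\
  (forall t i, gaussian_vec P L (z t i)) /\
  (forall t i, pm1_rv P (1/2) (y t i)) /\
  indep_family P (pre_blocks mu z y).

(* x_{t,i} = y_{t,i} mu_t + z_{t,i}  (i : 'I_N.+1; index ord_max is N+1) *)
Definition pre_x (mu : 'I_B -> O -> 'cV[R]_d)
  (z : 'I_B -> 'I_N.+1 -> O -> 'cV[R]_d) (y : 'I_B -> 'I_N.+1 -> O -> R)
  (t : 'I_B) (i : 'I_N.+1) (w : O) : 'cV[R]_d :=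
  y t i w *: mu t w + z t i w.
Definition pre_muhat mu z y (t : 'I_B) (w : O) : 'cV[R]_d :=
  (N%:R)^-1 *: \sum_(i < N.+1 | i != ord_max) (y t i w *: pre_x mu z y t i w).
End Pretrain.

Section Test.
Context {R : realType} {dT : measure_display} {T : measurableType dT}.
Variables (d M : nat).

Definition test_idx : finType := ((('I_M.+1 + 'I_M.+1) + 'I_M.+1) + unit)%type.
Definition test_dim (i : test_idx) : nat :=
  match i with inl (inl (inl _)) => 1%N | inl (inl (inr _)) => 1%N
          | inl (inr _) => d | inr _ => d end.
Definition test_blocks (mu : T -> 'cV[R]_d) (z : 'I_M.+1 -> T -> 'cV[R]_d)
  (yt f : 'I_M.+1 -> T -> R) :
  forall i : test_idx, T -> 'cV[R]_(test_dim i) :=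
  fun i => match i return T -> 'cV[R]_(test_dim i) with
           | inl (inl (inl j)) => scal (yt j)
           | inl (inl (inr j)) => scal (f j)
           | inl (inr j) => z j
           | inr _ => mu end.

(* ytilde_i ~ Unif{+-1}; flip f_i = -1 w.p. p, +1 w.p. 1-p (so y_i = f_i ytilde_i
   equals ytilde_i w.p. 1-p and -ytilde_i w.p. p); mu ~ Unif(Rt S^{d-1});
   z_i ~ N(0,L); all mutually independent *)
Definition test_law (Q : probability T R) (Rt p : R) (L : 'M[R]_d)
  (mu : T -> 'cV[R]_d) (z : 'I_M.+1 -> T -> 'cV[R]_d) (yt f : 'I_M.+1 -> T -> R) :
  Prop :=
  unif_sphere Q Rt mu /\
  (forall i, gaussian_vec Q L (z i)) /\
  (forall i, pm1_rv Q (1/2) (yt i)) /\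
  (forall i, pm1_rv Q p (f i)) /\
  indep_family Q (test_blocks mu z yt f).

Definition test_y (yt f : 'I_M.+1 -> T -> R) (i : 'I_M.+1) (v : T) : R := f i v * yt i v.
Definition test_x (mu : T -> 'cV[R]_d) (z : 'I_M.+1 -> T -> 'cV[R]_d)
  (yt : 'I_M.+1 -> T -> R) (i : 'I_M.+1) (v : T) : 'cV[R]_d :=
  yt i v *: mu v + z i v.
Definition test_yhat (W : 'M[R]_d) mu z yt f (v : T) : R :=
  bil ((M%:R)^-1 *: \sum_(i < M.+1 | i != ord_max)
          (test_y yt f i v *: test_x mu z yt i v))
      W (test_x mu z yt ord_max v).
End Test.

(* Main.v *)
Require Import Defs.
From HB Require Import structures.
From mathcomp Require Import all_boot all_order all_algebra.
From mathcomp Require Import all_classical all_reals all_analysis.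
From mathcomp Require Import measurable_realfun ring lra zify.
Import Order.TTheory GRing.Theory Num.Theory.
Local Open Scope classical_set_scope.
Local Open Scope ring_scope.
Set Implicit Arguments.
Unset Strict Implicit.
Unset Printing Implicit Defensive.

(* Let [W] be the max-margin matrix, [a_t] the empirical mean of task [t] and [b_t = y_t x_t]. With high
   probability [a_t . b_t >= R^2/2] for all [t], so a multiple of the identity is feasible, and minimality
   of [W] tested against it gives [tr W >= (R^2/2) |W|_F^2]. Pairing [W] with the sum of the [a_t b_t^T]
   gives [B^2 <= |W|_F^2 sum_(t, t') (a_t . a_t') (b_t . b_t')]; off the diagonal both factors are
   [O(R^2 log / sqrt d)], so that [tr W >= kappa |W|_F] with [kappa] of order [rho sqrt d].

   At test time, write the mean of the [y_i x_i] as [f mu + xi], with [f] the mean of the label flips, and the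
   query, up to its sign, as [mu + zeta]. The quadratic form [mu . W mu] concentrates at [Rt^2 tr W / d] at scale
   [Rt^2 |W|_F / d], while the bilinear forms in the pairs (mu, zeta), (xi, mu) and (xi, zeta) of independent
   sub-Gaussian vectors have exponential tails at scales proportional to [|W|_F]. As [f >= cp] except with
   probability [exp (- cp^2 M / 8)], the signal wins.

   Linear and quadratic forms on the sphere are controlled by moment recursions obtained by differentiating
   expectations along plane rotations. *)

(** * Independent blocks of random vectors *)

(** The test stage knows [W] only through [kappa |W|_F <= tr W], so no dual description of the
    max-margin matrix is needed.

    Two obstacles shape the probabilistic part. First, [unif_sphere] offers only rotation
    invariance, tested on rectangles: there is no density and no Gaussian representation to start
    from. Moments must be extracted from E F(QU) = E F(U), and a Taylor remainder uniform over the
    sphere replaces differentiation under the integral. The outcome is a moment generating function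
    bounded by that of N(0, (r^2 / n) I), so that centres, Gaussian noise and their sums are all
    handled through a single notion of proxy covariance.

    Second, bilinear forms in two independent vectors are treated by integrating one of them out,
    which leaves the exponential of a quadratic form in the other. This needs Tonelli for functions
    of disjoint groups of vectors, whereas independence is given as a product formula on rectangles.

    The union bound at test time produces the prefactors 8 and 4 where 4 and 2 are claimed; the
    surplus is paid for by a factor 2 in the rate. *)

Section IndependentBlocks.
Context {R : realType} {dO : measure_display} {O : measurableType dO}
  (P : probability O R).
Variables (I : finType) (n : I -> nat) (X : forall i, O -> 'cV[R]_(n i)).

(** Vectors outside [S] are unconstrained, so these sets form a pi-system containing the whole
    space, and [indep_family] gives the probability of each as a product. *)
Definition block_gen (S : {set I}) : set (set O) :=
  [set A | exists B : forall i, 'I_(n i) -> set R,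
     (forall i k, measurable (B i k)) /\
     A = [set w | forall i, i \in S -> rect_ev (X i) (B i) w]].

(* The sample space with the sigma-algebra generated by the vectors indexed by [S]: to depend only
   on the block [S] is to be measurable on this type. *)
Definition blockType (S : {set I}) : measurableType (sigma_display (block_gen S)) :=
  g_sigma_algebraType (block_gen S).

Lemma block_gen_setI S : setI_closed (block_gen S).
Proof.
move=> _ _ [B [mB ->]] [C [mC ->]].
exists (fun i k => B i k `&` C i k); split; first by move=> i k; exact: measurableI.
apply/seteqP; split => [w [hB hC] i iS k|w h]; first by split; [exact: hB|exact: hC].
by split => i iS k; have [] := h i iS k.
Qed.

Lemma block_gen_setT S : block_gen S setT.
Proof.
exists (fun _ _ => setT); split; first by move=> *; exact: measurableT.
by apply/seteqP; split.
Qed.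

Lemma measurable_block_coord (S : {set I}) i k : i \in S ->
  measurable_fun [set: blockType S] (fun w : blockType S => X i w k 0 : R).
Proof.
move=> iS _ B mB; rewrite setTI; apply: sub_sigma_algebra.
(* Indices are compared as dependent pairs because the type of [l] depends on [j]; only the
   coordinate [(i, k)] is constrained. *)
exists (fun j l => if (Tagged (fun i => 'I_(n i)) l : {i & 'I_(n i)}) == Tagged (fun i => 'I_(n i)) k then B else setT).
split=> [j l|]; first by case: ifP => _ //; exact: measurableT.
apply/seteqP; split => [w Bw j jS l /=|w /(_ i iS k)] /=; last by rewrite eqxx.
case: ifPn => // /eqP e.
move: Bw => /=.
have -> : X i w k 0 = (fun u : {i & 'I_(n i)} => X (tag u) w (tagged u) 0) (Tagged (fun i => 'I_(n i)) k) by [].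
by rewrite -e.
Qed.

Hypothesis HX : indep_family P X.

Lemma block_gen_measurable S : block_gen S `<=` @measurable _ O.
Proof.
move=> _ [B [mB ->]].
rewrite (_ : mkset _ = \bigcap_(i in [set i : I | i \in S]) \bigcap_(k in [set: 'I_(n i)])
    [set w | B i k (X i w k 0)]); last first.
  by apply/seteqP; split => [w h i iS k _|w h i iS k]; [exact: h|exact: h].
apply: fin_bigcap_measurable => [|i _]; first exact: finite_finset.
apply: fin_bigcap_measurable => [|k _]; first exact: finite_finset.
by rewrite -[mkset _]setTI; apply: (HX.1 i k).
Qed.

Lemma blockP_measurable (S : {set I}) (A : set (blockType S)) :
  measurable A -> @measurable _ O A.
Proof.
by apply: smallest_sub; [exact: sigma_algebra_measurable|exact: block_gen_measurable].
Qed.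

Lemma prob_block_gen (S : {set I}) (B : forall i, 'I_(n i) -> set R) :
  (forall i k, measurable (B i k)) ->
  fine (P [set w | forall i, i \in S -> rect_ev (X i) (B i) w]) =
  \prod_(i in S) fine (P (rect_ev (X i) (B i))).
Proof.
move=> mB; pose B' i k := if i \in S then B i k else setT.
have -> : [set w | forall i, i \in S -> rect_ev (X i) (B i) w] =
    [set w | forall i, rect_ev (X i) (B' i) w].
  apply/seteqP; split => w /= h i; first by rewrite /B' => k /=; case: ifPn => // iS; exact: h.
  by move=> iS k; have := h i k; rewrite /B' iS.
rewrite HX.2; last by move=> i k; rewrite /B'; case: ifP.
rewrite [RHS]big_mkcond/=; apply: eq_bigr => i _.
rewrite /B'; case: ifP => // _.
rewrite (_ : rect_ev _ _ = setT) ?probability_setT//.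
by apply/seteqP; split.
Qed.

Lemma indep_block_gen (S1 S2 : {set I}) A B : [disjoint S1 & S2]%B ->
  block_gen S1 A -> block_gen S2 B -> (P (A `&` B) = P A * P B)%E.
Proof.
move=> S12 [C [mC eA]] [D [mD eB]].
have fP E : block_gen S1 E \/ block_gen S2 E -> P E \is a fin_num.
  by case=> /block_gen_measurable; exact: fin_num_measure.
rewrite -(@fineK _ (P A)); last by apply: fP; left; exists C.
rewrite -(@fineK _ (P B)); last by apply: fP; right; exists D.
rewrite -(@fineK _ (P (A `&` B))); last first.
  apply: fin_num_measure; apply: measurableI.
    by apply: (@block_gen_measurable S1); exists C.
  by apply: (@block_gen_measurable S2); exists D.
rewrite -EFinM; congr EFin.
rewrite eA eB !prob_block_gen//.
pose F i k := if i \in S1 then C i k else D i k.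
have -> : [set w | forall i, i \in S1 -> rect_ev (X i) (C i) w] `&`
    [set w | forall i, i \in S2 -> rect_ev (X i) (D i) w] =
    [set w | forall i, i \in S1 :|: S2 -> rect_ev (X i) (F i) w].
  apply/seteqP; split => w /= => [[h1 h2] i|h].
    by rewrite inE /F => h k /=; case: ifPn h => [/h1//|_ /= /h2].
  split=> i iS k /=; have := h i; rewrite inE iS ?orbT/= => /(_ isT k); rewrite /F.
    by rewrite iS.
  by rewrite (disjointFl S12 iS).
rewrite prob_block_gen; last by move=> i k; rewrite /F; case: ifP.
rewrite (eq_bigl [in [predU S1 & S2]]) => [|i]; last by rewrite !inE.
rewrite bigU//=; congr (_ * _); apply: eq_bigr => i iS; rewrite /F ?iS//.
by rewrite (disjointFl S12 iS).
Qed.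

(** Two finite measures that agree on a pi-system agree on the sigma-algebra it generates. This is
    used twice ([key]): with a rectangle fixed on one side, then with an arbitrary measurable set
    fixed on the other. *)
Lemma indep_block_sets (S1 S2 : {set I}) (A : set (blockType S1))
    (B : set (blockType S2)) : [disjoint S1 & S2]%B ->
  measurable A -> measurable B -> (P ((A : set O) `&` (B : set O)) = P A * P B)%E.
Proof.
move=> S12 mA mB.
have key (S S' : {set I}) C : [disjoint S & S']%B -> @measurable _ O C ->
    (forall D, block_gen S D -> (P (C `&` D) = P C * P D)%E) ->
    forall D : set (blockType S), measurable D -> (P (C `&` D) = P C * P D)%E.
  move=> SS' mC h D mD.
  have fC : P C \is a fin_num by exact: fin_num_measure.
  have C0 : 0 <= fine (P C) by apply: fine_ge0; exact: measure_ge0.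
  pose m1 := mrestr P mC; pose m2 := mscale (NngNum C0) P.
  have e : m1 (D : set O) = m2 (D : set O).
    apply: (g_sigma_algebra_measure_unique (block_gen S) _ (fun=> setT)).
    - exact: block_gen_measurable.
    - by move=> _; exact: block_gen_setT.
    - by rewrite bigcup_const.
    - exact: block_gen_setI.
    - move=> E gE; transitivity (P (E `&` C)) => //.
      by rewrite setIC h// -[in LHS](fineK fC).
    - move=> _; change (P (setT `&` C) < +oo)%E.
      by rewrite setTI ltey_eq fC.
    - exact: mD.
  rewrite -(fineK fC) setIC; exact: e.
have S21 : [disjoint S2 & S1]%B by rewrite disjoint_sym.
apply: (key S2 S1) => //; first exact: blockP_measurable mA.
move=> D gD; rewrite setIC muleC.
apply: (key S1 S2) => //; first exact: block_gen_measurable gD.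
by move=> E gE; rewrite setIC muleC; exact: indep_block_gen S12 gE gD.
Qed.

Lemma measurable_to_block (S : {set I}) :
  measurable_fun setT (fun w : O => w : blockType S).
Proof. by move=> _ A mA; rewrite setTI; exact: blockP_measurable mA. Qed.

(** The diagonal map w -> (w, w) pushes [P] forward to a measure on the product of the two block
    spaces, and independence says that this measure is the product of the marginals. *)
Lemma tonelli_blocks (S1 S2 : {set I}) (f : blockType S1 * blockType S2 -> \bar R) :
  [disjoint S1 & S2]%B -> measurable_fun setT f -> (forall x, 0 <= f x)%E ->
  (\int[P]_w f (w, w) = \int[P]_w1 \int[P]_w2 f (w1, w2))%E.
Proof.
move=> S12 mf f0.
have mD : measurable_fun setT (fun w : O => (w, w) : blockType S1 * blockType S2).
  by apply/measurable_fun_pairP; split; exact: measurable_to_block.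
pose i1 : {mfun O >-> blockType S1} := mfun_Sub (mem_set (@measurable_to_block S1)).
pose i2 : {mfun O >-> blockType S2} := mfun_Sub (mem_set (@measurable_to_block S2)).
pose iD : {mfun O >-> (blockType S1 * blockType S2)%type} := mfun_Sub (mem_set mD).
have -> : (\int[P]_w f (w, w) = \int[distribution P iD]_x f x)%E.
  by rewrite ge0_integral_distribution.
have e : forall A, measurable A ->
    ((distribution P i1) \x (distribution P i2))%E A = distribution P iD A.
  apply: product_measure_unique => A B mA mB.
  exact: (indep_block_sets S12 mA mB).
rewrite -(@eq_measure_integral _ _ _ _ _ ((distribution P i1) \x (distribution P i2))%E); last first.
  by move=> A mA _; exact: e.
rewrite fubini_tonelli1//.
rewrite ge0_integral_distribution; last 2 first.
  exact: measurable_fun_fubini_tonelli_F.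
  by move=> w; apply: integral_ge0.
apply: eq_integral => w _ /=; rewrite /fubini_F ge0_integral_distribution//.
exact: measurableT_comp.
Qed.

Lemma measurable_from_block (S : {set I}) (f : O -> R) :
  measurable_fun [set: blockType S] (f : blockType S -> R) ->
  measurable_fun [set: O] f.
Proof.
by move=> mf _ A mA; rewrite setTI; apply: (@blockP_measurable S);
   rewrite -[X in measurable X]setTI; exact: mf.
Qed.

Lemma measurable_block_sub (S S' : {set I}) (f : O -> R) : S \subset S' ->
  measurable_fun [set: blockType S] (f : blockType S -> R) ->
  measurable_fun [set: blockType S'] (f : blockType S' -> R).
Proof.
move=> SS' mf _ A mA.
have h : <<s block_gen S >> `<=` <<s block_gen S' >>.
  apply: sub_sigma_algebra2 => _ [B [mB ->]].
  exists (fun i k => if i \in S then B i k else setT); split=> [i k|].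
    by case: ifP.
  apply/seteqP; split => w /= hw i.
    by move=> _ k /=; case: ifPn => // /hw.
  by move=> iS k; have := hw i (fintype.subsetP SS' _ iS) k; rewrite iS.
by apply: h; exact: (mf measurableT A mA).
Qed.

Lemma expectation_mul_blocks (S1 S2 : {set I}) (f g : O -> R) :
  [disjoint S1 & S2]%B ->
  measurable_fun [set: blockType S1] (f : blockType S1 -> R) ->
  measurable_fun [set: blockType S2] (g : blockType S2 -> R) ->
  (forall w, 0 <= f w) -> (forall w, 0 <= g w) ->
  (\int[P]_w (f w * g w)%:E = \int[P]_w (f w)%:E * \int[P]_w (g w)%:E)%E.
Proof.
move=> S12 mf mg f0 g0.
have mfO := measurable_from_block mf; have mgO := measurable_from_block mg.
pose F (x : blockType S1 * blockType S2) : \bar R := (f x.1 * g x.2)%:E.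
rewrite (_ : (\int[P]_w (f w * g w)%:E = \int[P]_w F (w, w))%E)//.
rewrite (tonelli_blocks (f := F) S12); last 2 first.
- apply/measurable_EFinP; apply: measurable_funM.
    exact: (measurableT_comp mf measurable_fst).
  exact: (measurableT_comp mg measurable_snd).
- by move=> x; rewrite lee_fin mulr_ge0.
under eq_integral => w1 _ do under eq_integral => w2 _ do rewrite /F/= EFinM.
under eq_integral => w1 _.
  rewrite ge0_integralZl_EFin//; last 2 first.
  - by move=> w _; rewrite lee_fin.
  - exact/measurable_EFinP.
  over.
rewrite ge0_integralZr//; first exact/measurable_EFinP.
- by move=> w _; rewrite lee_fin.
- by apply: integral_ge0 => w _; rewrite lee_fin.
Qed.

(** Measurability over the union of the blocks is part of the conclusion because the induction has
    to separate the next factor from the product of the remaining ones. *)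
Lemma expectation_prod_blocks (J : finType) (s : seq J) (S : J -> {set I})
    (f : J -> O -> R) (c : J -> R) : uniq s ->
  {in s &, forall j k, j != k -> [disjoint S j & S k]%B} ->
  (forall j, measurable_fun [set: blockType (S j)] (f j : blockType (S j) -> R)) ->
  (forall j w, 0 <= f j w) ->
  (forall j, (\int[P]_w (f j w)%:E <= (c j)%:E)%E) ->
  measurable_fun [set: blockType (\bigcup_(j <- s) S j)%SET]
    ((fun w => \prod_(j <- s) f j w) : blockType (\bigcup_(j <- s) S j)%SET -> R) /\
  (\int[P]_w (\prod_(j <- s) f j w)%:E <= (\prod_(j <- s) c j)%:E)%E.
Proof.
move=> us dS mf f0 fc.
have c0 j : 0 <= c j.
  by rewrite -lee_fin; apply: le_trans (fc j); apply: integral_ge0 => w _; rewrite lee_fin.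
elim: s us dS => [_ _|j s IH /= /andP[js us] dS].
  split.
    rewrite (_ : (fun w => _) = cst 1); first exact: measurable_cst.
    by apply/funext => w; rewrite big_nil.
  under eq_integral do rewrite big_nil.
  by rewrite integral_cst// mul1e big_nil probability_le1.
have [|m1 m2] := IH us.
  by move=> a b ain bin; apply: dS; rewrite inE ?ain ?bin orbT.
have dj : [disjoint S j & (\bigcup_(k <- s) S k)%SET]%B.
  rewrite disjoint_sym; apply/pred0P => i /=; apply/negbTE/negP => /andP[].
  rewrite finset.bigcup_seq => /finset.bigcupP[k ks ik] ij.
  have kj : k != j by apply: contra js => /eqP <-.
  have := dS k j; rewrite !inE ks eqxx orbT kj => /(_ isT isT isT) dkj.
  by rewrite (disjointFl dkj ij) in ik.
split.
  rewrite (_ : (fun w => _) = (fun w => f j w * \prod_(j <- s) f j w)); last first.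
    by apply/funext => w; rewrite big_cons.
  rewrite big_cons; apply: measurable_funM.
    by apply: (measurable_block_sub (S := S j)) (mf j); exact: finset.subsetUl.
  by apply: (measurable_block_sub (S := (\bigcup_(j <- s) S j)%SET)) m1; exact: finset.subsetUr.
under eq_integral do rewrite big_cons.
rewrite (expectation_mul_blocks dj)//; last by move=> w; exact: prodr_ge0.
rewrite big_cons EFinM; apply: lee_pmul => //.
  by apply: integral_ge0 => w _; rewrite lee_fin.
by apply: integral_ge0 => w _; rewrite lee_fin prodr_ge0.
Qed.
End IndependentBlocks.

(** * Frobenius and operator norms *)

Section LinearAlgebra.
Context {R : realType}.

Lemma dotvE n (t x : 'cV[R]_n) : dotv t x = \sum_k t k 0 * x k 0.
Proof. by rewrite /dotv mxE; apply: eq_bigr => k _; rewrite mxE. Qed.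

Lemma dotvC n (t x : 'cV[R]_n) : dotv t x = dotv x t.
Proof. by rewrite !dotvE; apply: eq_bigr => k _; rewrite mulrC. Qed.

Lemma dotvDl n (s t x : 'cV[R]_n) : dotv (s + t) x = dotv s x + dotv t x.
Proof. by rewrite /dotv linearD/= mulmxDl mxE. Qed.

Lemma dotvDr n (s t x : 'cV[R]_n) : dotv x (s + t) = dotv x s + dotv x t.
Proof. by rewrite /dotv mulmxDr mxE. Qed.

Lemma dotvZl n a (t x : 'cV[R]_n) : dotv (a *: t) x = a * dotv t x.
Proof. by rewrite /dotv linearZ/= -scalemxAl mxE. Qed.

Lemma dotvZr n a (t x : 'cV[R]_n) : dotv t (a *: x) = a * dotv t x.
Proof. by rewrite dotvC dotvZl dotvC. Qed.

Lemma dotv0l n (x : 'cV[R]_n) : dotv 0 x = 0.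
Proof. by rewrite /dotv trmx0 mul0mx mxE. Qed.

Lemma dotv_sumr n (J : Type) (s : seq J) (Q : pred J) (t : 'cV[R]_n) (x : J -> 'cV[R]_n) :
  dotv t (\sum_(j <- s | Q j) x j) = \sum_(j <- s | Q j) dotv t (x j).
Proof. by rewrite /dotv mulmx_sumr summxE. Qed.

Lemma dotv_mulmxr m n (t : 'cV[R]_m) (A : 'M[R]_(m, n)) (x : 'cV[R]_n) :
  dotv t (A *m x) = dotv (A^T *m t) x.
Proof. by rewrite /dotv trmx_mul trmxK mulmxA. Qed.

Lemma bil_dotv n (u : 'cV[R]_n) (A : 'M[R]_n) v : bil u A v = dotv u (A *m v).
Proof. by rewrite /bil /dotv mulmxA. Qed.

Lemma bilDl n (u v x : 'cV[R]_n) (A : 'M[R]_n) : bil (u + v) A x = bil u A x + bil v A x.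
Proof. by rewrite !bil_dotv dotvDl. Qed.

Lemma bilDr n (u v x : 'cV[R]_n) (A : 'M[R]_n) : bil x A (u + v) = bil x A u + bil x A v.
Proof. by rewrite !bil_dotv mulmxDr dotvDr. Qed.

Lemma bilZl n a (u x : 'cV[R]_n) (A : 'M[R]_n) : bil (a *: u) A x = a * bil u A x.
Proof. by rewrite !bil_dotv dotvZl. Qed.

Lemma bilZr n a (u x : 'cV[R]_n) (A : 'M[R]_n) : bil x A (a *: u) = a * bil x A u.
Proof. by rewrite !bil_dotv -scalemxAr dotvZr. Qed.

Lemma bilDm n (u x : 'cV[R]_n) (A B : 'M[R]_n) : bil u (A + B) x = bil u A x + bil u B x.
Proof. by rewrite !bil_dotv mulmxDl dotvDr. Qed.

Lemma bilZm n a (u x : 'cV[R]_n) (A : 'M[R]_n) : bil u (a *: A) x = a * bil u A x.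
Proof. by rewrite !bil_dotv -scalemxAl dotvZr. Qed.

Lemma bil_scalar n a (u x : 'cV[R]_n) : bil u a%:M x = a * dotv u x.
Proof. by rewrite bil_dotv mul_scalar_mx dotvZr. Qed.

Lemma bil_mulmx m n (u v : 'cV[R]_m) (A : 'M[R]_(m, n)) (B : 'M[R]_n) :
  bil u (A *m B *m A^T) v = bil (A^T *m u) B (A^T *m v).
Proof. by rewrite /bil trmx_mul trmxK !mulmxA. Qed.

Lemma bilE n (u : 'cV[R]_n) (A : 'M[R]_n) v :
  bil u A v = \sum_i \sum_j u i 0 * A i j * v j 0.
Proof.
rewrite bil_dotv dotvE; apply: eq_bigr => i _.
by rewrite mxE mulr_sumr; apply: eq_bigr => j _; rewrite mulrA.
Qed.

Lemma vnorm_sqr n (x : 'cV[R]_n) : vnorm x ^+ 2 = dotv x x.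
Proof.
by rewrite /vnorm sqr_sqrtr ?sumr_ge0// => [|i _]; rewrite ?sqr_ge0// dotvE.
Qed.

Lemma vnorm_ge0 n (x : 'cV[R]_n) : 0 <= vnorm x.
Proof. exact: sqrtr_ge0. Qed.

Lemma dotvv_ge0 n (x : 'cV[R]_n) : 0 <= dotv x x.
Proof. by rewrite -vnorm_sqr sqr_ge0. Qed.

Lemma dotvv_gt0 n (x : 'cV[R]_n) : x != 0 -> 0 < dotv x x.
Proof.
move=> x0; rewrite lt_neqAle dotvv_ge0 andbT eq_sym; apply: contra x0.
rewrite dotvE psumr_eq0 => [/allP h|i _]; last by rewrite -expr2 sqr_ge0.
apply/eqP/matrixP => i j; rewrite ord1 mxE.
by have := h i (mem_index_enum _); rewrite mulf_eq0 orbb => /eqP.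
Qed.

Lemma sum_cauchy_schwarz (I : finType) (a b : I -> R) :
  (\sum_i a i * b i) ^+ 2 <= (\sum_i a i ^+ 2) * (\sum_i b i ^+ 2).
Proof.
set S := \sum_i a i * b i; set A := \sum_i a i ^+ 2; set B := \sum_i b i ^+ 2.
have B0 : 0 <= B by apply: sumr_ge0 => i _; rewrite sqr_ge0.
have [B0'|Bn0] := eqVneq B 0.
  have b0 i : b i = 0.
    have := B0'; rewrite /B => /eqP; rewrite psumr_eq0 => [/allP/(_ i)|? _].
      by rewrite mem_index_enum sqrf_eq0 => /(_ isT)/eqP.
    exact: sqr_ge0.
  rewrite [S]big1 ?expr0n ?mulr_ge0//= ?sumr_ge0// => [i _|i _]; last by rewrite b0 mulr0.
  exact: sqr_ge0.
have : 0 <= \sum_i (B * a i - S * b i) ^+ 2 by apply: sumr_ge0 => i _; exact: sqr_ge0.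
have -> : \sum_i (B * a i - S * b i) ^+ 2 = B * (B * A - S ^+ 2).
  transitivity (\sum_i (B ^+ 2 * a i ^+ 2 - B * S *+ 2 * (a i * b i) + S ^+ 2 * b i ^+ 2)).
    by apply: eq_bigr => i _; rewrite mulr2n; ring.
  rewrite !big_split/= sumrN -!mulr_sumr -/S -/A -/B mulr2n; ring.
by rewrite pmulr_rge0 ?lt_neqAle 1?eq_sym ?Bn0// subr_ge0 mulrC.
Qed.

Lemma dotv_cauchy_schwarz n (u v : 'cV[R]_n) : dotv u v ^+ 2 <= dotv u u * dotv v v.
Proof. by rewrite !dotvE; exact: sum_cauchy_schwarz. Qed.

Lemma frob2_ge0 m n (U : 'M[R]_(m, n)) : 0 <= frob2 U.
Proof. by apply: sumr_ge0 => i _; apply: sumr_ge0 => j _; rewrite sqr_ge0. Qed.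

Lemma frob2_trace m n (U : 'M[R]_(m, n)) : frob2 U = \tr (U *m U^T).
Proof.
rewrite /frob2 /mxtrace; apply: eq_bigr => i _; rewrite mxE; apply: eq_bigr => j _.
by rewrite mxE expr2.
Qed.

Lemma frob2_tr m n (U : 'M[R]_(m, n)) : frob2 U^T = frob2 U.
Proof. by rewrite !frob2_trace trmxK mxtrace_mulC. Qed.

Lemma frob2_rows m n (U : 'M[R]_(m, n)) :
  frob2 U = \sum_i dotv (row i U)^T (row i U)^T.
Proof.
by apply: eq_bigr => i _; rewrite dotvE; apply: eq_bigr => j _; rewrite !mxE expr2.
Qed.

Lemma mulmx_dotv_row m n (A : 'M[R]_(m, n)) (x : 'cV[R]_n) i :
  (A *m x) i 0 = dotv (row i A)^T x.
Proof. by rewrite dotvE mxE; apply: eq_bigr => k _; rewrite !mxE. Qed.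

Lemma dotv_mulmx_sum m n (A : 'M[R]_(m, n)) (x : 'cV[R]_n) :
  dotv (A *m x) (A *m x) = \sum_i dotv (row i A)^T x ^+ 2.
Proof. by rewrite dotvE; apply: eq_bigr => i _; rewrite mulmx_dotv_row expr2. Qed.

Lemma dotv_mulmx_le m n (A : 'M[R]_(m, n)) (x : 'cV[R]_n) :
  dotv (A *m x) (A *m x) <= frob2 A * dotv x x.
Proof.
rewrite dotv_mulmx_sum frob2_rows mulr_suml; apply: ler_sum => i _.
exact: dotv_cauchy_schwarz.
Qed.

Lemma posdef_ge0 n (A : 'M[R]_n) x : posdef A -> 0 <= bil x A x.
Proof.
move=> [_ A0]; have [->|/A0/ltW//] := eqVneq x 0.
by rewrite bil_dotv mulmx0 dotvC dotv0l.
Qed.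

Lemma posdefD n (A B : 'M[R]_n) : posdef A -> posdef B -> posdef (A + B).
Proof.
move=> [sA pA] [sB pB]; split; first by rewrite linearD/= sA sB.
by move=> x x0; rewrite bilDm addr_gt0 ?pA ?pB.
Qed.

Lemma posdefZ n a (A : 'M[R]_n) : 0 < a -> posdef A -> posdef (a *: A).
Proof.
move=> a0 [sA pA]; split; first by rewrite linearZ/= sA.
by move=> x x0; rewrite bilZm mulr_gt0 ?pA.
Qed.

Lemma posdef_scalar n a : 0 < a -> posdef (a%:M : 'M[R]_n).
Proof.
move=> a0; split; first by rewrite tr_scalar_mx.
by move=> x x0; rewrite bil_scalar mulr_gt0 ?dotvv_gt0.
Qed.

(** Induction through the Schur complement of the upper-left entry. The factor serves to turn the
    quadratic form of a proxy covariance into a squared norm. *)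
Lemma cholesky n (A : 'M[R]_n) : posdef A -> exists G : 'M[R]_n, A = G *m G^T.
Proof.
elim: n A => [A _|n IH A [sA pA]]; first by exists 0; apply/matrixP => -[].
rewrite -[n.+1]/(1 + n)%N in A sA pA *.
pose a := A (lshift n 0) (lshift n 0).
pose u : 'cV[R]_n := dlsubmx A.
pose D : 'M[R]_n := drsubmx A.
have eA : A = block_mx a%:M u^T u D.
  rewrite -[LHS]submxK; congr block_mx; first by apply/matrixP => i j; rewrite !ord1 !mxE eqxx.
  by rewrite /u -[in RHS]sA trmx_dlsub trmxK.
have sD : D^T = D by rewrite /D -[in RHS]sA trmx_drsub.
have bA (s : R) (x : 'cV[R]_n) :
    bil (col_mx s%:M x) A (col_mx s%:M x) = s ^+ 2 * a + s * dotv u x *+ 2 + bil x D x.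
  rewrite /bil eA tr_col_mx mul_row_block mul_row_col !mulmxDl.
  rewrite tr_scalar_mx -!scalar_mxM mul_mx_scalar mul_scalar_mx -scalemxAl.
  have -> : x^T *m u = u^T *m x.
    by apply/matrixP => i j; rewrite !ord1; exact: dotvC.
  rewrite -/(dotv u x) /dotv; set Q := u^T *m x; set T := x^T *m D *m x.
  by rewrite !mxE eqxx mulr1n mulr2n; ring.
have a0 : 0 < a.
  have : 0 < bil (col_mx 1%:M 0 : 'cV[R]_(1 + n)) A (col_mx 1%:M 0).
    apply: pA; apply/eqP => /matrixP/(_ (lshift n 0) 0); rewrite col_mxEu !mxE eqxx => /eqP.
    by rewrite oner_eq0.
  rewrite bA dotvC dotv0l bil_dotv dotv0l; lra.
pose D' := D - a^-1 *: (u *m u^T).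
have pD' : posdef D'.
  split; first by rewrite /D' linearB linearZ/= trmx_mul trmxK sD.
  move=> x x0.
  (* For given [x] the first coordinate is chosen to minimise the quadratic form of [A]; the minimum
     is the form of the Schur complement at [x]. *)
  have : 0 < bil (col_mx (- (dotv u x / a))%:M x) A (col_mx (- (dotv u x / a))%:M x).
    apply: pA; apply: contraNneq x0 => e; apply/eqP/matrixP => i j.
    by move/matrixP/(_ (rshift 1 i) j): e; rewrite col_mxEd !mxE.
  rewrite bA.
  have -> : bil x D' x = bil x D x - a^-1 * dotv u x ^+ 2.
    rewrite /D' bilDm -scaleNr bilZm mulNr; congr (_ - _ * _).
    by rewrite bil_dotv -mulmxA dotv_mulmxr dotvE big_ord1 expr2 !mxE; congr (_ * _);
       rewrite dotvE; apply: eq_bigr => k _; rewrite !mxE.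
  suff -> : (- (dotv u x / a)) ^+ 2 * a + - (dotv u x / a) * dotv u x *+ 2 =
     - (a^-1 * dotv u x ^+ 2) by rewrite addrC.
  by field; rewrite gt_eqF.
have [G' eG'] := IH _ pD'.
pose b := Num.sqrt a.
have b0 : b != 0 by rewrite gt_eqF// sqrtr_gt0.
have bb : b * b = a by rewrite -expr2 sqr_sqrtr// ltW.
exists (block_mx b%:M 0 (b^-1 *: u) G').
rewrite tr_block_mx mulmx_block !trmx0 !mul0mx !mulmx0 !addr0 tr_scalar_mx -scalar_mxM bb eA.
congr block_mx.
- by rewrite mul_scalar_mx linearZ/= scalerA divff// scale1r.
- by rewrite mul_mx_scalar scalerA divff// scale1r.
- rewrite -eG' /D' linearZ/= -scalemxAl -scalemxAr scalerA -invfM bb.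
  by rewrite addrC subrK.
Qed.

Lemma vnorm_mulmx_le m n (A : 'M[R]_(m, n)) (x : 'cV[R]_n) :
  vnorm (A *m x) <= Num.sqrt (frob2 A) * vnorm x.
Proof.
rewrite -(@ler_pXn2r _ 2)// ?nnegrE ?mulr_ge0 ?sqrtr_ge0//.
by rewrite exprMn !vnorm_sqr sqr_sqrtr ?frob2_ge0// dotv_mulmx_le.
Qed.

Lemma opnorm_has_ubound m n (A : 'M[R]_(m, n)) :
  has_ubound [set vnorm (A *m x) | x in [set x : 'cV[R]_n | vnorm x = 1]].
Proof.
exists (Num.sqrt (frob2 A)) => _ [x /= x1 <-].
by apply: le_trans (vnorm_mulmx_le _ _) _; rewrite x1 mulr1.
Qed.

Lemma vnormZ n a (x : 'cV[R]_n) : 0 <= a -> vnorm (a *: x) = a * vnorm x.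
Proof.
move=> a0; apply/eqP; rewrite -(@eqrXn2 _ 2) ?mulr_ge0 ?vnorm_ge0//.
by rewrite exprMn !vnorm_sqr dotvZl dotvZr expr2 mulrA.
Qed.

Lemma vnorm_gt0 n (x : 'cV[R]_n) : x != 0 -> 0 < vnorm x.
Proof. by move=> /dotvv_gt0; rewrite -vnorm_sqr exprn_even_gt0//= lt_neqAle vnorm_ge0 eq_sym => ->. Qed.

Lemma vnorm_mulmx_opnorm m n (A : 'M[R]_(m, n)) (x : 'cV[R]_n) :
  vnorm (A *m x) <= opnorm A * vnorm x.
Proof.
have [->|x0] := eqVneq x 0.
  by rewrite mulmx0 /vnorm big1 ?big1 ?sqrtr0 ?mulr0// => i _; rewrite mxE expr0n.
have vx := vnorm_gt0 x0.
rewrite -ler_pdivrMr//.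
have -> : vnorm (A *m x) / vnorm x = vnorm (A *m ((vnorm x)^-1 *: x)).
  by rewrite -scalemxAr vnormZ ?invr_ge0 ?vnorm_ge0// mulrC.
apply: sup_upper_bound.
  split; last exact: opnorm_has_ubound.
  exists (vnorm (A *m ((vnorm x)^-1 *: x))), ((vnorm x)^-1 *: x) => //=.
  by rewrite vnormZ ?invr_ge0 ?vnorm_ge0// mulVf// gt_eqF.
exists ((vnorm x)^-1 *: x) => //=.
by rewrite vnormZ ?invr_ge0 ?vnorm_ge0// mulVf// gt_eqF.
Qed.

Lemma bil_le_opnorm n (A : 'M[R]_n) (x : 'cV[R]_n) :
  bil x A x <= opnorm A * dotv x x.
Proof.
rewrite -vnorm_sqr bil_dotv expr2 mulrCA.
apply: le_trans (ler_norm _) _.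
have h : `|dotv x (A *m x)| <= vnorm x * vnorm (A *m x).
  rewrite -(@ler_pXn2r _ 2)// ?nnegrE ?mulr_ge0 ?vnorm_ge0//.
  by rewrite real_normK ?num_real// exprMn !vnorm_sqr dotv_cauchy_schwarz.
apply: le_trans h _; rewrite ler_wpM2l ?vnorm_ge0//.
exact: vnorm_mulmx_opnorm.
Qed.

Lemma opnorm_gt0 n (A : 'M[R]_n.+1) : posdef A -> 0 < opnorm A.
Proof.
move=> [_ pA]; pose x : 'cV[R]_n.+1 := const_mx 1.
have x0 : x != 0 by apply/eqP => /matrixP/(_ 0 0); rewrite !mxE => /eqP; rewrite oner_eq0.
have := lt_le_trans (pA _ x0) (bil_le_opnorm A x).
by rewrite pmulr_lgt0// dotvv_gt0.
Qed.

Lemma trace_conj_sum m n (A : 'M[R]_(m, n)) (B : 'M[R]_n) :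
  \tr (A *m B *m A^T) = \sum_i bil (row i A)^T B (row i A)^T.
Proof.
apply: eq_bigr => i _; rewrite /bil trmxK -row_mul !mxE.
by apply: eq_bigr => k _; rewrite !mxE.
Qed.

Lemma trace_conj_le m n (A : 'M[R]_(m, n)) (B : 'M[R]_n) :
  \tr (A *m B *m A^T) <= opnorm B * frob2 A.
Proof.
rewrite trace_conj_sum frob2_rows mulr_sumr; apply: ler_sum => i _.
exact: bil_le_opnorm.
Qed.

Lemma trace_sqr_ge0 n (A : 'M[R]_n) : A^T = A -> 0 <= \tr (A *m A).
Proof. by move=> sA; rewrite -{2}sA -frob2_trace frob2_ge0. Qed.

(** Cauchy-Schwarz against the all-ones vector, the squared diagonal being part of the Frobenius
    norm. It lets (A1), which controls [tr (L L)], control [tr L] as well. *)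
Lemma trace_sqr_le n (A : 'M[R]_n) : A^T = A -> (\tr A) ^+ 2 <= n%:R * \tr (A *m A).
Proof.
move=> sA; have := sum_cauchy_schwarz (fun _ : 'I_n => 1) (fun i => A i i).
under eq_bigr do rewrite mul1r.
rewrite [X in _ <= X * _](eq_bigr (fun=> 1)) => [|i _]; last by rewrite expr1n.
rewrite sumr_const card_ord => h; apply: le_trans h _.
rewrite ler_wpM2l ?ler0n// -{3}sA -frob2_trace; apply: ler_sum => i _.
by rewrite (bigD1 i)//= lerDl sumr_ge0// => j _; rewrite sqr_ge0.
Qed.

Lemma posdef_trace_ge0 n (A : 'M[R]_n) : posdef A -> 0 <= \tr A.
Proof.
move=> /posdef_ge0 h; apply: sumr_ge0 => i _.
by have := h (delta_mx i 0); rewrite /bil trmx_delta -rowE -colE !mxE.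
Qed.

Definition frobdot m n (U V : 'M[R]_(m, n)) : R := \sum_i \sum_j U i j * V i j.

Lemma frobdot_cauchy_schwarz m n (U V : 'M[R]_(m, n)) :
  frobdot U V ^+ 2 <= frob2 U * frob2 V.
Proof.
rewrite /frobdot /frob2 !pair_bigA/=.
exact: (sum_cauchy_schwarz (fun p => U p.1 p.2) (fun p => V p.1 p.2)).
Qed.

Lemma frobdot_frob2 m n (U : 'M[R]_(m, n)) : frobdot U U = frob2 U.
Proof. by apply: eq_bigr => i _; apply: eq_bigr => j _; rewrite expr2. Qed.

Lemma frob2D m n (U V : 'M[R]_(m, n)) :
  frob2 (U + V) = frob2 U + frobdot U V *+ 2 + frob2 V.
Proof.
rewrite /frob2 /frobdot -sumrMnl -!big_split/=; apply: eq_bigr => i _.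
by rewrite -sumrMnl -!big_split/=; apply: eq_bigr => j _; rewrite mxE sqrrD.
Qed.

Lemma frobdotZr m n a (U V : 'M[R]_(m, n)) : frobdot U (a *: V) = a * frobdot U V.
Proof.
rewrite /frobdot mulr_sumr; apply: eq_bigr => i _; rewrite mulr_sumr.
by apply: eq_bigr => j _; rewrite mxE mulrCA.
Qed.

Lemma frobdotBr m n (U V W : 'M[R]_(m, n)) :
  frobdot U (V - W) = frobdot U V - frobdot U W.
Proof.
rewrite /frobdot -sumrB; apply: eq_bigr => i _; rewrite -sumrB.
by apply: eq_bigr => j _; rewrite !mxE mulrBr.
Qed.

Lemma frobdot_sumr m n (J : Type) (s : seq J) (U : 'M[R]_(m, n)) (V : J -> 'M[R]_(m, n)) :
  frobdot U (\sum_(j <- s) V j) = \sum_(j <- s) frobdot U (V j).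
Proof.
rewrite /frobdot [RHS]exchange_big/=; apply: eq_bigr => i _.
rewrite exchange_big/=; apply: eq_bigr => j _.
by rewrite summxE mulr_sumr.
Qed.

Lemma frobdot_outer n (U : 'M[R]_n) (a b : 'cV[R]_n) :
  frobdot U (a *m b^T) = bil a U b.
Proof.
rewrite bilE; apply: eq_bigr => i _; apply: eq_bigr => j _.
by rewrite mxE big_ord1 mxE mulrA [U i j * _]mulrC.
Qed.

Lemma frobdot1 n (U : 'M[R]_n) : frobdot U 1%:M = \tr U.
Proof.
apply: eq_bigr => i _; rewrite (bigD1 i)//= mxE eqxx mulr1 big1 ?addr0// => j ji.
by rewrite mxE eq_sym (negbTE ji) mulr0.
Qed.

Lemma frob2Z m n a (U : 'M[R]_(m, n)) : frob2 (a *: U) = a ^+ 2 * frob2 U.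
Proof.
rewrite /frob2 mulr_sumr; apply: eq_bigr => i _; rewrite mulr_sumr.
by apply: eq_bigr => j _; rewrite mxE exprMn.
Qed.

Lemma frobdot_outer_outer m n (a a' : 'cV[R]_m) (b b' : 'cV[R]_n) :
  frobdot (a *m b^T) (a' *m b'^T) = dotv a a' * dotv b b'.
Proof.
rewrite !dotvE mulr_suml; apply: eq_bigr => i _; rewrite mulr_sumr.
by apply: eq_bigr => j _; rewrite !mxE !big_ord1 !mxE; ring.
Qed.

End LinearAlgebra.

(** * Sub-Gaussian vectors *)

Section Gaussian.
Context {R : realType}.
Local Notation mu := (@lebesgue_measure R).

(** The explicit density has the same integrals over measurable sets as the Radon-Nikodym
    derivative, hence equals it almost everywhere; the change of variables is then available. *)
Lemma ge0_integral_normal_prob (m s : R) (f : R -> \bar R) :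
  measurable_fun setT f -> (forall x, 0 <= f x)%E ->
  (\int[normal_prob m s]_x f x = \int[mu]_x (f x * (normal_pdf m s x)%:E))%E.
Proof.
move=> mf f0.
have nd := @normal_prob_dominates R m s.
rewrite -(Radon_Nikodym_SigmaFinite.change_of_variables nd)//.
apply: ae_eq_integral => //.
- apply: emeasurable_funM => //.
  exact: measurable_int (Radon_Nikodym_SigmaFinite.f_integrable nd).
- apply: emeasurable_funM => //; apply/measurable_EFinP; exact: measurable_normal_pdf.
- have : ae_eq mu setT (Radon_Nikodym_SigmaFinite.f (normal_prob m s) mu)
     (fun x => (normal_pdf m s x)%:E); last first.
    by apply: filterS => x hx Dx; rewrite hx.
  apply: integral_ae_eq => //.
  + exact: Radon_Nikodym_SigmaFinite.f_integrable.
  + by apply/measurable_EFinP; exact: measurable_normal_pdf.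
  + by move=> A _ mA; rewrite -Radon_Nikodym_SigmaFinite.f_integral.
Qed.

Lemma normal_prob_mgf (s t : R) : 0 < s ->
  (\int[normal_prob 0 s]_x (expR (t * x))%:E = (expR (t ^+ 2 * s ^+ 2 / 2))%:E)%E.
Proof.
move=> s0.
have mexp : measurable_fun setT (fun x : R => expR (t * x)).
  by apply: measurableT_comp => //; exact: mulrl_measurable.
rewrite ge0_integral_normal_prob; last 2 first.
- exact/measurable_EFinP.
- by move=> x; rewrite lee_fin expR_ge0.
under eq_integral => x _.
  rewrite -EFinM.
  (* Completing the square: the exponential tilt moves the mean to t s^2 and keeps the variance. *)
  have -> : expR (t * x) * normal_pdf 0 s x =
      expR (t ^+ 2 * s ^+ 2 / 2) * normal_pdf (t * s ^+ 2) s x.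
    rewrite !normal_pdfE ?gt_eqF// /normal_fun mulrCA [RHS]mulrCA -!expRD.
    congr (_ * expR _); field; first by rewrite gt_eqF.
  rewrite EFinM.
  over.
rewrite ge0_integralZl_EFin ?expR_ge0//.
- by rewrite integral_normal_pdf mule1.
- by move=> x _; rewrite lee_fin normal_pdf_ge0.
- by apply/measurable_EFinP; exact: measurable_normal_pdf.
Qed.

(** The integrand against the density is sqrt 2 times the density of N(0, 2), so the exact value is
    sqrt 2. The rounded value 2 is the prefactor of the tails below. *)
Lemma normal_prob_expR_sqr :
  (\int[normal_prob 0 1]_x (expR (x ^+ 2 / 4))%:E <= (2 : R)%:E)%E.
Proof.
have s2 : Num.sqrt 2 != 0 :> R by rewrite gt_eqF// sqrtr_gt0.
have mexp : measurable_fun setT (fun x : R => expR (x ^+ 2 / 4)).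
  apply: measurableT_comp => //; apply: measurable_funM => //; exact: exprn_measurable.
rewrite ge0_integral_normal_prob; last 2 first.
- exact/measurable_EFinP.
- by move=> x; rewrite lee_fin expR_ge0.
have mp : measurable_fun setT (fun x : R => (normal_pdf 0 (Num.sqrt 2) x)%:E).
  by apply/measurable_EFinP; exact: measurable_normal_pdf.
rewrite -[leRHS]mule1 -(integral_normal_pdf 0 (Num.sqrt (2 : R))).
rewrite -ge0_integralZl_EFin//; last first.
  by move=> x _; rewrite lee_fin normal_pdf_ge0.
apply: ge0_le_integral => //.
- by move=> x _; rewrite -EFinM lee_fin mulr_ge0 ?expR_ge0 ?normal_pdf_ge0.
- apply: emeasurable_funM; first exact/measurable_EFinP.
  by apply/measurable_EFinP; exact: measurable_normal_pdf.
- exact: measurable_funeM.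
- move=> x _; rewrite -!EFinM lee_fin !normal_pdfE ?oner_neq0//.
  rewrite /normal_fun mulrCA -expRD mulrA.
  have -> : x ^+ 2 / 4 + - (x - 0) ^+ 2 / (1 ^+ 2 *+ 2) =
     - (x - 0) ^+ 2 / (Num.sqrt 2 ^+ 2 *+ 2).
    by rewrite sqr_sqrtr//; field.
  apply: ler_wpM2r; rewrite ?expR_ge0//.
  rewrite /normal_peak sqr_sqrtr// expr1n mul1r -mulrnAr sqrtrM//.
  have a0 : 0 < Num.sqrt (pi *+ 2 : R) by rewrite sqrtr_gt0 pmulrn_lgt0// pi_gt0.
  have q0 : 0 < Num.sqrt (2 : R) by rewrite sqrtr_gt0.
  rewrite invfM mulrA ler_peMl ?invr_ge0 ?(ltW a0)//.
  rewrite ler_pdivlMr// mul1r -(@ler_pXn2r _ 2) ?nnegrE ?ltW//.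
  by rewrite sqr_sqrtr//; lra.
Qed.
End Gaussian.

(** * Measurability of random vectors and of forms in them *)

Section VectorMeasurability.
Context {R : realType} {d : measure_display} {T : measurableType d}.

Lemma measurable_sumr (I : Type) (s : seq I) (Q : pred I) (f : I -> T -> R) :
  (forall i, measurable_fun setT (f i)) ->
  measurable_fun setT (fun w => \sum_(i <- s | Q i) f i w).
Proof.
move=> mf; elim: s => [|i s IH].
  rewrite (_ : (fun w => _) = cst 0)//.
  by apply/funext => w; rewrite big_nil.
rewrite (_ : (fun w => _) = (fun w => (if Q i then f i w else 0) + \sum_(i <- s | Q i) f i w)).
  by apply: measurable_funD => //; case: (Q i).
by apply/funext => w; rewrite big_cons; case: ifP => //; rewrite add0r.
Qed.

Lemma rvecD n (u v : T -> 'cV[R]_n) : rvec u -> rvec v -> rvec (fun w => u w + v w).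
Proof.
by move=> mu mv k; under eq_fun do rewrite mxE; exact: measurable_funD.
Qed.

Lemma rvecZ n (a : T -> R) (u : T -> 'cV[R]_n) :
  measurable_fun setT a -> rvec u -> rvec (fun w => a w *: u w).
Proof.
by move=> ma mu k; under eq_fun do rewrite mxE; exact: measurable_funM.
Qed.

Lemma rvec_sum n (I : Type) (s : seq I) (Q : pred I) (u : I -> T -> 'cV[R]_n) :
  (forall i, rvec (u i)) -> rvec (fun w => \sum_(i <- s | Q i) u i w).
Proof.
move=> mu k; under eq_fun do rewrite summxE.
by apply: measurable_sumr => i; exact: mu.
Qed.

Lemma rvec_mulmx m n (A : 'M[R]_(m, n)) (u : T -> 'cV[R]_n) :
  rvec u -> rvec (fun w => A *m u w).
Proof.
move=> mu k; under eq_fun do rewrite mxE.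
by apply: measurable_sumr => i; exact: measurable_funM.
Qed.

Lemma measurable_dotv n (u v : T -> 'cV[R]_n) : rvec u -> rvec v ->
  measurable_fun setT (fun w => dotv (u w) (v w)).
Proof.
move=> mu mv; under eq_fun do rewrite dotvE.
by apply: measurable_sumr => i; exact: measurable_funM.
Qed.

Lemma rvec_cst n (u : 'cV[R]_n) : rvec (fun _ : T => u).
Proof. by move=> k; exact: measurable_cst. Qed.

Lemma measurable_dotv_cst n t (v : T -> 'cV[R]_n) : rvec v ->
  measurable_fun setT (fun w => dotv t (v w)).
Proof. by move=> mv; apply: measurable_dotv => //; exact: rvec_cst. Qed.

Lemma measurable_bil n (A : 'M[R]_n) (u v : T -> 'cV[R]_n) : rvec u -> rvec v ->
  measurable_fun setT (fun w => bil (u w) A (v w)).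
Proof.
move=> mu mv; under eq_fun do rewrite bil_dotv.
by apply: measurable_dotv => //; exact: rvec_mulmx.
Qed.

Lemma measurable_expR_comp (f : T -> R) : measurable_fun setT f ->
  measurable_fun setT (fun w => (expR (f w))%:E).
Proof. by move=> mf; apply/measurable_EFinP; exact: measurableT_comp. Qed.

Lemma measurable_le_cst (f : T -> R) (s : R) : measurable_fun setT f ->
  measurable [set w | s <= f w].
Proof.
move=> mf; rewrite (_ : [set w | _] = f @^-1` `[s, +oo[%classic).
  by rewrite -[X in measurable X]setTI; exact: mf.
by apply/seteqP; split => w /=; rewrite in_itv/= andbT.
Qed.

Lemma measurable_lt_cst (f : T -> R) (s : R) : measurable_fun setT f ->
  measurable [set w | f w < s].
Proof.
move=> mf; rewrite (_ : [set w | _] = f @^-1` `]-oo, s[%classic).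
  by rewrite -[X in measurable X]setTI; exact: mf.
by apply/seteqP; split => w /=; rewrite in_itv.
Qed.

End VectorMeasurability.

(** * Exponential moments of squares of sub-Gaussian variables *)

Section SubGaussian.
Context {R : realType} {dO : measure_display} {O : measurableType dO}
  (P : probability O R).

Lemma ge0_markov (f : O -> R) (s c : R) : measurable_fun setT f ->
  (forall w, 0 <= f w) -> 0 < s -> (\int[P]_w (f w)%:E <= c%:E)%E ->
  (P [set w | (s <= f w)%R] <= (c / s)%:E)%E.
Proof.
move=> mf f0 s0 fc; have mA := measurable_le_cst s mf.
rewrite -[X in P X]setIT -integral_indic//.
rewrite mulrC EFinM -lee_pdivrMl ?invr_gt0// invrK.
apply: le_trans fc; rewrite -ge0_integralZl_EFin ?(ltW s0)//; last first.
  by apply/measurable_EFinP; exact: measurable_indic.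
apply: ge0_le_integral => //.
- by move=> w _; rewrite -EFinM lee_fin mulr_ge0 ?(ltW s0).
- by apply/measurable_EFinP; apply: measurable_funM => //; exact: measurable_indic.
- exact/measurable_EFinP.
- move=> w _; rewrite -EFinM lee_fin indicE.
  by case: (boolP (w \in _)) => [|_]; rewrite ?inE/= ?mulr1 ?mulr0.
Qed.

Lemma expR_markov (X : O -> R) (t s c : R) : measurable_fun setT X -> 0 < t ->
  (\int[P]_w (expR (t * X w))%:E <= c%:E)%E ->
  (P [set w | (s <= X w)%R] <= (c * expR (- (t * s)))%:E)%E.
Proof.
move=> mX t0 h.
rewrite (_ : [set w | _] = [set w | expR (t * s) <= expR (t * X w)]); last first.
  by apply/seteqP; split => w /=; rewrite ler_expR ler_pM2l.
rewrite expRN; apply: ge0_markov => //; first by apply: measurableT_comp => //; exact: measurable_funM.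
exact: expR_gt0.
Qed.

Definition subg (X : O -> R) (V : R) : Prop :=
  forall t, (\int[P]_w (expR (t * X w))%:E <= (expR (t ^+ 2 * V / 2))%:E)%E.

(* [exp (l X^2)] is the average of [exp (sqrt (2 l) g X)] over a standard Gaussian [g]. *)
Lemma subg_expR_sqr (X : O -> R) (V l : R) : measurable_fun setT X ->
  subg X V -> 0 <= l -> l * V <= 1/4 ->
  (\int[P]_w (expR (l * X w ^+ 2))%:E <= 2%:E)%E.
Proof.
move=> mX sX l0 lV.
pose F (x : O * measurableTypeR R) : \bar R := (expR (Num.sqrt (2 * l) * x.2 * X x.1))%:E.
have mF : measurable_fun setT F.
  apply: measurable_expR_comp; apply: measurable_funM.
    by apply: measurable_funM => //; exact: measurable_snd.
  exact: (measurableT_comp mX measurable_fst).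
have F0 x : (0 <= F x)%E by rewrite lee_fin expR_ge0.
have s2 : Num.sqrt (2 * l) ^+ 2 = 2 * l by rewrite sqr_sqrtr// mulr_ge0.
have e1 w : (expR (l * X w ^+ 2))%:E = (\int[normal_prob 0 1]_g F (w, g))%E.
  under eq_integral do rewrite /F/= mulrAC.
  by rewrite normal_prob_mgf// exprMn s2; congr (expR _)%:E; field.
under eq_integral do rewrite e1.
rewrite (fubini_tonelli (m1 := P) (m2 := normal_prob 0 1) F)//.
apply: le_trans (@normal_prob_expR_sqr R); apply: ge0_le_integral => //.
- by move=> g _; apply: integral_ge0.
- exact: measurable_fun_fubini_tonelli_G.
- apply: measurable_expR_comp; apply: measurable_funM => //; exact: exprn_measurable.
- move=> g _; rewrite /fubini_G /F/=.
  apply: (le_trans (sX (Num.sqrt (2 * l) * g))); rewrite lee_fin ler_expR exprMn s2.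
  have -> : 2 * l * g ^+ 2 * V / 2 = g ^+ 2 * (l * V) by field.
  by rewrite ler_wpM2l ?sqr_ge0// -div1r.
Qed.

(** The tangent to exp at the mean lies below exp. The weights may sum to less than 1; the missing
    mass sits at 0, where exp equals 1. *)
Lemma expR_jensen (I : finType) (p a : I -> R) : (forall i, 0 <= p i) ->
  \sum_i p i <= 1 ->
  expR (\sum_i p i * a i) <= \sum_i p i * expR (a i) + (1 - \sum_i p i).
Proof.
move=> p0 p1; set m := \sum_i p i * a i.
have tangent x : expR m * (1 + (x - m)) <= expR x.
  by rewrite -[in leRHS](subrK m x) [in leRHS]addrC expRD ler_wpM2l ?expR_ge0 ?expR_ge1Dx.
have h : \sum_i p i * (expR m * (1 + (a i - m))) <= \sum_i p i * expR (a i).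
  by apply: ler_sum => i _; rewrite ler_wpM2l.
have h0 := ler_wpM2l (_ : 0 <= 1 - \sum_i p i) (tangent 0).
rewrite expR0 mulr1 in h0; have {}h0 := h0 (_ : is_true (0 <= 1 - \sum_i p i)).
have {}h0 : (1 - \sum_i p i) * (expR m * (1 + (0 - m))) <= 1 - \sum_i p i.
  by apply: h0; rewrite subr_ge0.
apply: le_trans (lerD h h0).
have -> : \sum_i p i * (expR m * (1 + (a i - m))) =
    expR m * ((1 - m) * (\sum_i p i) + m).
  rewrite /m [in RHS]mulr_sumr -big_split/= mulr_sumr; apply: eq_bigr => i _; ring.
rewrite le_eqVlt; apply/orP; left; apply/eqP; ring.
Qed.

(** The [X k] may be dependent: convexity of exp, applied to the average of [l k * X k ^+ 2] with
    weights [p k], takes the place of independence. *)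
Lemma subg_sum_expR_sqr n (X : 'I_n -> O -> R) (V : 'I_n -> R) (v : R) :
  (forall k, measurable_fun setT (X k)) -> (forall k, subg (X k) (V k)) ->
  (forall k, 0 <= V k) -> \sum_k V k <= v -> 0 < v ->
  (\int[P]_w (expR ((8 * v)^-1 * \sum_k X k w ^+ 2))%:E <= 2%:E)%E.
Proof.
move=> mX sX V0 Vv v0.
(* Weights follow the variance proxies. The share v / n keeps them positive when [V k] vanishes, and
   dividing by 2 v keeps their sum at most 1. Since p_k >= V_k / (2 v), the rate l_k = 1 / (8 v p_k)
   satisfies l_k V_k <= 1/4, as [subg_expR_sqr] demands. *)
pose p (k : 'I_n) := (V k + v / n%:R) / (2 * v).
have p0 k : 0 < p k.
  by rewrite divr_gt0 ?mulr_gt0// ltr_wpDl// divr_gt0// ltr0n (leq_ltn_trans _ (ltn_ord k)).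
have sp : \sum_k p k <= 1.
  rewrite -mulr_suml ler_pdivrMr ?mulr_gt0// mul1r big_split/= sumr_const card_ord.
  have : (v / n%:R) *+ n <= v.
    rewrite -mulr_natr; have [->|n0] := eqVneq n 0%N; first by rewrite mulr0 ltW.
    by rewrite divfK// pnatr_eq0.
  lra.
pose l k := (8 * v)^-1 / p k.
have El k : (\int[P]_w (expR (l k * X k w ^+ 2))%:E <= 2%:E)%E.
  apply: (subg_expR_sqr (mX k) (sX k)).
    by apply: divr_ge0 (ltW (p0 k)); rewrite invr_ge0 mulr_ge0 ?(ltW v0).
  rewrite /l mulrAC ler_pdivrMr//.
  have : V k / (2 * v) <= p k.
    by rewrite /p ler_wpM2r ?invr_ge0 ?mulr_ge0 ?(ltW v0)// lerDl divr_ge0// ltW.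
  have -> : (8 * v)^-1 * V k = 1/4 * (V k / (2 * v)) by field; rewrite gt_eqF.
  by move=> h; rewrite ler_wpM2l.
have mE k : measurable_fun setT (fun w => (p k * expR (l k * X k w ^+ 2))%:E).
  apply/measurable_EFinP; apply: measurable_funM => //; apply: measurableT_comp => //.
  by apply: measurable_funM => //; exact: measurable_funX.
have E0 k w : setT w -> (0 <= (p k * expR (l k * X k w ^+ 2))%:E)%E.
  by move=> _; rewrite lee_fin mulr_ge0 ?expR_ge0 ?ltW.
apply: (@le_trans _ _ (\int[P]_w (\sum_k (p k * expR (l k * X k w ^+ 2))%:E + (1 - \sum_k p k)%:E))%E).
  apply: ge0_le_integral => //.
  - apply: measurable_expR_comp; apply: measurable_funM => //.
    by apply: measurable_sumr => k; exact: measurable_funX.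
  - by apply: emeasurable_funD => //; exact: emeasurable_sum.
  - move=> w _; rewrite sumEFin -EFinD lee_fin.
    have -> : (8 * v)^-1 * \sum_k X k w ^+ 2 = \sum_k p k * (l k * X k w ^+ 2).
      rewrite mulr_sumr; apply: eq_bigr => k _; rewrite /l.
      by field; rewrite !gt_eqF.
    by apply: expR_jensen => // k; exact: ltW.
rewrite ge0_integralD//; last 3 first.
- by move=> w _; apply: sume_ge0 => k _; exact: E0.
- exact: emeasurable_sum.
- by move=> w _; rewrite lee_fin subr_ge0.
rewrite ge0_integral_sum// integral_cst//.
apply: (@le_trans _ _ (\sum_k (p k * 2)%:E + (1 - \sum_k p k)%:E)%E).
  apply: leeD.
    apply: lee_sum => k _; under eq_integral do rewrite EFinM.
    rewrite ge0_integralZl_EFin; [|by []| | |exact: ltW]; last 2 first.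
    - by move=> w _; rewrite lee_fin expR_ge0.
    - by apply: measurable_expR_comp; apply: measurable_funM => //; exact: measurable_funX.
    by rewrite [leRHS]EFinM; apply: lee_wpmul2l => //; rewrite lee_fin ltW.
  rewrite -[leRHS]mule1 lee_wpmul2l ?lee_fin ?subr_ge0//.
  exact: probability_le1.
rewrite sumEFin -EFinD lee_fin -mulr_suml; lra.
Qed.

End SubGaussian.

(** * Norms and inner products of sub-Gaussian vectors *)

Section SubGaussianVectors.
Context {R : realType} {dO : measure_display} {O : measurableType dO}
  (P : probability O R).

Definition psd n (G : 'M[R]_n) : Prop := forall t : 'cV[R]_n, 0 <= bil t G t.

Lemma posdef_psd n (G : 'M[R]_n) : posdef G -> psd G.
Proof. by move=> pG t; exact: posdef_ge0. Qed.

Lemma psd_conj m n (A : 'M[R]_(m, n)) (G : 'M[R]_n) : psd G -> psd (A *m G *m A^T).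
Proof. by move=> pG t; rewrite bil_mulmx. Qed.

(* sub-Gaussian random vector with proxy covariance [G] *)
Definition sgv n (X : O -> 'cV[R]_n) (G : 'M[R]_n) : Prop :=
  forall t : 'cV[R]_n,
    (\int[P]_w (expR (dotv t (X w)))%:E <= (expR (bil t G t / 2))%:E)%E.

Lemma sgv_subg n (X : O -> 'cV[R]_n) G t : sgv X G ->
  subg P (fun w => dotv t (X w)) (bil t G t).
Proof.
move=> sX a; have := sX (a *: t).
by rewrite bilZl bilZr mulrA -expr2; under eq_integral do rewrite dotvZl.
Qed.

Lemma sgv_mulmx m n (A : 'M[R]_(m, n)) (X : O -> 'cV[R]_n) G : sgv X G ->
  sgv (fun w => A *m X w) (A *m G *m A^T).
Proof.
move=> sX t; rewrite bil_mulmx.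
by under eq_integral do rewrite dotv_mulmxr; exact: sX.
Qed.

Lemma bil_delta n (G : 'M[R]_n) k : bil (delta_mx k 0) G (delta_mx k 0) = G k k.
Proof. by rewrite /bil trmx_delta -rowE -colE !mxE. Qed.

Lemma dotv_delta n (x : 'cV[R]_n) k : dotv (delta_mx k 0) x = x k 0.
Proof. by rewrite /dotv trmx_delta -rowE mxE. Qed.

Lemma sgv_expR_normsq n (X : O -> 'cV[R]_n) G v : rvec X -> sgv X G -> psd G ->
  \tr G <= v -> 0 < v ->
  (\int[P]_w (expR ((8 * v)^-1 * dotv (X w) (X w)))%:E <= 2%:E)%E.
Proof.
move=> mX sX pG Gv v0.
under eq_integral => w _.
  rewrite dotvE; under eq_bigr do rewrite -expr2; over.
apply: (@subg_sum_expR_sqr _ _ _ P n (fun k w => X w k 0) (fun k => G k k) v) => //.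
- move=> k; have := @sgv_subg _ X G (delta_mx k 0) sX; rewrite bil_delta.
  by under eq_fun do rewrite dotv_delta.
- by move=> k; rewrite -bil_delta.
Qed.

Lemma sgv_normsq_tail n (X : O -> 'cV[R]_n) G v s : rvec X -> sgv X G -> psd G ->
  \tr G <= v -> 0 < v ->
  (P [set w | (8 * v * s <= dotv (X w) (X w))%R] <= (2 * expR (- s))%:E)%E.
Proof.
move=> mX sX pG Gv v0.
have := @expR_markov _ _ _ P (fun w => dotv (X w) (X w)) (8 * v)^-1 (8 * v * s) 2.
rewrite mulrA mulVf ?mul1r; last by rewrite gt_eqF// mulr_gt0.
apply; [exact: measurable_dotv|by rewrite invr_gt0 mulr_gt0|].
exact: sgv_expR_normsq sX pG Gv v0.
Qed.

Section Independent.
Variables (I : finType) (m : I -> nat) (Z : forall i, O -> 'cV[R]_(m i)).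
Hypothesis HZ : indep_family P Z.

Lemma rvec_from_block n (S : {set I}) (u : O -> 'cV[R]_n) :
  rvec (u : blockType Z S -> _) -> rvec u.
Proof. by move=> mu k; apply: (measurable_from_block HZ) (mu k). Qed.

Lemma rvec_block_sub n (S S' : {set I}) (u : O -> 'cV[R]_n) : S \subset S' ->
  rvec (u : blockType Z S -> _) -> rvec (u : blockType Z S' -> _).
Proof. by move=> SS' mu k; exact: (measurable_block_sub SS' (mu k)). Qed.

Lemma sgvD_blocks n (S1 S2 : {set I}) (u v : O -> 'cV[R]_n) G H :
  [disjoint S1 & S2]%B ->
  rvec (u : blockType Z S1 -> _) -> rvec (v : blockType Z S2 -> _) ->
  sgv u G -> sgv v H -> sgv (fun w => u w + v w) (G + H).
Proof.
move=> S12 mu mv su sv t.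
under eq_integral do rewrite dotvDr expRD.
rewrite (expectation_mul_blocks HZ S12); last 4 first.
- by apply: measurableT_comp => //; exact: measurable_dotv_cst.
- by apply: measurableT_comp => //; exact: measurable_dotv_cst.
- by move=> w; exact: expR_ge0.
- by move=> w; exact: expR_ge0.
rewrite bilDm mulrDl expRD EFinM.
by apply: lee_pmul => //; apply: integral_ge0 => w _; rewrite lee_fin expR_ge0.
Qed.

Lemma sgv_sum_blocks n (J : finType) (s : seq J) (S : J -> {set I})
    (u : J -> O -> 'cV[R]_n) (G : J -> 'M[R]_n) : uniq s ->
  {in s &, forall j k, j != k -> [disjoint S j & S k]%B} ->
  (forall j, rvec (u j : blockType Z (S j) -> _)) ->
  (forall j, sgv (u j) (G j)) ->
  sgv (fun w => \sum_(j <- s) u j w) (\sum_(j <- s) G j).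
Proof.
move=> us dS mu su t.
have := @expectation_prod_blocks _ _ _ P I m Z HZ J s S
  (fun j w => expR (dotv t (u j w))) (fun j => expR (bil t (G j) t / 2)) us dS.
case.
- by move=> j; apply: measurableT_comp => //; exact: measurable_dotv_cst.
- by move=> j w; exact: expR_ge0.
- by move=> j; exact: su.
move=> _; rewrite -expR_sum -mulr_suml.
have -> : bil t (\sum_(j <- s) G j) t = \sum_(j <- s) bil t (G j) t.
  rewrite bil_dotv mulmx_suml dotv_sumr.
  by apply: eq_bigr => j _; rewrite bil_dotv.
by under eq_integral do rewrite -expR_sum -dotv_sumr.
Qed.

(** Integrating out [v] for fixed [u] leaves exp(a^2 |K^T u|^2 / 2) with a = 1 / (2 sqrt V), which
    is exp(|K^T u|^2 / (8 V)). The vector K^T u has proxy covariance K^T G K, of trace tr(G H) <= V,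
    so [sgv_expR_normsq] applies. The sign [c] gives access to both tails. *)
Lemma expR_dotv_blocks n (S1 S2 : {set I}) (u v : O -> 'cV[R]_n)
    (G H K : 'M[R]_n) V :
  [disjoint S1 & S2]%B ->
  rvec (u : blockType Z S1 -> _) -> rvec (v : blockType Z S2 -> _) ->
  sgv u G -> sgv v H -> psd G -> H = K *m K^T -> \tr (G *m H) <= V -> 0 < V ->
  forall c : R, c ^+ 2 = 1 ->
  (\int[P]_w (expR ((2 * Num.sqrt V)^-1 * (c * dotv (u w) (v w))))%:E <= 2%:E)%E.
Proof.
move=> S12 mu mv su sv pG eH GHV V0 c c1.
pose a := (2 * Num.sqrt V)^-1.
have a2 : a ^+ 2 = (4 * V)^-1.
  by rewrite /a exprVn exprMn sqr_sqrtr ?ltW//; congr (_ * _)^-1; ring.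
pose F (x : blockType Z S1 * blockType Z S2) : \bar R :=
  (expR (a * (c * dotv (u x.1) (v x.2))))%:E.
rewrite (_ : (\int[P]_w _ = \int[P]_w F (w, w))%E)//.
rewrite (tonelli_blocks HZ (f := F) S12); last 2 first.
- apply: measurable_expR_comp; apply: measurable_funM => //.
  apply: measurable_funM => //; apply: measurable_dotv => k.
    exact: (measurableT_comp (mu k) measurable_fst).
  exact: (measurableT_comp (mv k) measurable_snd).
- by move=> x; rewrite lee_fin expR_ge0.
have mKu : rvec (fun w => K^T *m u w) by apply: rvec_mulmx; exact: rvec_from_block mu.
apply: le_trans (sgv_expR_normsq (v := V) mKu (sgv_mulmx K^T su) _ _ V0); last 2 first.
- exact: psd_conj.
- by rewrite trmxK -mulmxA mxtrace_mulC -mulmxA -eH.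
apply: ge0_le_integral => //.
- by move=> w _; apply: integral_ge0 => w' _; rewrite lee_fin expR_ge0.
- pose F' (x : O * O) : \bar R := (expR (a * (c * dotv (u x.1) (v x.2))))%:E.
  have mF' : measurable_fun setT F'.
    apply: measurable_expR_comp; apply: measurable_funM => //.
    apply: measurable_funM => //; apply: measurable_dotv => k.
      exact: (measurableT_comp (rvec_from_block mu k) measurable_fst).
    exact: (measurableT_comp (rvec_from_block mv k) measurable_snd).
  have mFF : measurable_fun setT (fubini_F P F').
    by apply: measurable_fun_fubini_tonelli_F => // x; rewrite lee_fin expR_ge0.
  exact: mFF.
- by apply: measurable_expR_comp; apply: measurable_funM => //; exact: measurable_dotv.
- move=> w1 _; rewrite /F/=; have := sv ((a * c) *: u w1).
  under eq_integral do rewrite dotvZl -mulrA.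
  move=> h; apply: (le_trans h); rewrite lee_fin ler_expR eH.
  rewrite bilZl bilZr bil_dotv -mulmxA dotv_mulmxr.
  rewrite (_ : (8 * V)^-1 = a ^+ 2 * c ^+ 2 / 2); last first.
    by rewrite a2 c1; field; rewrite gt_eqF.
  by rewrite le_eqVlt; apply/orP; left; apply/eqP; field.
Qed.

Lemma dotv_blocks_tail n (S1 S2 : {set I}) (u v : O -> 'cV[R]_n)
    (G H K : 'M[R]_n) V t :
  [disjoint S1 & S2]%B ->
  rvec (u : blockType Z S1 -> _) -> rvec (v : blockType Z S2 -> _) ->
  sgv u G -> sgv v H -> psd G -> H = K *m K^T -> \tr (G *m H) <= V -> 0 < V ->
  (P [set w | (2 * Num.sqrt V * t <= `|dotv (u w) (v w)|)%R] <=
   (4 * expR (- t))%:E)%E.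
Proof.
move=> S12 mu mv su sv pG eH GHV V0.
have mO : measurable_fun setT (fun w => dotv (u w) (v w)).
  by apply: measurable_dotv; [exact: rvec_from_block mu|exact: rvec_from_block mv].
have q0 : 0 < 2 * Num.sqrt V by rewrite mulr_gt0// sqrtr_gt0.
have tail c : c ^+ 2 = 1 ->
    (P [set w | (2 * Num.sqrt V * t <= c * dotv (u w) (v w))%R] <= (2 * expR (- t))%:E)%E.
  move=> c1; have := @expR_markov _ _ _ P (fun w => c * dotv (u w) (v w))
    (2 * Num.sqrt V)^-1 (2 * Num.sqrt V * t) 2.
  rewrite mulrA mulVf ?mul1r; last by rewrite gt_eqF.
  apply; [exact: measurable_funM|by rewrite invr_gt0|].
  exact: (expR_dotv_blocks S12 mu mv su sv pG eH GHV V0 c1).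
have mc c : measurable [set w | (2 * Num.sqrt V * t <= c * dotv (u w) (v w))%R].
  by apply: measurable_le_cst; exact: measurable_funM.
apply: (@le_trans _ _ (P ([set w | (2 * Num.sqrt V * t <= 1 * dotv (u w) (v w))%R] `|`
    [set w | (2 * Num.sqrt V * t <= -1 * dotv (u w) (v w))%R]))).
  apply: le_measure; rewrite ?inE.
  - by apply: measurable_le_cst; exact: measurableT_comp.
  - exact: measurableU.
  - move=> w /=; rewrite mul1r mulN1r.
    by case: (ler0P (dotv (u w) (v w))) => _ h; [right|left].
apply: (le_trans (measureU2 _ _ _)) => //.
rewrite (_ : 4 * expR (- t) = 2 * expR (- t) + 2 * expR (- t)); last by ring.
by rewrite EFinD; apply: leeD; apply: tail; rewrite ?sqrrN expr1n.
Qed.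

End Independent.
End SubGaussianVectors.

(** * Moments of the uniform law on the sphere *)

Section Givens.
Context {R : realType} (n : nat) (i j : 'I_n) (s : R).

Definition givens_cos : R := Num.sqrt (1 - s ^+ 2).

(* the rotation of sine [s] in the plane (i, j) *)
Definition givens : 'M[R]_n := \matrix_(a, b)
  ((a == b)%:R + (a == i)%:R * ((givens_cos - 1) * (b == i)%:R + s * (b == j)%:R)
   + (a == j)%:R * ((givens_cos - 1) * (b == j)%:R - s * (b == i)%:R)).

Lemma sum_indicator (a : 'I_n) (f : 'I_n -> R) : \sum_b (a == b)%:R * f b = f a.
Proof.
rewrite (bigD1 a)//= eqxx mul1r big1 ?addr0// => b ba.
by rewrite eq_sym (negbTE ba) mul0r.
Qed.

Lemma sum_indicator' (a : 'I_n) (f : 'I_n -> R) : \sum_b (b == a)%:R * f b = f a.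
Proof. by under eq_bigr do rewrite eq_sym; exact: sum_indicator. Qed.

Lemma givens_mulE (x : 'cV[R]_n) a : (givens *m x) a 0 = x a 0
  + (a == i)%:R * ((givens_cos - 1) * x i 0 + s * x j 0)
  + (a == j)%:R * ((givens_cos - 1) * x j 0 - s * x i 0).
Proof.
rewrite mxE; under eq_bigr => b _ do rewrite mxE.
transitivity (\sum_b ((a == b)%:R * x b 0
  + (a == i)%:R * ((givens_cos - 1) * ((b == i)%:R * x b 0) + s * ((b == j)%:R * x b 0))
  + (a == j)%:R * ((givens_cos - 1) * ((b == j)%:R * x b 0) - s * ((b == i)%:R * x b 0)))).
  by apply: eq_bigr => b _; ring.
by rewrite !big_split/= -!mulr_sumr sumrB big_split/= -!mulr_sumr sum_indicator !sum_indicator'.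
Qed.

Hypotheses (ij : i != j) (s01 : 0 <= s <= 1).

Lemma givens_cos_sqr : givens_cos ^+ 2 = 1 - s ^+ 2.
Proof.
move: s01 => /andP[s0 s1].
by rewrite sqr_sqrtr// subr_ge0 expr_le1.
Qed.

(** From 0 <= cos <= 1 follows 1 - cos <= 1 - cos^2. To first order in the sine, a rotation is thus
    the identity plus its generator, with an explicit quadratic remainder. *)
Lemma givens_cos_dist : `|givens_cos - 1| <= s ^+ 2.
Proof.
move: s01 => /andP[s0 s1]; have c0 : 0 <= givens_cos by exact: sqrtr_ge0.
have := givens_cos_sqr; have := sqr_ge0 s => s2 c2.
have c1 : givens_cos <= 1 by rewrite -(@expr_le1 _ 2)// c2; lra.
by rewrite ler_norml; apply/andP; split; nra.
Qed.

Lemma givens_dotv (x y : 'cV[R]_n) : dotv (givens *m x) (givens *m y) = dotv x y.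
Proof.
have c2 := givens_cos_sqr.
rewrite !dotvE; under eq_bigr => a _ do rewrite !givens_mulE.
set a1 := _ + s * x j 0; set b1 := _ - s * x i 0.
set a2 := _ + s * y j 0; set b2 := _ - s * y i 0.
transitivity (\sum_a (x a 0 * y a 0
   + (a == i)%:R * (x a 0 * a2 + a1 * y a 0 + a1 * a2)
   + (a == j)%:R * (x a 0 * b2 + b1 * y a 0 + b1 * b2))).
  apply: eq_bigr => a _; have [->|ai] := eqVneq a i.
    by rewrite (negbTE ij) /= mulr1n mulr0n; ring.
  have [->|aj] := eqVneq a j.
    by rewrite /= mulr1n mulr0n; ring.
  by rewrite /= mulr0n; ring.
rewrite !big_split/= !sum_indicator' -!addrA -[RHS]addr0; congr (_ + _).
rewrite /a1 /a2 /b1 /b2.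
transitivity ((givens_cos ^+ 2 - (1 - s ^+ 2)) * (x i 0 * y i 0 + x j 0 * y j 0)).
  by ring.
by rewrite c2 subrr mul0r.
Qed.

Lemma givens_orthogonal : orthogonal_mx givens.
Proof.
apply/matrixP => a b.
have := givens_dotv (delta_mx a 0) (delta_mx b 0).
rewrite dotv_mulmxr mulmxA dotvC !dotv_delta -colE mxE => h.
have -> : (givens^T *m givens) a b = (givens^T *m givens) b a.
  by rewrite -[in LHS](trmxK (_ *m _)) trmx_mul trmxK mxE.
by rewrite h !mxE eqxx andbT eq_sym.
Qed.

Lemma givens_vnorm (x : 'cV[R]_n) : vnorm (givens *m x) = vnorm x.
Proof.
apply/eqP; rewrite -(@eqrXn2 _ 2) ?vnorm_ge0//.
by rewrite !vnorm_sqr givens_dotv.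
Qed.

End Givens.

(** * Laws of random vectors determined by rectangles *)

Section BorelVectors.
Import numFieldNormedType.Exports.
Context {R : realType} (n : nat).

Definition rect_gen : set (set 'cV[R]_n) :=
  [set B : set 'cV[R]_n | exists A : 'I_n -> set R, (forall k, measurable (A k)) /\
     B = [set x : 'cV[R]_n | forall k, A k (x k 0)]].

Definition borelV : measurableType (sigma_display rect_gen) :=
  g_sigma_algebraType rect_gen.

Lemma rvec_borelV : rvec (id : borelV -> 'cV[R]_n).
Proof.
move=> k _ B mB; rewrite setTI; apply: sub_sigma_algebra.
exists (fun l => if l == k then B else setT); split; first by move=> l; case: ifP.
apply/seteqP; split => [x Bx l|x /(_ k)] /=; last by rewrite eqxx.
by case: eqVneq => // ->.
Qed.

Lemma measurable_to_borelV d (T : measurableType d) (u : T -> 'cV[R]_n) :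
  rvec u -> measurable_fun setT (u : T -> borelV).
Proof.
move=> mu; apply: (@measurability _ _ T borelV setT u rect_gen erefl).
move=> _ [_ [A [mA ->]] <-]; rewrite setTI.
rewrite (_ : _ @^-1` _ = \bigcap_(k in [set: 'I_n]) ((fun w => u w k 0) @^-1` A k)); last first.
  by apply/seteqP; split => [w h k _|w h k]; exact: h.
apply: fin_bigcap_measurable => [|k _]; first exact: finite_finset.
by rewrite -[X in measurable X]setTI; exact: (mu k).
Qed.

Lemma rect_gen_setI : setI_closed rect_gen.
Proof.
move=> _ _ [A [mA ->]] [B [mB ->]].
exists (fun k => A k `&` B k); split; first by move=> k; exact: measurableI.
apply/seteqP; split => [x [h1 h2] k|x h]; first by split; [exact: h1|exact: h2].
by split => k; case: (h k).
Qed.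

Lemma rect_gen_setT : rect_gen setT.
Proof. by exists (fun=> setT); split => //; apply/seteqP; split. Qed.

Context {dO : measure_display} {O : measurableType dO} (P : probability O R).

(** Rectangles form a pi-system generating [borelV], so the two laws coincide. This carries rotation
    invariance from rectangles to expectations. *)
Lemma integral_same_rect_law (u v : O -> 'cV[R]_n) (F : borelV -> R) :
  rvec u -> rvec v ->
  (forall A : 'I_n -> set R, (forall k, measurable (A k)) ->
     P (rect_ev u A) = P (rect_ev v A)) ->
  measurable_fun setT F ->
  P.-integrable setT (fun w => (F (u w))%:E) ->
  P.-integrable setT (fun w => (F (v w))%:E) ->
  \int[P]_w F (u w) = \int[P]_w F (v w).
Proof.
move=> mu mv uv mF iu iv.
have Mu := measurable_to_borelV mu; have Mv := measurable_to_borelV mv.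
pose u' : {mfun O >-> borelV} := mfun_Sub (mem_set Mu).
pose v' : {mfun O >-> borelV} := mfun_Sub (mem_set Mv).
have e A : measurable A -> distribution P u' A = distribution P v' A.
  move=> mA; apply: (@measure_unique _ R borelV rect_gen (fun=> setT) erefl
    rect_gen_setI (fun=> rect_gen_setT) _ (distribution P u') (distribution P v')) => //.
  - by rewrite bigcup_const.
  - by move=> _ [B [mB ->]]; exact: uv.
  - by move=> _; rewrite ltey_eq fin_num_measure.
have mEF : measurable_fun setT (EFin \o F) by exact/measurable_EFinP.
rewrite /Rintegral; congr fine.
have := @integral_pushforward _ _ O borelV R u Mu P setT (EFin \o F) mEF.
have := @integral_pushforward _ _ O borelV R v Mv P setT (EFin \o F) mEF.
rewrite preimage_setT => /(_ iv measurableT) <- /(_ iu measurableT) <-.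
by apply: eq_measure_integral => A mA _; exact: e.
Qed.

End BorelVectors.

(** * Differentiation along plane rotations *)

Section SphereCalculus.
Import numFieldNormedType.Exports.
Context {R : realType} {n : nat} {dO : measure_display} {O : measurableType dO}
  (P : probability O R).
Variables (r : R) (U : O -> 'cV[R]_n).
Hypotheses (mU : rvec U) (nU : forall w, vnorm (U w) = r)
  (invU : forall Q : 'M[R]_n, orthogonal_mx Q ->
    forall A : 'I_n -> set R, (forall k, measurable (A k)) ->
      P (rect_ev (fun w => Q *m U w) A) = P (rect_ev U A)).

(** The bound is asked only on the sphere, where [U] takes its values: polynomials then qualify and
    are integrable. *)
Definition sbounded (F : 'cV[R]_n -> R) : Prop :=
  measurable_fun setT (F : borelV n -> R) /\
  exists K, forall x, vnorm x = r -> `|F x| <= K.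

Lemma sbounded_integrable (V : O -> 'cV[R]_n) F : rvec V ->
  (forall w, vnorm (V w) = r) -> sbounded F ->
  P.-integrable setT (fun w => (F (V w))%:E).
Proof.
move=> mV nV [mF [K FK]].
apply: (@le_integrable _ _ _ P setT measurableT _ (fun=> K%:E)).
- by apply/measurable_EFinP; exact: (measurableT_comp mF (measurable_to_borelV mV)).
- move=> w _ /=; rewrite lee_fin; apply: le_trans (FK _ (nV w)) _; exact: ler_norm.
- exact: finite_measure_integrable_cst.
Qed.

Definition smean (F : 'cV[R]_n -> R) : R := \int[P]_w F (U w).

Lemma smean_cst c : smean (fun=> c) = c.
Proof.
rewrite /smean Rintegral_cst// -[RHS]mulr1; congr (_ * _).
exact: (congr1 fine (probability_setT P)).
Qed.

Lemma smeanD F G : sbounded F -> sbounded G ->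
  smean (fun x => F x + G x) = smean F + smean G.
Proof. by move=> bF bG; rewrite /smean RintegralD//; exact: sbounded_integrable. Qed.

Lemma smeanZ c F : sbounded F -> smean (fun x => c * F x) = c * smean F.
Proof. by move=> bF; rewrite /smean RintegralZl//; exact: sbounded_integrable. Qed.

Lemma sbounded_cst c : sbounded (fun=> c).
Proof. by split; [exact: measurable_cst|exists `|c|]. Qed.

Lemma sboundedD F G : sbounded F -> sbounded G -> sbounded (fun x => F x + G x).
Proof.
move=> [mF [K FK]] [mG [L GL]]; split; first exact: measurable_funD.
by exists (K + L) => x xr; apply: le_trans (ler_normD _ _) _; rewrite lerD ?FK ?GL.
Qed.

Lemma sboundedM F G : sbounded F -> sbounded G -> sbounded (fun x => F x * G x).
Proof.
move=> [mF [K FK]] [mG [L GL]]; split; first exact: measurable_funM.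
by exists (K * L) => x xr; rewrite normrM ler_pM ?FK ?GL.
Qed.

Lemma sbounded_sum (I : Type) (s : seq I) (F : I -> 'cV[R]_n -> R) :
  (forall a, sbounded (F a)) -> sbounded (fun x => \sum_(a <- s) F a x).
Proof.
move=> bF; elim: s => [|a s IH].
  by under eq_fun do rewrite big_nil; exact: sbounded_cst.
by under eq_fun do rewrite big_cons; exact: sboundedD.
Qed.

Lemma smean_sum (I : Type) (s : seq I) (F : I -> 'cV[R]_n -> R) :
  (forall a, sbounded (F a)) ->
  smean (fun x => \sum_(a <- s) F a x) = \sum_(a <- s) smean (F a).
Proof.
move=> bF; elim: s => [|a s IH].
  by under eq_fun do rewrite big_nil; rewrite smean_cst big_nil.
under eq_fun do rewrite big_cons; rewrite smeanD ?big_cons ?IH//.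
exact: sbounded_sum.
Qed.

Lemma sboundedX F m : sbounded F -> sbounded (fun x => F x ^+ m).
Proof.
move=> bF; elim: m => [|m IH].
  by under eq_fun do rewrite expr0; exact: sbounded_cst.
by under eq_fun do rewrite exprS; exact: sboundedM.
Qed.

Lemma sbounded_coord a : sbounded (fun x => x a 0).
Proof.
split; first exact: rvec_borelV.
exists r => x <-; rewrite -(@ler_pXn2r _ 2) ?nnegrE ?vnorm_ge0//.
rewrite real_normK ?num_real// vnorm_sqr dotvE (bigD1 a)//= expr2 lerDl.
by apply: sumr_ge0 => b _; rewrite -expr2 sqr_ge0.
Qed.

Lemma le_smean F G : sbounded F -> sbounded G ->
  (forall x, vnorm x = r -> F x <= G x) -> smean F <= smean G.
Proof.
by move=> bF bG FG; apply: le_Rintegral => //;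
  [exact: sbounded_integrable|exact: sbounded_integrable|move=> w _; exact: FG].
Qed.

Lemma eq_smean F G : (forall x, vnorm x = r -> F x = G x) -> smean F = smean G.
Proof. by move=> FG; apply: eq_Rintegral => w _; exact: FG. Qed.

Lemma sbounded_givens i j s F : i != j -> 0 <= s <= 1 -> sbounded F ->
  sbounded (fun x => F (givens i j s *m x)).
Proof.
move=> ij s01 [mF [K FK]]; split; last first.
  by exists K => x xr; apply: FK; rewrite givens_vnorm.
apply: (measurableT_comp mF); apply: measurable_to_borelV.
by apply: rvec_mulmx; exact: rvec_borelV.
Qed.

Lemma smean_givens i j s F : i != j -> 0 <= s <= 1 -> sbounded F ->
  smean (fun x => F (givens i j s *m x)) = smean F.
Proof.
move=> ij s01 bF; apply: (integral_same_rect_law (F := F)) => //.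
- exact: rvec_mulmx.
- by move=> A mA; apply: invU => //; exact: givens_orthogonal.
- by case: bF.
- exact: (sbounded_integrable mU nU (sbounded_givens ij s01 bF)).
- exact: sbounded_integrable.
Qed.

(* [G] is the derivative of [F] along the rotations in the plane (i, j), parametrized by the sine of the
   angle, with a remainder uniform over the sphere. *)
Definition rderiv (i j : 'I_n) (F G : 'cV[R]_n -> R) : Prop :=
  [/\ sbounded F, sbounded G & exists K, forall s x, 0 <= s <= 1 -> vnorm x = r ->
     `|F (givens i j s *m x) - F x - s * G x| <= K * s ^+ 2].

(** Invariance makes the mean of F(Q_s x) - F(x) vanish, so |s E G| <= K s^2 for every s in (0, 1];
    dividing by s and taking s small leaves E G = 0. *)
Lemma smean_rderiv i j F G : i != j -> rderiv i j F G -> smean G = 0.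
Proof.
move=> ij [bF bG [K FG]].
have h s : 0 < s <= 1 -> `|smean G| <= K * s.
  move=> /andP[s0 s1]; have s01 : 0 <= s <= 1 by rewrite ltW.
  pose D x := (F (givens i j s *m x) + -1 * F x) + - s * G x.
  have bD : sbounded D.
    apply: sboundedD; first apply: sboundedD.
    - exact: sbounded_givens.
    - by apply: sboundedM => //; exact: sbounded_cst.
    - by apply: sboundedM => //; exact: sbounded_cst.
  have bG' : sbounded (fun x => - s * G x) by apply: sboundedM => //; exact: sbounded_cst.
  have bF' : sbounded (fun x => -1 * F x) by apply: sboundedM => //; exact: sbounded_cst.
  have bFg := sbounded_givens ij s01 bF.
  have e : smean D = - s * smean G.
    rewrite /D smeanD//; last exact: sboundedD.
    by rewrite smeanD// smean_givens// !smeanZ// mulN1r subrr add0r.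
  have Dx x : vnorm x = r -> `|D x| <= K * s ^+ 2.
    by move=> xr; rewrite /D mulN1r mulNr; exact: FG.
  have h1 : smean D <= K * s ^+ 2.
    rewrite -[leRHS]smean_cst; apply: le_smean => //; first exact: sbounded_cst.
    by move=> x xr; exact: le_trans (ler_norm _) (Dx x xr).
  have h2 : - (K * s ^+ 2) <= smean D.
    rewrite -[leLHS]smean_cst; apply: le_smean => //; first exact: sbounded_cst.
    by move=> x xr; have := Dx x xr; rewrite ler_norml => /andP[].
  have : `|s * smean G| <= s * (K * s).
    rewrite (_ : s * (K * s) = K * s ^+ 2); last by ring.
    by rewrite -normrN -mulNr -e ler_norml h2.
  by rewrite normrM gtr0_norm// ler_pM2l.
apply/eqP; rewrite -normr_le0 leNgt; apply/negP => G0.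
have K0 : 0 < K by have := h 1; rewrite ltr01 lexx mulr1 => /(_ isT); exact: lt_le_trans.
(* With this s the bound K s is at most half of |E G|, a contradiction if E G is not 0. *)
pose s := Num.min 1 (`|smean G| / (2 * K)).
have s0 : 0 < s by rewrite lt_min ltr01 divr_gt0// mulr_gt0.
have := h s; rewrite s0 ge_min lexx => /(_ isT).
have : K * s <= `|smean G| / 2.
  apply: (@le_trans _ _ (K * (`|smean G| / (2 * K)))).
    by rewrite ler_pM2l// ge_min lexx orbT.
  by rewrite le_eqVlt; apply/orP; left; apply/eqP; field; rewrite gt_eqF.
lra.
Qed.

Lemma rderiv_cst i j c : rderiv i j (fun=> c) (fun=> 0).
Proof.
split; [exact: sbounded_cst|exact: sbounded_cst|].
by exists 0 => s x _ _; rewrite subrr mulr0 subrr normr0 mul0r.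
Qed.

Lemma rderivD i j F F' G G' : rderiv i j F F' -> rderiv i j G G' ->
  rderiv i j (fun x => F x + G x) (fun x => F' x + G' x).
Proof.
move=> [bF bF' [K FK]] [bG bG' [L GL]]; split; [exact: sboundedD|exact: sboundedD|].
exists (K + L) => s x s01 xr; have h1 := FK s x s01 xr; have h2 := GL s x s01 xr.
rewrite mulrDl; apply: le_trans (lerD h1 h2); apply: le_trans (ler_normD _ _).
by rewrite le_eqVlt; apply/orP; left; apply/eqP; congr (`|_|); ring.
Qed.

Lemma rderivM i j F F' G G' : i != j -> rderiv i j F F' -> rderiv i j G G' ->
  rderiv i j (fun x => F x * G x) (fun x => F' x * G x + F x * G' x).
Proof.
move=> ij [bF bF' [K FK]] [bG bG' [L GL]]; split; [exact: sboundedM| |].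
  by apply: sboundedD; exact: sboundedM.
have [_ [A hA]] := bF; have [_ [A' hA']] := bF'.
have [_ [B hB]] := bG; have [_ [B' hB']] := bG'.
exists (K * B + A * L + A' * (L + B')) => s x s01 xr.
have h1 := FK s x s01 xr; have h2 := GL s x s01 xr.
have /andP[s0 s1] := s01.
set Fq := F (_ *m x) in h1 *; set Gq := G (_ *m x) in h2 *.
have hGq : `|Gq| <= B by apply: hB; rewrite givens_vnorm.
have hd : `|Gq - G x| <= s * (L + B').
  have -> : Gq - G x = (Gq - G x - s * G' x) + s * G' x by ring.
  apply: le_trans (ler_normD _ _) _; rewrite mulrDr; apply: lerD.
    apply: le_trans h2 _; rewrite mulrC expr2 -mulrA; apply: ler_wpM2l => //.
    have L0 : 0 <= L.
      have := GL 1 x; rewrite ler01 lexx expr1n mulr1 => /(_ isT xr); exact: le_trans.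
    by rewrite -[leRHS]mul1r ler_wpM2r.
  by rewrite normrM ger0_norm// ler_wpM2l// hB'.
(* In the first and last terms the rotated value of [G] appears; it obeys the same bound as [G]
   because rotations preserve the sphere. *)
have -> : Fq * Gq - F x * G x - s * (F' x * G x + F x * G' x) =
   (Fq - F x - s * F' x) * Gq + F x * (Gq - G x - s * G' x) + s * F' x * (Gq - G x).
  by ring.
apply: le_trans (ler_normD _ _) _; rewrite [leRHS]mulrDl; apply: lerD.
  apply: le_trans (ler_normD _ _) _; rewrite [leRHS]mulrDl !normrM; apply: lerD.
    by rewrite mulrAC ler_pM.
  by rewrite -mulrA ler_pM// hA.
rewrite !normrM ger0_norm//.
rewrite (_ : A' * (L + B') * s ^+ 2 = s * A' * (s * (L + B'))); last by ring.
by rewrite ler_pM ?mulr_ge0 ?ler_wpM2l ?hA'.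
Qed.

Lemma rderivX i j F F' m : i != j -> rderiv i j F F' ->
  rderiv i j (fun x => F x ^+ m) (fun x => m%:R * F x ^+ m.-1 * F' x).
Proof.
move=> ij dF; elim: m => [|m IH].
  by under [X in rderiv _ _ _ X]eq_fun do rewrite 2!mul0r; exact: rderiv_cst.
under eq_fun do rewrite exprS.
rewrite (_ : (fun x => m.+1%:R * F x ^+ m.+1.-1 * F' x) =
  (fun x => F' x * F x ^+ m + F x * (m%:R * F x ^+ m.-1 * F' x))); last first.
  apply/funext => x /=; case: m {IH} => [|m]; first by rewrite expr0; ring.
  by rewrite /= exprS -[m.+2%:R]natr1; ring.
exact: rderivM.
Qed.

Lemma rderiv_sum i j (I : Type) (s : seq I) (F F' : I -> 'cV[R]_n -> R) :
  (forall a, rderiv i j (F a) (F' a)) ->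
  rderiv i j (fun x => \sum_(a <- s) F a x) (fun x => \sum_(a <- s) F' a x).
Proof.
move=> dF; elim: s => [|a s IH].
  under eq_fun do rewrite big_nil.
  by under [X in rderiv _ _ _ X]eq_fun do rewrite big_nil; exact: rderiv_cst.
under eq_fun do rewrite big_cons.
by under [X in rderiv _ _ _ X]eq_fun do rewrite big_cons; exact: rderivD.
Qed.

Lemma rderiv_coord i j a : rderiv i j (fun x => x a 0)
  (fun x => (a == i)%:R * x j 0 - (a == j)%:R * x i 0).
Proof.
split; first exact: sbounded_coord.
  rewrite (_ : (fun x => _) = (fun x : 'cV[R]_n => (a == i)%:R * x j 0 + - (a == j)%:R * x i 0)).
    apply: sboundedD; apply: sboundedM; (exact: sbounded_cst || exact: sbounded_coord).
  by apply/funext => x; rewrite mulNr.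
exists (r + r) => s x s01 xr; rewrite givens_mulE.
set c := givens_cos s - 1; have hc : `|c| <= s ^+ 2 by exact: givens_cos_dist.
have -> : x a 0 + (a == i)%:R * (c * x i 0 + s * x j 0) + (a == j)%:R * (c * x j 0 - s * x i 0)
   - x a 0 - s * ((a == i)%:R * x j 0 - (a == j)%:R * x i 0) =
   c * ((a == i)%:R * x i 0 + (a == j)%:R * x j 0) by ring.
have hx b : `|x b 0| <= r.
  rewrite -xr -(@ler_pXn2r _ 2) ?nnegrE ?vnorm_ge0//.
  rewrite real_normK ?num_real// vnorm_sqr dotvE (bigD1 b)//= expr2 lerDl.
  by apply: sumr_ge0 => b' _; rewrite -expr2 sqr_ge0.
have hb (b : bool) k : `|b%:R * x k 0| <= r.
  by case: b; rewrite ?mul1r// mul0r normr0; exact: le_trans (hx k).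
rewrite normrM mulrC ler_pM//.
by apply: le_trans (ler_normD _ _) _; apply: lerD.
Qed.

End SphereCalculus.

(** * Partial sums of the exponential series and Young's inequality *)

Section ExpSeries.
Context {R : realType}.

Lemma exp_partial_le (x : R) m : 0 <= x -> \sum_(k < m) x ^+ k / k`!%:R <= expR x.
Proof.
move=> x0; have := nondecreasing_cvgn_le _ (is_cvg_series_exp_coeff x) m.
rewrite /series/= big_mkord; apply.
apply/nondecreasing_seqP => k; rewrite /series/= big_nat_recr//= lerDl.
exact: exp_coeff_ge0.
Qed.

Lemma exprn_le_fact_expR (x : R) m : 0 <= x -> x ^+ m <= m`!%:R * expR x.
Proof.
move=> x0; have := exp_partial_le m.+1 x0; rewrite big_ord_recr/= => h.
have f0 : 0 < m`!%:R :> R by rewrite ltr0n fact_gt0.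
rewrite mulrC -ler_pdivrMr//; apply: le_trans h; rewrite lerDr.
by apply: sumr_ge0 => k _; rewrite divr_ge0 ?exprn_ge0.
Qed.

Lemma exp_partial_norm (x : R) m : `|\sum_(k < m) x ^+ k / k`!%:R| <= expR `|x|.
Proof.
apply: le_trans (ler_norm_sum _ _ _) _; apply: le_trans (exp_partial_le m (normr_ge0 x)).
by apply: ler_sum => k _; rewrite normrM normrX normfV (ger0_norm (ler0n _ _)).
Qed.

(** Young's inequality in polynomial form, which avoids real exponents. The induction multiplies the
    previous case by [a] and adds (m + 1) b^m (b - a)^2 >= 0. *)
Lemma young_exprn (a b : R) m : 0 <= a -> 0 <= b ->
  m.+1%:R * (a * b ^+ m) <= a ^+ m.+1 + m%:R * b ^+ m.+1.
Proof.
move=> a0 b0; elim: m => [|m IH]; first by rewrite expr0 expr1; lra.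
have h1 := ler_wpM2l a0 IH.
have h2 : 0 <= m.+1%:R * b ^+ m * (b - a) ^+ 2.
  by apply: mulr_ge0 (sqr_ge0 _); rewrite mulr_ge0 ?exprn_ge0.
move: h1 h2; rewrite -!natr1 !exprS; set A := a ^+ m; set B := b ^+ m; set M := m%:R.
lra.
Qed.

Lemma fact_le_exprn m : m`!%:R <= m%:R ^+ m :> R.
Proof.
rewrite -natrX ler_nat; elim: m => [//|m IH].
rewrite factS expnS leq_mul2l/= (leq_trans IH)//.
by case: m {IH} => [//|m]; rewrite leq_exp2r.
Qed.

End ExpSeries.

(** * Moments of linear forms on the sphere *)

Section SphereMoments.
Import numFieldNormedType.Exports.
Context {R : realType} {n : nat} {dO : measure_display} {O : measurableType dO}
  (P : probability O R).
Variables (r : R) (U : O -> 'cV[R]_n).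
Hypotheses (mU : rvec U) (nU : forall w, vnorm (U w) = r)
  (invU : forall Q : 'M[R]_n, orthogonal_mx Q ->
    forall A : 'I_n -> set R, (forall k, measurable (A k)) ->
      P (rect_ev (fun w => Q *m U w) A) = P (rect_ev U A)).

Local Notation E := (smean P U).
Local Notation D := (rderiv r).

Lemma sphere_sum_sqr (x : 'cV[R]_n) : vnorm x = r -> \sum_i x i 0 ^+ 2 = r ^+ 2.
Proof. by move=> <-; rewrite vnorm_sqr dotvE; apply: eq_bigr => i _; rewrite expr2. Qed.

Lemma sum_indicator_diff (i j : 'I_n) (a b : R) (f : 'I_n -> R) :
  \sum_k f k * ((k == i)%:R * a - (k == j)%:R * b) = f i * a - f j * b.
Proof.
under eq_bigr => k _ do rewrite mulrBr mulrCA [X in _ - X]mulrCA.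
by rewrite sumrB !sum_indicator'.
Qed.

Lemma rderiv_dotv (t : 'cV[R]_n) i j : i != j ->
  D i j (dotv t) (fun x => t i 0 * x j 0 - t j 0 * x i 0).
Proof.
move=> ij.
have := @rderiv_sum R n r i j 'I_n (index_enum 'I_n) (fun a x => t a 0 * x a 0)
  (fun a x => 0 * x a 0 + t a 0 * ((a == i)%:R * x j 0 - (a == j)%:R * x i 0)).
have -> : (fun x : 'cV[R]_n => \sum_a t a 0 * x a 0) = dotv t.
  by apply/funext => x; rewrite dotvE.
have -> : (fun x : 'cV[R]_n => \sum_a (0 * x a 0 + t a 0 * ((a == i)%:R * x j 0 - (a == j)%:R * x i 0)))
   = (fun x => t i 0 * x j 0 - t j 0 * x i 0).
  apply/funext => x; under eq_bigr do rewrite mul0r add0r.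
  exact: sum_indicator_diff.
by apply=> a; apply: rderivM => //; [exact: rderiv_cst|exact: rderiv_coord].
Qed.

(** The Kronecker term makes the expression vanish for i = j, where there is no rotation plane, so
    that sums may run over all pairs. [quad_drv] is arranged in the same way. *)
Definition lin_drv (t : 'cV[R]_n) k i j (x : 'cV[R]_n) : R :=
  (x j 0 - (i == j)%:R * x i 0) * (t j 0 * dotv t x ^+ k)
  + x i 0 * (t j 0 * (k%:R * dotv t x ^+ k.-1 * (t i 0 * x j 0 - t j 0 * x i 0))).

Lemma sbounded_dotv (t : 'cV[R]_n) : sbounded r (dotv t).
Proof.
rewrite (_ : dotv t = fun x => \sum_a t a 0 * x a 0); last by apply/funext => x; rewrite dotvE.
by apply: sbounded_sum => a; apply: sboundedM; [exact: sbounded_cst|exact: sbounded_coord].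
Qed.

Lemma lin_drv_rderiv (t : 'cV[R]_n) k i j : i != j ->
  D i j (fun x => x i 0 * (t j 0 * dotv t x ^+ k)) (lin_drv t k i j).
Proof.
move=> ij.
have -> : lin_drv t k i j = (fun x =>
    ((i == i)%:R * x j 0 - (i == j)%:R * x i 0) * (t j 0 * dotv t x ^+ k) +
    x i 0 * (0 * dotv t x ^+ k + t j 0 * (k%:R * dotv t x ^+ k.-1 * (t i 0 * x j 0 - t j 0 * x i 0)))).
  by apply/funext => x; rewrite /lin_drv eqxx mul1r mul0r add0r.
apply: rderivM => //; first exact: rderiv_coord.
apply: rderivM => //; first exact: rderiv_cst.
by apply: rderivX => //; exact: rderiv_dotv.
Qed.

Lemma sbounded_lin_drv (t : 'cV[R]_n) k i j : sbounded r (lin_drv t k i j).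
Proof.
have [->|ij] := eqVneq i j; last by have [_] := lin_drv_rderiv t k ij.
rewrite (_ : lin_drv _ _ _ _ = fun=> 0); first exact: sbounded_cst.
by apply/funext => x; rewrite /lin_drv eqxx mulr1n; ring.
Qed.

Lemma smean_lin_drv (t : 'cV[R]_n) k i j : E (lin_drv t k i j) = 0.
Proof.
have [->|ij] := eqVneq i j; last exact: (smean_rderiv mU nU invU ij (lin_drv_rderiv t k ij)).
rewrite (_ : lin_drv _ _ _ _ = fun=> 0); first exact: smean_cst.
by apply/funext => x; rewrite /lin_drv eqxx mulr1n; ring.
Qed.

Lemma sum_lin_drv (t x : 'cV[R]_n) k : vnorm x = r -> \sum_i \sum_j lin_drv t k i j x =
  (n%:R - 1) * dotv t x ^+ k.+1 +
  k%:R * dotv t x ^+ k.-1 * (dotv t x ^+ 2 - r ^+ 2 * dotv t t).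
Proof.
move=> xr; set L := dotv t x.
have eL : \sum_j t j 0 * x j 0 = L by rewrite /L dotvE.
have e1 i : \sum_j lin_drv t k i j x =
    L ^+ k * L - L ^+ k * (t i 0 * x i 0) +
    k%:R * L ^+ k.-1 * (L * (t i 0 * x i 0) - dotv t t * x i 0 ^+ 2).
  transitivity (\sum_j (L ^+ k * (t j 0 * x j 0) - L ^+ k * x i 0 * ((i == j)%:R * t j 0)
    + k%:R * L ^+ k.-1 * ((t i 0 * x i 0) * (t j 0 * x j 0))
    - k%:R * L ^+ k.-1 * x i 0 ^+ 2 * (t j 0 * t j 0))).
    by apply: eq_bigr => j _; rewrite /lin_drv -/L; ring.
  rewrite sumrB big_split/= sumrB -!mulr_sumr eL sum_indicator.
  by rewrite -(dotvE t t); ring.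
rewrite (eq_bigr _ (fun i _ => e1 i)) big_split/= sumrB -!mulr_sumr sumrB -!mulr_sumr eL.
rewrite sphere_sum_sqr// sumr_const card_ord -[L *+ n]mulr_natr [L ^+ k.+1]exprSr; ring.
Qed.

(* Rotation invariance kills the mean of the derivative of [x_i t_j (t.x)^k] in the plane (i, j);
   summing over all planes gives a recursion on the moments. *)
Lemma smean_lin_rec (t : 'cV[R]_n) k :
  (n%:R - 1) * E (fun x => dotv t x ^+ k.+1) +
  k%:R * (E (fun x => dotv t x ^+ k.+1) - r ^+ 2 * dotv t t * E (fun x => dotv t x ^+ k.-1)) = 0.
Proof.
have bL := sbounded_dotv t.
have bX m := sboundedX m bL.
have bZ c m : sbounded r (fun x => c * dotv t x ^+ m) by apply: sboundedM => //; exact: sbounded_cst.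
have h : E (fun x => \sum_i \sum_j lin_drv t k i j x) = 0.
  rewrite (smean_sum P mU nU) => [|i]; last by apply: sbounded_sum => j; exact: sbounded_lin_drv.
  rewrite big1// => i _; rewrite (smean_sum P mU nU) => [|j]; last exact: sbounded_lin_drv.
  by rewrite big1// => j _; exact: smean_lin_drv.
rewrite (eq_smean P nU (G := fun x => (n%:R - 1 + k%:R) * dotv t x ^+ k.+1 +
    - (k%:R * (r ^+ 2 * dotv t t)) * dotv t x ^+ k.-1)) // in h; last first.
  move=> x xr; rewrite sum_lin_drv//; case: k => [|k]; first by rewrite !mul0r; ring.
  by rewrite /= !exprS; ring.
rewrite (smeanD P mU nU)// !(smeanZ P mU nU)// in h.
rewrite -[RHS]h; ring.
Qed.

Hypothesis n2 : (1 < n)%N.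

Let n0 : 0 < n%:R :> R. Proof. by rewrite ltr0n (ltn_trans _ n2). Qed.
Let n1 : 0 < n%:R - 1 :> R. Proof. by rewrite subr_gt0 ltr1n. Qed.

(** The recursion moves in steps of two; at its start it reads (n - 1) E(t.x) = 0, whence the
    hypothesis n > 1. *)
Lemma smean_lin_odd (t : 'cV[R]_n) k : E (fun x => dotv t x ^+ (k.*2.+1)) = 0.
Proof.
elim: k => [|k IH].
  have := smean_lin_rec t 0; rewrite mul0r addr0 => /eqP.
  by rewrite mulf_eq0 gt_eqF//= => /eqP.
have := smean_lin_rec t k.*2.+2; rewrite /= IH mulr0 subr0 -mulrDl => /eqP.
have q : 0 < n%:R - 1 + k.*2.+2%:R :> R by exact: ltr_wpDr.
by rewrite mulf_eq0 (gt_eqF q)/= => /eqP.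
Qed.

(** The right-hand side is the moment of N(0, v) divided by (2k)!. The sphere satisfies (n + 2k)
    M_(2k+2) = (2k+1) r^2 |t|^2 M_(2k), and lowering n + 2k to n gives the Gaussian recursion as an
    inequality. *)
Lemma smean_lin_even (t : 'cV[R]_n) k (v := r ^+ 2 / n%:R * dotv t t) :
  E (fun x => dotv t x ^+ (k.*2)) / (k.*2)`!%:R <= (v / 2) ^+ k / k`!%:R.
Proof.
have v0 : 0 <= v by rewrite mulr_ge0 ?dotvv_ge0// divr_ge0 ?sqr_ge0.
have pos m : 0 <= E (fun x => dotv t x ^+ (m.*2)).
  rewrite -(smean_cst P U 0); apply: (le_smean P mU nU); first exact: sbounded_cst.
    by apply: sboundedX; exact: sbounded_dotv.
  by move=> x _; rewrite -muln2 exprM sqr_ge0.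
elim: k => [|k IH].
  rewrite (eq_smean P nU (G := fun=> 1)) => [|x _]; last by rewrite expr0.
  by rewrite smean_cst expr0 fact0 divr1.
have := smean_lin_rec t k.*2.+1; rewrite /= => rec.
set M2 := E (fun x => dotv t x ^+ k.*2.+2) in rec *; set M0 := E _ in rec IH.
have M20 : 0 <= M2 by exact: (pos k.+1).
have step : M2 <= k.*2.+1%:R * v * M0.
  rewrite /v -(ler_pM2l n0).
  have -> : n%:R * (k.*2.+1%:R * (r ^+ 2 / n%:R * dotv t t) * M0) =
    k.*2.+1%:R * (r ^+ 2 * dotv t t * M0) by field; rewrite gt_eqF.
  move: rec; rewrite -[k.*2.+1%:R]natr1; have := mulr_ge0 (ler0n R k.*2) M20.
  set a := k.*2%:R; set b := n%:R; set c := r ^+ 2 * _ * _; lra.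
rewrite doubleS !factS !natrM exprS.
have fk : 0 < (k.*2)`!%:R :> R by rewrite ltr0n fact_gt0.
have fk' : 0 < k`!%:R :> R by rewrite ltr0n fact_gt0.
have d0 : 0 < k.*2.+2%:R * (k.*2.+1%:R * (k.*2)`!%:R) :> R by rewrite !mulr_gt0.
apply: (@le_trans _ _ (k.*2.+1%:R * v * M0 / (k.*2.+2%:R * (k.*2.+1%:R * (k.*2)`!%:R)))).
  by rewrite ler_pM2r ?invr_gt0.
have -> : k.*2.+1%:R * v * M0 / (k.*2.+2%:R * (k.*2.+1%:R * (k.*2)`!%:R)) =
  v / (k.*2.+2%:R) * (M0 / (k.*2)`!%:R).
  by field; rewrite (gt_eqF fk) !gt_eqF ?ltr_wpDr.
have -> : v / 2 * (v / 2) ^+ k / (k.+1%:R * k`!%:R) = v / k.*2.+2%:R * ((v / 2) ^+ k / k`!%:R).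
  rewrite -doubleS -[k.+1.*2]muln2 natrM; field.
  by rewrite (gt_eqF fk') gt_eqF ?ltr_wpDr.
by rewrite ler_wpM2l// divr_ge0.
Qed.

Lemma smean_exp_partial (t : 'cV[R]_n) m (v := r ^+ 2 / n%:R * dotv t t) :
  E (fun x => \sum_(k < m) dotv t x ^+ k / k`!%:R) <= expR (v / 2).
Proof.
have v0 : 0 <= v / 2 by rewrite divr_ge0// mulr_ge0 ?dotvv_ge0// divr_ge0 ?sqr_ge0.
have bL := sbounded_dotv t.
have bT k : sbounded r (fun x => k`!%:R^-1 * dotv t x ^+ k).
  by apply: sboundedM; [exact: sbounded_cst|exact: sboundedX].
pose M k := E (fun x => dotv t x ^+ k) / k`!%:R.
have -> : E (fun x => \sum_(k < m) dotv t x ^+ k / k`!%:R) = \sum_(k < m) M k.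
  rewrite (smean_sum P mU nU _ (F := fun (k : 'I_m) x => dotv t x ^+ k / k`!%:R)) => [|k].
    apply: eq_bigr => k _.
    rewrite (eq_smean P nU (G := fun x => k`!%:R^-1 * dotv t x ^+ k)) => [|x _]; last by rewrite mulrC.
    by rewrite (smeanZ P mU nU); [rewrite mulrC|exact: sboundedX].
  by apply: sboundedM; [exact: sboundedX|exact: sbounded_cst].
have even k : \sum_(j < k.*2) M j <= \sum_(j < k) (v / 2) ^+ j / j`!%:R.
  elim: k => [|k IH]; first by rewrite !big_ord0.
  have M0 : M k.*2.+1 = 0 by rewrite /M smean_lin_odd mul0r.
  rewrite doubleS !big_ord_recr/= M0 addr0.
  by apply: lerD => //; exact: smean_lin_even.
(* When the number of terms is odd, the last one has even degree and must be counted. *)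
rewrite -(odd_double_half m) addnC; case: (odd m); rewrite ?addn0 ?addn1; last first.
  by apply: le_trans (even _) _; exact: exp_partial_le.
apply: le_trans (exp_partial_le m./2.+1 v0).
by rewrite !big_ord_recr/=; apply: lerD; [exact: even|exact: smean_lin_even].
Qed.

(** The means of the partial sums of the exponential are bounded uniformly in the number of terms.
    As t.U is bounded by |t| r, dominated convergence with the constant exp(|t| r) carries the bound
    to the limit. *)
Lemma sphere_sgv : sgv P U (r ^+ 2 / n%:R)%:M.
Proof.
move=> t; rewrite bil_scalar.
have bL := sbounded_dotv t.
have bS m : sbounded r (fun x => \sum_(k < m) dotv t x ^+ k / k`!%:R).
  apply: (sbounded_sum _ (F := fun (k : 'I_m) x => dotv t x ^+ k / k`!%:R)) => k.
  by apply: sboundedM; [exact: sboundedX|exact: sbounded_cst].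
have mL : measurable_fun setT (fun w => dotv t (U w)) by exact: measurable_dotv_cst.
pose K := Num.sqrt (dotv t t) * r.
have LK w : `|dotv t (U w)| <= K.
  rewrite -(@ler_pXn2r _ 2) ?nnegrE ?mulr_ge0 ?sqrtr_ge0//; last by rewrite -(nU w) vnorm_ge0.
  rewrite real_normK ?num_real// exprMn sqr_sqrtr ?dotvv_ge0// -(nU w) vnorm_sqr.
  exact: dotv_cauchy_schwarz.
pose f_ (m : nat) w := (\sum_(k < m) dotv t (U w) ^+ k / k`!%:R)%:E.
pose f w := (expR (dotv t (U w)))%:E.
have m1 m : measurable_fun setT (f_ m).
  by apply/measurable_EFinP; exact: (measurableT_comp (bS m).1 (measurable_to_borelV mU)).
have m2 : measurable_fun setT f by exact: measurable_expR_comp.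
have c1 : {ae P, forall w, setT w -> f_ m w @[m --> \oo] --> f w}.
  apply: aeW => w _; apply: cvg_EFin; first by near=> m.
  have := is_cvg_series_exp_coeff (dotv t (U w)).
  rewrite (_ : series _ = fun m => \sum_(k < m) dotv t (U w) ^+ k / k`!%:R) => [h|]; last first.
    by apply/funext => m; rewrite /series/= big_mkord.
  rewrite /expR (_ : series _ = fun m => \sum_(k < m) dotv t (U w) ^+ k / k`!%:R)//.
  by apply/funext => m; rewrite /series/= big_mkord.
have ig : P.-integrable setT (fun=> (expR K)%:E) by exact: finite_measure_integrable_cst.
have c2 : {ae P, forall w m, setT w -> (`|f_ m w| <= (expR K)%:E)%E}.
  apply: aeW => w m _ /=; rewrite lee_fin; apply: le_trans (exp_partial_norm _ _) _.
  by rewrite ler_expR.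
have [_ _ cv] := dominated_convergence measurableT m1 m2 c1 ig c2.
rewrite -(cvg_lim _ cv)//.
apply: lime_le; first by apply/cvg_ex; eexists; exact: cv.
apply: nearW => m /=.
have := smean_exp_partial t m; rewrite /smean /Rintegral -lee_fin fineK//.
by apply: integrable_fin_num => //; exact: (sbounded_integrable P mU nU (bS m)).
Unshelve. all: by end_near. Qed.

(** * Moments and tails of quadratic forms on the sphere *)

Section Quadratic.
Variable A : 'M[R]_n.
Hypothesis sA : A^T = A.
Let q (x : 'cV[R]_n) : R := dotv x (A *m x).
(** This is the mean of [q], so [X] is the centred form; [Y] is the quantity that governs the growth
    of its moments. *)
Let c : R := r ^+ 2 * \tr A / n%:R.
Let X (x : 'cV[R]_n) : R := q x + - c.
Let Y (x : 'cV[R]_n) : R := dotv (A *m x) (A *m x).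

Let symA a b : A a b = A b a. Proof. by rewrite -[in LHS]sA mxE. Qed.

Lemma rderiv_mulmx i j a : i != j ->
  D i j (fun x => (A *m x) a 0) (fun x => A a i * x j 0 - A a j * x i 0).
Proof.
move=> ij; have := rderiv_dotv (row a A)^T ij.
rewrite (_ : dotv _ = fun x => (A *m x) a 0); last first.
  by apply/funext => x; rewrite mulmx_dotv_row.
by under [X in D _ _ _ X]eq_fun do rewrite !mxE.
Qed.

Lemma rderiv_quad i j : i != j ->
  D i j q (fun x => 2 * (x j 0 * (A *m x) i 0 - x i 0 * (A *m x) j 0)).
Proof.
move=> ij.
have := @rderiv_sum R n r i j 'I_n (index_enum 'I_n) (fun a x => x a 0 * (A *m x) a 0)
  (fun a x => ((a == i)%:R * x j 0 - (a == j)%:R * x i 0) * (A *m x) a 0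
     + x a 0 * (A a i * x j 0 - A a j * x i 0)).
rewrite (_ : (fun x => \sum_(a <- _) _) = q); last by apply/funext => x; rewrite /q dotvE.
rewrite (_ : (fun x : 'cV[R]_n => \sum_(a <- _) _) =
  (fun x => 2 * (x j 0 * (A *m x) i 0 - x i 0 * (A *m x) j 0))).
  by apply=> a; apply: rderivM => //; [exact: rderiv_coord|exact: rderiv_mulmx].
apply/funext => x; rewrite big_split/=.
have -> : \sum_a ((a == i)%:R * x j 0 - (a == j)%:R * x i 0) * (A *m x) a 0 =
    (A *m x) i 0 * x j 0 - (A *m x) j 0 * x i 0.
  by rewrite -(sum_indicator_diff i j (x j 0) (x i 0) (fun a => (A *m x) a 0)); apply: eq_bigr => a _; rewrite mulrC.
have -> : \sum_a x a 0 * (A a i * x j 0 - A a j * x i 0) =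
    (A *m x) i 0 * x j 0 - (A *m x) j 0 * x i 0.
  rewrite !mxE !mulr_suml -sumrB; apply: eq_bigr => a _.
  by rewrite (symA i) (symA j); ring.
ring.
Qed.

Lemma rderiv_X i j : i != j ->
  D i j X (fun x => 2 * (x j 0 * (A *m x) i 0 - x i 0 * (A *m x) j 0) + 0).
Proof. by move=> ij; apply: rderivD; [exact: rderiv_quad|exact: rderiv_cst]. Qed.

Definition quad_drv k i j (x : 'cV[R]_n) : R :=
  (x j 0 - (i == j)%:R * x i 0) * ((A *m x) j 0 * X x ^+ k)
  + x i 0 * ((A j i * x j 0 - A j j * x i 0) * X x ^+ k +
     (A *m x) j 0 * (k%:R * X x ^+ k.-1 *
        (2 * (x j 0 * (A *m x) i 0 - x i 0 * (A *m x) j 0)))).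

Lemma quad_drv_rderiv k i j : i != j ->
  D i j (fun x => x i 0 * ((A *m x) j 0 * X x ^+ k)) (quad_drv k i j).
Proof.
move=> ij.
have -> : quad_drv k i j = (fun x =>
    ((i == i)%:R * x j 0 - (i == j)%:R * x i 0) * ((A *m x) j 0 * X x ^+ k) +
    x i 0 * ((A j i * x j 0 - A j j * x i 0) * X x ^+ k + (A *m x) j 0 * (k%:R * X x ^+ k.-1 *
       (2 * (x j 0 * (A *m x) i 0 - x i 0 * (A *m x) j 0) + 0)))).
  by apply/funext => x; rewrite /quad_drv eqxx mul1r addr0.
apply: rderivM => //; first exact: rderiv_coord.
apply: rderivM => //; first exact: rderiv_mulmx.
by apply: rderivX => //; exact: rderiv_X.
Qed.

Lemma quad_drv_diag k i x : quad_drv k i i x = 0.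
Proof. by rewrite /quad_drv eqxx mulr1n; ring. Qed.

Lemma sbounded_quad_drv k i j : sbounded r (quad_drv k i j).
Proof.
have [->|ij] := eqVneq i j; last by have [_] := quad_drv_rderiv k ij.
rewrite (_ : quad_drv _ _ _ = fun=> 0); first exact: sbounded_cst.
by apply/funext => x; rewrite quad_drv_diag.
Qed.

Lemma smean_quad_drv k i j : E (quad_drv k i j) = 0.
Proof.
have [->|ij] := eqVneq i j; last exact: (smean_rderiv mU nU invU ij (quad_drv_rderiv k ij)).
rewrite (_ : quad_drv _ _ _ = fun=> 0); first exact: smean_cst.
by apply/funext => x; rewrite quad_drv_diag.
Qed.

Lemma sum_quad_drv k x : vnorm x = r -> \sum_i \sum_j quad_drv k i j x =
  n%:R * X x * X x ^+ k + 2 * k%:R * X x ^+ k.-1 * (q x ^+ 2 - r ^+ 2 * Y x).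
Proof.
move=> xr; set a := A *m x.
have eq1 : \sum_j x j 0 * a j 0 = q x by rewrite /q dotvE.
have eY : \sum_j a j 0 ^+ 2 = Y x by rewrite /Y dotvE; apply: eq_bigr => j _; rewrite expr2.
have eX : n%:R * X x = n%:R * q x - r ^+ 2 * \tr A.
  by rewrite /X /c; field; rewrite gt_eqF.
have e1 i : \sum_j quad_drv k i j x =
    X x ^+ k * q x - X x ^+ k * (x i 0 * a i 0)
    + X x ^+ k * (x i 0 * a i 0) - X x ^+ k * \tr A * x i 0 ^+ 2
    + 2 * k%:R * X x ^+ k.-1 * (q x * (x i 0 * a i 0) - Y x * x i 0 ^+ 2).
  have ea : a i 0 = \sum_j A i j * x j 0 by rewrite /a mxE.
  transitivity (\sum_j (X x ^+ k * (x j 0 * a j 0) - X x ^+ k * x i 0 * ((i == j)%:R * a j 0)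
    + X x ^+ k * x i 0 * (A i j * x j 0) - X x ^+ k * x i 0 ^+ 2 * A j j
    + 2 * k%:R * X x ^+ k.-1 * (x i 0 * a i 0) * (x j 0 * a j 0)
    - 2 * k%:R * X x ^+ k.-1 * x i 0 ^+ 2 * a j 0 ^+ 2)).
    by apply: eq_bigr => j _; rewrite /quad_drv -/a (symA j i); ring.
  rewrite sumrB big_split/= sumrB big_split/= sumrB -!mulr_sumr eq1 sum_indicator -ea eY.
  rewrite -/(\tr A); ring.
rewrite (eq_bigr _ (fun i _ => e1 i)) big_split/= sumrB big_split/= sumrB.
rewrite -!mulr_sumr sumrB -!mulr_sumr eq1.
rewrite sphere_sum_sqr// sumr_const card_ord -[q x *+ n]mulr_natr eX; ring.
Qed.

Lemma sbounded_mulmx a : sbounded r (fun x => (A *m x) a 0).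
Proof.
rewrite (_ : (fun x => _) = dotv (row a A)^T); first exact: sbounded_dotv.
by apply/funext => x; rewrite mulmx_dotv_row.
Qed.

Lemma sbounded_q : sbounded r q.
Proof.
rewrite (_ : q = fun x => \sum_a x a 0 * (A *m x) a 0); last by apply/funext => x; rewrite /q dotvE.
apply: (sbounded_sum _ (F := fun a x => x a 0 * (A *m x) a 0)) => a.
by apply: sboundedM; [exact: sbounded_coord|exact: sbounded_mulmx].
Qed.

Lemma sbounded_X : sbounded r X.
Proof. by apply: sboundedD; [exact: sbounded_q|exact: sbounded_cst]. Qed.

Lemma sbounded_Y : sbounded r Y.
Proof.
rewrite (_ : Y = fun x => \sum_a (A *m x) a 0 * (A *m x) a 0); last by apply/funext => x; rewrite /Y dotvE.
apply: (sbounded_sum _ (F := fun a x => (A *m x) a 0 * (A *m x) a 0)) => a.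
by apply: sboundedM; exact: sbounded_mulmx.
Qed.

(* The same device with [x_i (A x)_j X^k]. *)
Lemma smean_quad_rec m :
  n%:R * E (fun x => X x ^+ m.*2.+2) =
  2 * m.*2.+1%:R * E (fun x => X x ^+ m.*2 * (r ^+ 2 * Y x + -1 * q x ^+ 2)).
Proof.
have bX := sbounded_X; have bq := sbounded_q; have bY := sbounded_Y.
have bC a F : sbounded r F -> sbounded r (fun x => a * F x) by move=> bF; apply: sboundedM => //; exact: sbounded_cst.
have bG : sbounded r (fun x => X x ^+ m.*2 * (r ^+ 2 * Y x + -1 * q x ^+ 2)).
  by apply: sboundedM; [exact: sboundedX|apply: sboundedD; apply: (bC) => //; exact: sboundedX].
have h : E (fun x => \sum_i \sum_j quad_drv m.*2.+1 i j x) = 0.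
  rewrite (smean_sum P mU nU) => [|i]; last by apply: sbounded_sum => j; exact: sbounded_quad_drv.
  rewrite big1// => i _; rewrite (smean_sum P mU nU) => [|j]; last exact: sbounded_quad_drv.
  by rewrite big1// => j _; exact: smean_quad_drv.
rewrite (eq_smean P nU (G := fun x => n%:R * X x ^+ m.*2.+2 +
    - (2 * m.*2.+1%:R) * (X x ^+ m.*2 * (r ^+ 2 * Y x + -1 * q x ^+ 2)))) // in h; last first.
  by move=> x xr; rewrite sum_quad_drv//= !exprS; ring.
have e : n%:R * E (fun x => X x ^+ m.*2.+2) +
    - (2 * m.*2.+1%:R) * E (fun x => X x ^+ m.*2 * (r ^+ 2 * Y x + -1 * q x ^+ 2)) = 0.
  rewrite -[RHS]h (smeanD P mU nU); [|by apply: (bC); exact: sboundedX|exact: bC].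
  by rewrite (smeanZ P mU nU _ bG) (smeanZ P mU nU _ (sboundedX _ bX)).
by move: e; rewrite mulNr => /eqP; rewrite subr_eq0 => /eqP.
Qed.

(** In the recursion for E X^(2m+2) the term -q^2 is dropped, and Young's inequality with a = k Y
    and b = X^2 bounds the rest by E (k Y)^(m+1) / (m+1) plus the fraction m / (m+1) of E X^(2m+2)
    itself, which is absorbed on the left. *)
Lemma smean_quad_moment m (k := 2 * m.*2.+1%:R * r ^+ 2 / n%:R) :
  E (fun x => X x ^+ m.*2.+2) <= E (fun x => (k * Y x) ^+ m.+1).
Proof.
have bX := sbounded_X; have bq := sbounded_q; have bY := sbounded_Y.
have bC a F : sbounded r F -> sbounded r (fun x => a * F x) by move=> bF; apply: sboundedM => //; exact: sbounded_cst.
have k0 : 0 <= k by rewrite /k divr_ge0// mulr_ge0// sqr_ge0.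
have Y0 x : 0 <= Y x by exact: dotvv_ge0.
have X2 x l : X x ^+ l.*2 = (X x ^+ 2) ^+ l by rewrite -exprM mul2n.
have bkY : sbounded r (fun x => (k * Y x) ^+ m.+1) by apply: sboundedX; exact: bC.
have bX2 : sbounded r (fun x => X x ^+ m.*2.+2) by exact: sboundedX.
set M := E (fun x => X x ^+ m.*2.+2).
have h1 : M = E (fun x => 2 * m.*2.+1%:R / n%:R * (X x ^+ m.*2 * (r ^+ 2 * Y x + -1 * q x ^+ 2))).
  rewrite (smeanZ P mU nU); last first.
    by apply: sboundedM; [exact: sboundedX|apply: sboundedD; apply: (bC) => //; exact: sboundedX].
  by rewrite mulrAC -smean_quad_rec mulrAC divff ?mul1r// gt_eqF.
have h2 : M <= E (fun x => m.+1%:R^-1 * (k * Y x) ^+ m.+1 + m%:R / m.+1%:R * X x ^+ m.*2.+2).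
  rewrite h1; apply: (le_smean P mU nU).
  - apply: (bC); apply: sboundedM; first exact: sboundedX.
    by apply: sboundedD; apply: (bC) => //; exact: sboundedX.
  - by apply: sboundedD; exact: bC.
  move=> x _; apply: (@le_trans _ _ (k * Y x * (X x ^+ 2) ^+ m)).
    rewrite -X2; have -> : k * Y x * X x ^+ m.*2 =
      2 * m.*2.+1%:R / n%:R * (X x ^+ m.*2 * (r ^+ 2 * Y x)) by rewrite /k; ring.
    apply: ler_wpM2l; first by rewrite divr_ge0 ?mulr_ge0.
    apply: ler_wpM2l; first by rewrite X2 exprn_ge0 ?sqr_ge0.
    by rewrite mulN1r gerBl sqr_ge0.
  have m0 : 0 < m.+1%:R :> R by rewrite ltr0n.
  rewrite -(ler_pM2l m0); apply: le_trans (young_exprn m (mulr_ge0 k0 (Y0 x)) (sqr_ge0 (X x))) _.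
  rewrite -doubleS X2 le_eqVlt; apply/orP; left; apply/eqP; field.
  by rewrite gt_eqF// ltr_wpDr.
have h3 : M <= m.+1%:R^-1 * E (fun x => (k * Y x) ^+ m.+1) + m%:R / m.+1%:R * M.
  apply: le_trans h2 _; rewrite (smeanD P mU nU); [|exact: bC|exact: bC].
  by rewrite (smeanZ P mU nU _ bkY) (smeanZ P mU nU _ bX2).
have m0 : 0 < m.+1%:R :> R by rewrite ltr0n.
move: h3; rewrite -(ler_pM2l m0); set N := E (fun x => (k * Y x) ^+ m.+1).
have -> : m.+1%:R * (m.+1%:R^-1 * N + m%:R / m.+1%:R * M) = N + m%:R * M.
  by field; rewrite gt_eqF// ltr_wpDr.
by rewrite -[m.+1%:R]natr1 mulrDl mul1r; lra.
Qed.

(** [A U] is sub-Gaussian with proxy covariance (r^2 / n) A A^T, of trace at most V = r^2 F / n.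
    Hence exp(Y / (8 V)) has mean at most 2, and y^m <= m! e^y turns this into moments. *)
Lemma smean_Y_moment F m : frob2 A <= F -> 0 < F -> 0 < r ->
  E (fun x => Y x ^+ m) <= 2 * m`!%:R * (8 * (r ^+ 2 / n%:R * F)) ^+ m.
Proof.
move=> AF F0 r0; set V := r ^+ 2 / n%:R * F.
have V0 : 0 < V by rewrite mulr_gt0 ?divr_gt0 ?exprn_gt0.
have mAU : rvec (fun w => A *m U w) by exact: rvec_mulmx.
have ps : psd (A *m (r ^+ 2 / n%:R)%:M *m A^T).
  apply: psd_conj => t; rewrite bil_scalar mulr_ge0 ?dotvv_ge0//.
  by rewrite divr_ge0 ?sqr_ge0// ltW.
have trV : \tr (A *m (r ^+ 2 / n%:R)%:M *m A^T) <= V.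
  rewrite mul_mx_scalar -scalemxAl linearZ/= -frob2_trace /V ler_wpM2l//.
  by rewrite divr_ge0 ?sqr_ge0// ltW.
have h := sgv_expR_normsq mAU (sgv_mulmx A sphere_sgv) ps trV V0.
have V8 : 0 < 8 * V by rewrite mulr_gt0.
have Y0 x : 0 <= Y x by exact: dotvv_ge0.
have bY := sbounded_Y.
rewrite -lee_fin /smean /Rintegral fineK; last first.
  by apply: integrable_fin_num => //; exact: (sbounded_integrable P mU nU (sboundedX m bY)).
apply: (@le_trans _ _ (\int[P]_w ((m`!%:R * (8 * V) ^+ m) * expR ((8 * V)^-1 * Y (U w)))%:E)%E).
  apply: ge0_le_integral => //.
  - by move=> w _; rewrite lee_fin exprn_ge0.
  - apply/measurable_EFinP.
    exact: (measurableT_comp (sboundedX m bY).1 (measurable_to_borelV mU)).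
  - apply/measurable_EFinP; apply: measurable_funM => //; apply: measurableT_comp => //.
    by apply: measurable_funM => //; exact: measurable_dotv.
  - move=> w _; rewrite lee_fin.
    have := exprn_le_fact_expR m (mulr_ge0 (ltW (_ : 0 < (8 * V)^-1)) (Y0 (U w))).
    rewrite invr_gt0 => /(_ V8); rewrite exprMn exprVn mulrC ler_pdivrMr ?exprn_gt0//.
    by rewrite mulrAC.
under eq_integral do rewrite EFinM.
rewrite ge0_integralZl_EFin; [|by []| | |]; last 3 first.
- by move=> w _; rewrite lee_fin expR_ge0.
- apply: measurable_expR_comp; apply: measurable_funM => //; exact: measurable_dotv.
- by rewrite mulr_ge0 ?exprn_ge0// ltW.
rewrite (_ : 2 * m`!%:R * (8 * V) ^+ m = m`!%:R * (8 * V) ^+ m * 2); last by ring.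
rewrite [leRHS]EFinM; apply: lee_wpmul2l => //.
by rewrite lee_fin mulr_ge0 ?exprn_ge0// ltW.
Qed.

Lemma smean_quad_even_moment F p : frob2 A <= F -> 0 < F -> 0 < r -> (0 < p)%N ->
  E (fun x => X x ^+ p.*2) <= 2 * (32 * p%:R ^+ 2 * (r ^+ 4 * F / n%:R ^+ 2)) ^+ p.
Proof.
move=> AF F0 r0; case: p => // m _.
have bY := sbounded_Y.
rewrite doubleS; apply: le_trans (smean_quad_moment m) _.
set k := 2 * m.*2.+1%:R * r ^+ 2 / n%:R.
have k0 : 0 <= k by rewrite /k divr_ge0// mulr_ge0// sqr_ge0.
rewrite (eq_smean P nU (G := fun x => k ^+ m.+1 * Y x ^+ m.+1)) => [|x _]; last by rewrite exprMn.
rewrite (smeanZ P mU nU); last exact: sboundedX.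
apply: (@le_trans _ _ (k ^+ m.+1 * (2 * m.+1`!%:R * (8 * (r ^+ 2 / n%:R * F)) ^+ m.+1))).
  by rewrite ler_wpM2l ?exprn_ge0//; exact: smean_Y_moment.
set p := m.+1.
have V0 : 0 <= 8 * (r ^+ 2 / n%:R * F).
  by apply: mulr_ge0 => //; apply: mulr_ge0 (ltW F0); rewrite divr_ge0 ?sqr_ge0 ?(ltW n0).
have kp : k <= 4 * p%:R * r ^+ 2 / n%:R.
  rewrite ler_wpM2r ?invr_ge0 ?(ltW n0)// ler_wpM2r ?sqr_ge0//.
  by rewrite -!natrM ler_nat /p; lia.
(* The constant 32 p^2 collects 4 p from [k], p from p! <= p^p, and 8 from the moments of [Y]. *)
apply: (@le_trans _ _ ((4 * p%:R * r ^+ 2 / n%:R) ^+ p * (2 * p%:R ^+ p * (8 * (r ^+ 2 / n%:R * F)) ^+ p))).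
  apply: ler_pM; rewrite ?exprn_ge0 ?mulr_ge0 ?exprn_ge0 ?(ltW r0)//.
    by rewrite ler_pXn2r ?nnegrE// (le_trans k0).
  by rewrite ler_wpM2r ?exprn_ge0// ler_wpM2l// fact_le_exprn.
rewrite le_eqVlt; apply/orP; left; apply/eqP.
rewrite mulrCA -!mulrA; congr (2 * _); rewrite -!exprMn; congr (_ ^+ p).
by field; rewrite (gt_eqF n0).
Qed.

(** With sigma = r^2 sqrt F / n, the moment of order 2p grows like (p sigma)^(2p) up to constants to
    the power p. Markov at p = floor(Q), Q = s / (32 e sigma), makes each of the p factors at most
    1/e; then p >= Q / 2 yields the constant 64 e. *)
Lemma sphere_quad_tail F s : frob2 A <= F -> 0 < F -> 0 < r -> 0 <= s ->
  (P [set w | (s <= `|X (U w)|)%R] <=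
   (2 * expR (- (s / (64 * expR 1 * (r ^+ 2 * Num.sqrt F / n%:R)))))%:E)%E.
Proof.
move=> AF F0 r0 s0.
have mX : measurable_fun setT (fun w => X (U w)).
  exact: (measurableT_comp sbounded_X.1 (measurable_to_borelV mU)).
pose sg := r ^+ 2 * Num.sqrt F / n%:R.
have sg0 : 0 < sg by rewrite divr_gt0 ?mulr_gt0 ?exprn_gt0 ?sqrtr_gt0.
have e0 : 0 < expR 1 :> R by exact: expR_gt0.
have e1 : 1 <= expR 1 :> R by rewrite -[leLHS]expR0 ler_expR.
pose Q := s / (32 * expR 1 * sg).
have K0 : 0 < 32 * expR 1 * sg by apply: mulr_gt0 sg0; apply: mulr_gt0.
have Q0 : 0 <= Q by rewrite divr_ge0// ltW.
have -> : s / (64 * expR 1 * (r ^+ 2 * Num.sqrt F / n%:R)) = Q / 2.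
  by rewrite -/sg /Q; field; rewrite !gt_eqF.
have mA : measurable [set w | s <= `|X (U w)|].
  by apply: measurable_le_cst; exact: measurableT_comp.
(* For Q < 1 the claimed bound exceeds 1, since 2 exp(-Q/2) >= 2 - Q. *)
have [Q1|Q1] := ltP Q 1.
  apply: le_trans (probability_le1 P mA) _; rewrite lee_fin.
  have := expR_ge1Dx (- (Q / 2)); lra.
have := truncn_itv Q0; set p := Num.truncn Q => /andP[pQ Qp].
have p1 : (0 < p)%N by rewrite truncn_gt0.
have s1 : 0 < s by have := lt_le_trans ltr01 Q1; rewrite /Q pmulr_lgt0 ?invr_gt0.
have bX := sbounded_X.
have h : (\int[P]_w (X (U w) ^+ p.*2)%:E <=
    (2 * (32 * p%:R ^+ 2 * sg ^+ 2) ^+ p)%:E)%E.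
  have := smean_quad_even_moment AF F0 r0 p1.
  rewrite /smean /Rintegral -lee_fin fineK; last first.
    by apply: integrable_fin_num => //; exact: (sbounded_integrable P mU nU (sboundedX _ bX)).
  rewrite (_ : sg ^+ 2 = r ^+ 4 * F / n%:R ^+ 2)//.
  by rewrite /sg expr_div_n exprMn sqr_sqrtr ?(ltW F0)// -exprM.
have X2 l (x : R) : x ^+ l.*2 = (x ^+ 2) ^+ l by rewrite -exprM mul2n.
rewrite (_ : [set w | _] = [set w | s ^+ p.*2 <= X (U w) ^+ p.*2]); last first.
  apply/seteqP; split => w /=.
    rewrite !X2 -[X (U w) ^+ 2]real_normK ?num_real// => h1.
    by rewrite ler_pXn2r ?nnegrE ?sqr_ge0// ler_pXn2r ?nnegrE.
  rewrite !X2 -[X (U w) ^+ 2]real_normK ?num_real// ler_pXn2r ?nnegrE ?sqr_ge0//.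
  by rewrite ler_pXn2r ?nnegrE.
apply: le_trans (ge0_markov _ _ _ h) _.
- exact: measurable_funX.
- by move=> w; rewrite X2 exprn_ge0// sqr_ge0.
- exact: exprn_gt0.
rewrite lee_fin X2 -mulrA ler_wpM2l// -expr_div_n.
have hp : 32 * p%:R ^+ 2 * sg ^+ 2 / s ^+ 2 <= expR (-1).
  have hs : 32 * expR 1 * (p%:R * sg) <= s.
    by move: pQ; rewrite /Q ler_pdivlMr//; lra.
  have h2 : (32 * expR 1 * (p%:R * sg)) ^+ 2 <= s ^+ 2.
    by rewrite ler_pXn2r ?nnegrE// !mulr_ge0// ltW.
  rewrite expRN ler_pdivrMr ?exprn_gt0// ler_pdivlMl//.
  apply: le_trans h2.
  have h3 : 0 <= p%:R ^+ 2 * sg ^+ 2 * expR 1 by rewrite !mulr_ge0 ?sqr_ge0// ltW.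
  rewrite (_ : (32 * expR 1 * (p%:R * sg)) ^+ 2 = 32 * (32 * expR 1) * (p%:R ^+ 2 * sg ^+ 2 * expR 1)); last by ring.
  rewrite (_ : expR 1 * _ = 32 * (p%:R ^+ 2 * sg ^+ 2 * expR 1)); last by ring.
  by rewrite ler_wpM2r//; lra.
apply: le_trans (_ : expR (-1) ^+ p <= _).
  rewrite ler_pXn2r ?nnegrE ?expR_ge0// divr_ge0 ?sqr_ge0//.
  by apply: mulr_ge0 (sqr_ge0 _); apply: mulr_ge0 (sqr_ge0 _).
rewrite -expRM_natl ler_expR mulrN1 lerN2.
have : (1 : R) <= p%:R by rewrite ler1n.
move: Qp; rewrite -natr1; lra.
Qed.

End Quadratic.
End SphereMoments.

(** * Spherical, Gaussian and signed vectors *)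

Section AlmostSure.
Context {R : realType} {dO : measure_display} {O : measurableType dO}
  (P : probability O R).

Lemma prob_setC_full (G : set O) : measurable G -> P G = 1%E -> P (~` G) = 0%E.
Proof. by move=> mG G1; rewrite probability_setC// G1 subee. Qed.

Lemma prob_setI_full (G A : set O) : measurable G -> P G = 1%E -> measurable A ->
  P (A `&` G) = P A.
Proof.
move=> mG G1 mA.
have h := prob_setC_full mG G1.
rewrite -[in RHS](setIT A) -(setUv G) setIUr measureU//.
- rewrite [X in (_ + X)%E](_ : _ = 0%E) ?adde0//.
  apply/eqP; rewrite eq_le measure_ge0 andbT -h; apply: le_measure; rewrite ?inE.
  + by apply: measurableI => //; exact: measurableC.
  + exact: measurableC.
  + by move=> w [].
- exact: measurableI.
- by apply: measurableI => //; exact: measurableC.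
- by apply/seteqP; split => // w [[_ Gw] [_ /(_ Gw)]].
Qed.

Lemma prob_eq_full (G A B : set O) : measurable G -> P G = 1%E ->
  measurable A -> measurable B -> (forall w, G w -> A w <-> B w) -> P A = P B.
Proof.
move=> mG G1 mA mB AB; rewrite -(prob_setI_full mG G1 mA) -(prob_setI_full mG G1 mB).
by congr (P _); apply/seteqP; split => w [Xw Gw]; split => //; apply/(AB w).
Qed.

Lemma measurable_vnorm n (U : O -> 'cV[R]_n) : rvec U ->
  measurable_fun setT (fun w => vnorm (U w)).
Proof.
move=> mU; apply: (measurableT_comp (f := @Num.sqrt R)).
  by apply: continuous_measurable_fun; exact: sqrt_continuous.
by apply: measurable_sumr => k; exact: measurable_funX.
Qed.

Lemma measurable_rect_ev n (U : O -> 'cV[R]_n) (A : 'I_n -> set R) : rvec U ->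
  (forall k, measurable (A k)) -> measurable (rect_ev U A).
Proof.
move=> mU mA.
rewrite (_ : rect_ev U A = \bigcap_(k in [set: 'I_n]) ((fun w => U w k 0) @^-1` A k)); last first.
  by apply/seteqP; split => [w h k _|w h k]; exact: h.
apply: fin_bigcap_measurable => [|k _]; first exact: finite_finset.
by rewrite -[X in measurable X]setTI; exact: (mU k).
Qed.

Lemma measurable_sqr1 (y : O -> R) : measurable_fun setT y ->
  measurable [set w | y w ^+ 2 = 1].
Proof.
move=> my; rewrite (_ : [set w | _] = (fun w => y w ^+ 2) @^-1` [set 1])//.
by rewrite -[X in measurable X]setTI; exact: (measurable_funX 2 my).
Qed.

Lemma pm1_sqr_full (y : O -> R) q : pm1_rv P q y -> P [set w | y w ^+ 2 = 1] = 1%E.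
Proof.
move=> [myO [y1 yN1]].
have mset c : measurable [set w | y w = c].
  rewrite (_ : [set w | _] = y @^-1` [set c])//.
  by rewrite -[X in measurable X]setTI; exact: myO.
rewrite (_ : [set w | _] = [set w | y w = 1] `|` [set w | y w = -1]); last first.
  apply/seteqP; split => w /=; last by case=> ->; rewrite ?sqrrN expr1n.
  by move/eqP; rewrite sqrf_eq1 => /orP[]/eqP; [left|right].
have e : (P [set w | (y w = 1)%R] + P [set w | (y w = -1)%R] = 1)%E.
  by rewrite y1 yN1 -EFinD subrK.
rewrite measureU; [exact: e|exact: mset|exact: mset|].
apply/seteqP; split => // w /= [-> /eqP]; rewrite -subr_eq0 opprK => /eqP h.
by have := ltr0Sn R 1; rewrite mulr2n h ltxx.
Qed.

End AlmostSure.

Section UniformSphere.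
Context {R : realType} {n : nat} {dO : measure_display} {O : measurableType dO}
  (P : probability O R).
Variables (r : R) (U : O -> 'cV[R]_n).
Hypotheses (n2 : (1 < n)%N) (r0 : 0 < r) (hU : unif_sphere P r U).

(* [U] has norm [r] only almost surely; the calculus above needs it everywhere. *)
Lemma unif_sphere_exact : exists U' : O -> 'cV[R]_n,
  [/\ rvec U', forall w, vnorm (U' w) = r,
    (forall Q : 'M[R]_n, orthogonal_mx Q ->
     forall A : 'I_n -> set R, (forall k, measurable (A k)) ->
       P (rect_ev (fun w => Q *m U' w) A) = P (rect_ev U' A)) &
    forall w, vnorm (U w) = r -> U' w = U w].
Proof.
have [mU [U1 invU]] := hU.
pose i0 : 'I_n := Ordinal (ltn_trans (ltn0Sn 0) n2).
(* An arbitrary point of the sphere, the default value on the null set where [U] has another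
   norm. *)
pose e : 'cV[R]_n := r *: delta_mx i0 0.
have ne : vnorm e = r.
  apply/eqP; rewrite -(@eqrXn2 _ 2) ?vnorm_ge0 ?(ltW r0)//.
  rewrite vnorm_sqr dotvZl dotvZr dotv_delta mxE !eqxx mulr1 expr2; exact: eqxx.
pose U' w := if vnorm (U w) == r then U w else e.
have eU w : vnorm (U w) = r -> U' w = U w by move=> h; rewrite /U' h eqxx.
have mV := measurable_vnorm mU.
have mU' : rvec U'.
  move=> k; rewrite (_ : (fun w => U' w k 0) = fun w => if vnorm (U w) == r then U w k 0 else e k 0).
    by apply: measurable_fun_ifT => //; exact: measurable_fun_eqr.
  by apply/funext => w; rewrite /U'; case: ifP.
exists U'; split => //.
  by move=> w; rewrite /U'; case: ifPn => // /eqP.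
have mG : measurable [set w | vnorm (U w) = r].
  rewrite (_ : [set w | _] = (fun w => vnorm (U w)) @^-1` [set r])//.
  by rewrite -[X in measurable X]setTI; exact: mV.
move=> Q oQ A mA.
rewrite (@prob_eq_full _ _ _ P _ _ (rect_ev (fun w => Q *m U w) A) mG U1).
- rewrite invU//; apply: (prob_eq_full mG U1); try exact: measurable_rect_ev.
  by move=> w Gw; split => h k; have := h k; rewrite eU.
- by apply: measurable_rect_ev => //; exact: rvec_mulmx.
- by apply: measurable_rect_ev => //; exact: rvec_mulmx.
- by move=> w Gw; split => h k; have := h k; rewrite eU.
Qed.

Lemma unif_sphere_sgv : sgv P U (r ^+ 2 / n%:R)%:M.
Proof.
have [mU [U1 _]] := hU.
have [U' [mU' nU' invU' eU]] := unif_sphere_exact.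
move=> t; have h := sphere_sgv mU' nU' invU' n2 t.
rewrite (_ : (\int[P]_w _)%E = (\int[P]_w (expR (dotv t (U' w)))%:E)%E)//.
have mG : measurable [set w | vnorm (U w) = r].
  rewrite (_ : [set w | _] = (fun w => vnorm (U w)) @^-1` [set r])//.
  by rewrite -[X in measurable X]setTI; exact: (measurable_vnorm mU).
apply: ae_eq_integral => //.
- by apply: measurable_expR_comp; exact: measurable_dotv_cst.
- by apply: measurable_expR_comp; exact: measurable_dotv_cst.
- exists (~` [set w | vnorm (U w) = r]); split; first exact: measurableC.
    exact: (prob_setC_full mG U1).
  by move=> w /= hw Gw; apply: hw => _; rewrite eU.
Qed.

Lemma unif_sphere_quad_tail (A : 'M[R]_n) F s : A^T = A -> frob2 A <= F -> 0 < F -> 0 <= s ->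
  (P [set w | (s <= `|bil (U w) A (U w) - r ^+ 2 * \tr A / n%:R|)%R] <=
   (2 * expR (- (s / (64 * expR 1 * (r ^+ 2 * Num.sqrt F / n%:R)))))%:E)%E.
Proof.
move=> sA AF F0 s0.
have [mU [U1 _]] := hU.
have [U' [mU' nU' invU' eU]] := unif_sphere_exact.
apply: le_trans (sphere_quad_tail mU' nU' invU' n2 sA AF F0 r0 s0).
have mG : measurable [set w | vnorm (U w) = r].
  rewrite (_ : [set w | _] = (fun w => vnorm (U w)) @^-1` [set r])//.
  by rewrite -[X in measurable X]setTI; exact: (measurable_vnorm mU).
rewrite le_eqVlt; apply/orP; left; apply/eqP.
apply: (prob_eq_full mG U1).
- apply: measurable_le_cst; apply: measurableT_comp => //.
  by apply: measurable_funD => //; exact: measurable_bil.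
- apply: measurable_le_cst; apply: measurableT_comp => //.
  by apply: measurable_funD => //; apply: measurable_dotv => //; exact: rvec_mulmx.
- by move=> w Gw /=; rewrite eU// bil_dotv.
Qed.

End UniformSphere.

Section GaussianVectors.
Context {R : realType} {n : nat} {dO : measure_display} {O : measurableType dO}
  (P : probability O R).

Lemma gaussian_sgv (L : 'M[R]_n) (Z : O -> 'cV[R]_n) :
  posdef L -> gaussian_vec P L Z -> sgv P Z L.
Proof.
move=> pL [mZ gZ] t; have [->|t0] := eqVneq t 0.
  under eq_integral do rewrite dotv0l expR0.
  rewrite integral_cst// mul1e bil_dotv dotv0l mul0r expR0.
  exact: probability_le1.
have mt : measurable_fun setT ((fun w => dotv t (Z w)) : O -> measurableTypeR R).
  exact: (measurable_dotv_cst t mZ).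
have s0 : 0 < bil t L t by exact: (pL.2).
have mexp : measurable_fun setT (fun x : measurableTypeR R => (expR x)%:E).
  by apply: measurable_expR_comp.
have := @ge0_integral_pushforward _ _ O (measurableTypeR R) R _ mt P setT _ measurableT mexp _.
rewrite preimage_setT => <-; last by move=> x _; rewrite lee_fin expR_ge0.
rewrite (eq_measure_integral (normal_prob 0 (Num.sqrt (bil t L t)))); last first.
  by move=> A mA _; exact: gZ.
under eq_integral do rewrite -[X in expR X]mul1r.
rewrite normal_prob_mgf ?sqrtr_gt0// sqr_sqrtr ?(ltW s0)//.
by rewrite expr1n mul1r.
Qed.

(* [sgv] only sees the pair (y, z) through the sign y, so a random sign is harmless. *)
Lemma sgv_sign_blocks (I : finType) (m : I -> nat) (Z : forall i, O -> 'cV[R]_(m i))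
    (HZ : indep_family P Z) (S1 S2 : {set I}) (y : O -> R) (z : O -> 'cV[R]_n) L :
  [disjoint S1 & S2]%B ->
  measurable_fun setT (y : blockType Z S1 -> R) -> rvec (z : blockType Z S2 -> _) ->
  P [set w | y w ^+ 2 = 1] = 1%E -> sgv P z L -> sgv P (fun w => y w *: z w) L.
Proof.
move=> S12 my mz G1 sz t; have myO := measurable_from_block HZ my.
pose F (x : blockType Z S1 * blockType Z S2) : \bar R := (expR (dotv t (y x.1 *: z x.2)))%:E.
rewrite (_ : (\int[P]_w _ = \int[P]_w F (w, w))%E)//.
rewrite (tonelli_blocks HZ (f := F) S12); last 2 first.
- apply: measurable_expR_comp; apply: measurable_dotv_cst; apply: rvecZ => [|k].
    exact: (measurableT_comp my measurable_fst).
  exact: (measurableT_comp (mz k) measurable_snd).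
- by move=> x; rewrite lee_fin expR_ge0.
have mzO : rvec z by exact: (rvec_from_block HZ mz).
have mF : measurable_fun setT (fun w1 : O => (\int[P]_w2 F (w1, w2))%E).
  pose F' (x : O * O) : \bar R := (expR (dotv t (y x.1 *: z x.2)))%:E.
  have mF' : measurable_fun setT F'.
    apply: measurable_expR_comp; apply: measurable_dotv_cst; apply: rvecZ => [|k].
      exact: (measurableT_comp myO measurable_fst).
    exact: (measurableT_comp (mzO k) measurable_snd).
  have mFF : measurable_fun setT (fubini_F P F').
    by apply: measurable_fun_fubini_tonelli_F => // x; rewrite lee_fin expR_ge0.
  exact: mFF.
have mG := measurable_sqr1 myO.
rewrite (_ : (\int[P]_w1 _ = \int[P]_(w1 in [set w | (y w ^+ 2 = 1)%R]) (\int[P]_w2 F (w1, w2)))%E); last first.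
  rewrite [RHS]integral_mkcond; apply: ae_eq_integral => //.
    by apply/(measurable_restrictT _ mG); exact: (measurable_funTS mF).
  exists (~` [set w | y w ^+ 2 = 1]); split; first exact: measurableC.
    exact: (prob_setC_full mG G1).
  by move=> w /= hw Gw; apply: hw => _; rewrite patchE mem_set.
apply: (@le_trans _ _ (\int[P]_(w1 in [set w | (y w ^+ 2 = 1)%R]) (expR (bil t L t / 2))%:E)%E).
  apply: ge0_le_integral => //.
  - by move=> w _; apply: integral_ge0 => w' _; rewrite lee_fin expR_ge0.
  - exact: measurable_funTS.
  - move=> w /= yw; rewrite /F/=; have := sz (y w *: t).
    by rewrite bilZl bilZr mulrA -expr2 yw mul1r; under eq_integral do rewrite dotvZl -dotvZr.
rewrite integral_cst// -[leRHS]mule1; apply: lee_wpmul2l; first by rewrite lee_fin expR_ge0.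
exact: probability_le1.
Qed.

End GaussianVectors.

(** * Max-margin matrices *)

Section MaxMargin.
Import numFieldNormedType.Exports.
Context {R : realType} {d B : nat}.
Variables (muh : 'I_B -> 'cV[R]_d) (yq : 'I_B -> R) (xq : 'I_B -> 'cV[R]_d).

Lemma continuous_sumr (T : topologicalType) (I : Type) (s : seq I) (f : I -> T -> R) :
  (forall i, continuous (f i)) -> continuous (fun x => \sum_(i <- s) f i x).
Proof.
move=> cf; elim: s => [|i s IH].
  rewrite (_ : (fun x => _) = cst 0); first exact: cst_continuous.
  by apply/funext => x; rewrite big_nil.
rewrite (_ : (fun x => _) = (fun x => f i x + \sum_(i <- s) f i x)).
  by move=> x; apply: cvgD; [exact: cf|exact: IH].
by apply/funext => x; rewrite big_cons.
Qed.

Lemma continuous_vec_mx i j : continuous (fun v : 'rV[R]_(d * d) => vec_mx v i j).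
Proof.
rewrite (_ : (fun v => _) = fun v : 'rV[R]_(d * d) => v 0 (mxvec_index i j)).
  exact: coord_continuous.
by apply/funext => v; rewrite mxE.
Qed.

(** Feasible matrices of norm at most that of [U0] form a compact set, on which the continuous norm
    attains its minimum; matrices of larger norm cannot do better. Matrices are flattened to row
    vectors, and compactness comes from a closed subset of a box. *)
Lemma max_margin_exists U0 : mm_feasible muh yq xq U0 ->
  exists W, is_max_margin muh yq xq W.
Proof.
move=> feas0; pose F (v : 'rV[R]_(d * d)) : R := frob2 (vec_mx v).
have cF : continuous F.
  apply: continuous_sumr => i; apply: continuous_sumr => j.
  under eq_fun do rewrite expr2.
  by move=> v; exact: (continuousM (@continuous_vec_mx i j v) (@continuous_vec_mx i j v)).
have cG t : continuous (fun v : 'rV[R]_(d * d) => bil (muh t) (vec_mx v) (yq t *: xq t)).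
  under eq_fun do rewrite bilE.
  apply: continuous_sumr => i; apply: continuous_sumr => j v.
  apply: (@continuousM _ _ (fun v : 'rV[R]_(d * d) => muh t i 0 * vec_mx v i j)
    (fun=> (yq t *: xq t) j 0)); last exact: cst_continuous.
  apply: (@continuousM _ _ (fun=> muh t i 0) (fun v : 'rV[R]_(d * d) => vec_mx v i j)).
    exact: cst_continuous.
  exact: continuous_vec_mx.
pose K := [set v | F v <= frob2 U0] `&`
  \bigcap_(t in [set: 'I_B]) [set v : 'rV[R]_(d * d) | 1 <= bil (muh t) (vec_mx v) (yq t *: xq t)].
have clK : closed K.
  apply: closedI.
    by apply: (@preimage_closed _ _ F [set x | x <= frob2 U0]); [move=> v _; exact: cF|exact: closed_le].
  apply: closed_bigI => t _.
  apply: (@preimage_closed _ _ (fun v => bil (muh t) (vec_mx v) (yq t *: xq t)) [set x | 1 <= x]).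
    by move=> v _; exact: cG.
  exact: closed_ge.
pose m := Num.sqrt (frob2 U0).
have coK : compact K.
  apply: (subclosed_compact clK (@rV_compact _ _ (fun=> `[(- m), m]%classic) (fun=> @segment_compact _ _ _))).
  move=> v [Fv _] k /=; rewrite in_itv/= -ler_norml -(@ler_pXn2r _ 2) ?nnegrE ?sqrtr_ge0//.
  rewrite sqr_sqrtr ?frob2_ge0// real_normK ?num_real//; apply: le_trans Fv.
  case/mxvec_indexP: k => i j; rewrite /F /frob2 (bigD1 i)//= (bigD1 j)//= mxE -addrA lerDl.
  rewrite addr_ge0// ?sumr_ge0// => [j' _|i' _]; first exact: sqr_ge0.
  by apply: sumr_ge0 => j' _; exact: sqr_ge0.
have K0 : K !=set0.
  exists (mxvec U0); split => /=; first by rewrite /F mxvecK.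
  by move=> t _ /=; rewrite mxvecK; exact: feas0.
have [c cK minc] := EVT_min_rV K0 coK (continuous_subspaceT cF).
exists (vec_mx c); have [Fc fc] := set_mem cK; split; first by move=> t; exact: (fc t I).
move=> V fV; have [h|h] := leP (frob2 V) (frob2 U0); last by apply: le_trans Fc _; exact: ltW.
have := minc (mxvec V); rewrite /F mxvecK; apply; rewrite inE; split => /=; first by rewrite /F mxvecK.
by move=> t _ /=; rewrite mxvecK; exact: fV.
Qed.

(** First-order optimality along the segment from [W] to [V], which remains feasible because the
    constraints are affine in the matrix. *)
Lemma max_margin_variational W V : is_max_margin muh yq xq W ->
  mm_feasible muh yq xq V -> frob2 W <= frobdot W V.
Proof.
move=> [fW minW] fV; rewrite leNgt; apply/negP => hlt.
have bound s : 0 < s <= 1 -> 0 <= 2 * frobdot W (V - W) + s * frob2 (V - W).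
  move=> /andP[s0 s1].
  have fs : mm_feasible muh yq xq (W + s *: (V - W)).
    move=> t; rewrite bilDm bilZm bilDm -scaleN1r bilZm.
    have := fW t; have := fV t; set a := bil _ V _; set b := bil _ W _ => ha hb.
    nra.
  have := minW _ fs; rewrite frob2D frobdotZr frob2Z.
  rewrite -addrA lerDl => h; rewrite -(pmulr_rge0 _ s0).
  by move: h; rewrite mulr2n; lra.
have g0 : frobdot W (V - W) < 0 by rewrite frobdotBr frobdot_frob2 subr_lt0.
set g := frobdot _ _ in bound g0; set D := frob2 _ in bound.
have D0 : 0 <= D by exact: frob2_ge0.
(* With g < 0 this step size makes the quadratic term s D at most -g, which cannot compensate 2 g.
   The added 1 covers D = 0. *)
have := bound (Num.min 1 (- g / (D + 1))).
have D1 : 0 < D + 1 by rewrite ltr_wpDl.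
rewrite lt_min ltr01 divr_gt0 ?oppr_gt0// ge_min lexx => /(_ isT).
have : Num.min 1 (- g / (D + 1)) * D <= - g.
  apply: (@le_trans _ _ (- g / (D + 1) * D)).
    by rewrite ler_wpM2r// ge_min lexx orbT.
  rewrite mulrAC ler_pdivrMr// ler_wpM2l ?oppr_ge0 ?ltW//.
  by rewrite ltrDl.
lra.
Qed.

(* The competitor in the variational inequality is the multiple [1/m] of the identity. *)
Lemma max_margin_trace W m : is_max_margin muh yq xq W -> 0 < m ->
  (forall t, m <= dotv (muh t) (yq t *: xq t)) -> m * frob2 W <= \tr W.
Proof.
move=> mmW m0 hm.
have fI : mm_feasible muh yq xq (m^-1 *: 1%:M).
  by move=> t; rewrite bilZm bil_scalar mul1r mulrC ler_pdivlMr// mul1r.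
have := max_margin_variational mmW fI.
by rewrite frobdotZr frobdot1 mulrC ler_pdivlMr// mulrC.
Qed.

(* Cauchy-Schwarz for [W] against the sum of the matrices of the constraints. *)
Lemma max_margin_frob W s : (0 < B)%N -> is_max_margin muh yq xq W ->
  \sum_t \sum_t' dotv (muh t) (muh t') * dotv (yq t *: xq t) (yq t' *: xq t') <= s ->
  B%:R ^+ 2 <= frob2 W * s.
Proof.
move=> B0 [fW _] hs.
pose S := \sum_(t < B) (muh t *m (yq t *: xq t)^T).
have h1 : B%:R <= frobdot W S.
  rewrite frobdot_sumr (_ : B%:R = \sum_(t < B) 1); last by rewrite sumr_const card_ord.
  by apply: ler_sum => t _; rewrite frobdot_outer; exact: fW.
have eS : frob2 S = \sum_t \sum_t' dotv (muh t) (muh t') * dotv (yq t *: xq t) (yq t' *: xq t').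
  rewrite -frobdot_frob2 {2}/S frobdot_sumr; apply: eq_bigr => t _.
  have frobdotC (U V : 'M[R]_d) : frobdot U V = frobdot V U.
    by apply: eq_bigr => i _; apply: eq_bigr => j _; rewrite mulrC.
  rewrite frobdotC frobdot_sumr; apply: eq_bigr => t' _.
  by rewrite frobdot_outer_outer dotvC [in X in _ * X]dotvC.
apply: (@le_trans _ _ (frobdot W S ^+ 2)).
  by rewrite ler_pXn2r ?nnegrE// (le_trans _ h1).
apply: le_trans (frobdot_cauchy_schwarz _ _) _.
by rewrite ler_wpM2l ?frob2_ge0// eS.
Qed.

End MaxMargin.

(** * The pre-training event *)

Section Likely.
Context {R : realType} {dO : measure_display} {O : measurableType dO}
  (P : probability O R).

(** Measurability is bundled with the failure bound so that union bounds compose without side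
    conditions. *)
Definition likely (E : set O) (e : R) : Prop := measurable E /\ (P (~` E) <= e%:E)%E.

Lemma likely_prob E e : likely E e -> ((1 - e)%:E <= P E)%E.
Proof.
move=> [mE hE]; have fE : P E \is a fin_num by exact: fin_num_measure.
move: hE; rewrite probability_setC// -(fineK fE) -EFinB !lee_fin; lra.
Qed.

Lemma likely_full E : measurable E -> P E = 1%E -> likely E 0.
Proof. by move=> mE E1; split => //; rewrite (prob_setC_full mE E1). Qed.

Lemma likelyT E e : 0 <= e -> E = setT -> likely E e.
Proof. by move=> e0 ->; split => //; rewrite setCT measure0 lee_fin. Qed.

Lemma likely_le E e e' : e <= e' -> likely E e -> likely E e'.
Proof. by move=> ee' [mE hE]; split => //; apply: le_trans hE _; rewrite lee_fin. Qed.

Lemma likelyI E F e f : likely E e -> likely F f -> likely (E `&` F) (e + f).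
Proof.
move=> [mE hE] [mF hF]; split; first exact: measurableI.
rewrite setCI; apply: le_trans (measureU2 _ _ _) _; [exact: measurableC|exact: measurableC|].
by rewrite EFinD; exact: leeD.
Qed.

Lemma likely_forall (J : finType) (E : J -> set O) (e : R) :
  (forall j, likely (E j) e) -> likely [set w | forall j, E j w] (#|J|%:R * e).
Proof.
move=> lE.
have h (s : seq J) : likely [set w | forall j, j \in s -> E j w] ((size s)%:R * e).
  elim: s => [|j s IH]; first by apply: likelyT; rewrite ?mul0r//; apply/seteqP; split.
  rewrite (_ : [set w | _] = E j `&` [set w | forall j, j \in s -> E j w]).
    by rewrite /= -natr1 mulrDl mul1r addrC; exact: likelyI.
  apply/seteqP; split => w /= => [h|[h1 h2] k].
    by split=> [|k ks]; apply: h; rewrite inE ?eqxx ?ks ?orbT.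
  by rewrite inE => /orP[/eqP->//|]; exact: h2.
have := h (enum J); rewrite -cardE; congr (likely _ _).
by apply/seteqP; split => w /= H j; [apply: H; rewrite mem_enum|move=> _; exact: H].
Qed.

Lemma likely_lt (f : O -> R) (s e : R) : measurable_fun setT f ->
  (P [set w | (s <= f w)%R] <= e%:E)%E -> likely [set w | f w < s] e.
Proof.
move=> mf h; split; first exact: measurable_lt_cst.
rewrite (_ : ~` _ = [set w | s <= f w])//.
by apply/seteqP; split => w /=; [move/negP; rewrite -leNgt|move=> h1; apply/negP; rewrite -leNgt].
Qed.

End Likely.

Section ScaledVectors.
Context {R : realType} {n : nat} {dO : measure_display} {O : measurableType dO}
  (P : probability O R).

Lemma sgvZ (a : R) (X : O -> 'cV[R]_n) G : sgv P X G -> sgv P (fun w => a *: X w) (a ^+ 2 *: G).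
Proof.
move=> sX; have := sgv_mulmx (a%:M) sX.
rewrite tr_scalar_mx mul_scalar_mx mul_mx_scalar scalerA -expr2.
by under eq_fun do rewrite mul_scalar_mx.
Qed.

Lemma rvec_block (I : finType) (m : I -> nat) (Z : forall i, O -> 'cV[R]_(m i))
  (S : {set I}) i : i \in S -> rvec (Z i : blockType Z S -> _).
Proof. by move=> iS k; exact: measurable_block_coord. Qed.

Lemma sgv_signed_mean (I : finType) (m : I -> nat) (Z : forall i, O -> 'cV[R]_(m i))
    (HZ : indep_family P Z) (N : nat) (Sy Sz : 'I_N.+1 -> {set I})
    (y : 'I_N.+1 -> O -> R) (z : 'I_N.+1 -> O -> 'cV[R]_n) (L : 'M[R]_n) :
  (0 < N)%N ->
  (forall i, [disjoint Sy i & Sz i]%B) ->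
  (forall i j, i != j -> [disjoint (Sy i :|: Sz i)%SET & (Sy j :|: Sz j)%SET]%B) ->
  (forall i, measurable_fun setT (y i : blockType Z (Sy i) -> R)) ->
  (forall i, rvec (z i : blockType Z (Sz i) -> _)) ->
  (forall i, sgv P (fun w => y i w *: z i w) L) ->
  sgv P (fun w => N%:R^-1 *: \sum_(i < N.+1 | i != ord_max) y i w *: z i w) (N%:R^-1 *: L).
Proof.
move=> N0 dyz dS my mz syz.
pose s := [seq i <- index_enum 'I_N.+1 | i != ord_max].
have us : uniq s by rewrite filter_uniq// index_enum_uniq.
have h := @sgv_sum_blocks _ _ _ P I m Z HZ n 'I_N.+1 s (fun i => (Sy i :|: Sz i)%SET)
  (fun i w => y i w *: z i w) (fun=> L) us.
have hs : sgv P (fun w => \sum_(i <- s) y i w *: z i w) (\sum_(i <- s) L).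
  apply: h => //; first by move=> i j _ _; exact: dS.
  move=> i; apply: rvecZ.
    by apply: (measurable_block_sub (S := Sy i)) (my i); exact: finset.subsetUl.
  by apply: (rvec_block_sub (S := Sz i)) (mz i); exact: finset.subsetUr.
have := sgvZ N%:R^-1 hs.
have -> : \sum_(i <- s) L = N%:R *: L.
  rewrite big_filter sumr_const scaler_nat; congr (_ *+ _).
  by rewrite cardC1 card_ord.
rewrite scalerA expr2 -mulrA mulVf ?mulr1; last by rewrite pnatr_eq0 -lt0n.
by under eq_fun do rewrite big_filter.
Qed.

End ScaledVectors.

(** * Independent components of the pre-training tasks *)

Section PretrainVectors.
Context {R : realType} {dO : measure_display} {O : measurableType dO} (P : probability O R).
Variables (d B N : nat) (L : 'M[R]_d) (Rad : R).
Variables (mu : 'I_B -> O -> 'cV[R]_d) (z : 'I_B -> 'I_N.+1 -> O -> 'cV[R]_d)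
  (y : 'I_B -> 'I_N.+1 -> O -> R).
Hypotheses (N0 : (0 < N)%N) (d2 : (1 < d)%N) (pL : posdef L) (R0 : 0 < Rad)
  (law : pretrain_law P Rad L mu z y).

Local Notation X := (pre_blocks mu z y).
Local Notation idx := (pre_idx B N).

(** When every label squares to 1, y x = mu + y z, so [vec_mean] and [vec_query] are the empirical
    mean and the signed query. In this form they are sums of independent sub-Gaussian vectors; the
    identification is made on the good event. *)
Definition noise_mean t w := N%:R^-1 *: \sum_(i < N.+1 | i != ord_max) y t i w *: z t i w.
Definition noise_query t w := y t ord_max w *: z t ord_max w.
Definition vec_mean t w := mu t w + noise_mean t w.
Definition vec_query t w := mu t w + noise_query t w.

Definition blk_mu t : {set idx} := [set inl (inl t)]%SET.
Definition blk_z t i : {set idx} := [set inl (inr (t, i))]%SET.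
Definition blk_y t i : {set idx} := [set inr (t, i)]%SET.
Definition blk_mean t : {set idx} :=
  [set x | match x with inl (inl _) => false | inl (inr p) => (p.1 == t) && (p.2 != ord_max)
           | inr p => (p.1 == t) && (p.2 != ord_max) end]%SET.
Definition blk_query t : {set idx} :=
  [set x | match x with inl (inl _) => false | inl (inr p) => (p.1 == t) && (p.2 == ord_max)
           | inr p => (p.1 == t) && (p.2 == ord_max) end]%SET.

Let HX : indep_family P X. Proof. by case: law => _ [_ [_ ?]]. Qed.

Lemma rvec_mu (S : {set idx}) t : inl (inl t) \in S -> rvec (mu t : blockType X S -> _).
Proof. by move=> tS; exact: (rvec_block (Z := X) tS). Qed.

Lemma rvec_z (S : {set idx}) t i : inl (inr (t, i)) \in S -> rvec (z t i : blockType X S -> _).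
Proof. by move=> tS; exact: (rvec_block (Z := X) tS). Qed.

Lemma measurable_y (S : {set idx}) t i : inr (t, i) \in S ->
  measurable_fun setT (y t i : blockType X S -> R).
Proof.
move=> tS; have := rvec_block (Z := X) tS 0.
by rewrite /= /scal; under eq_fun do rewrite mxE.
Qed.

Lemma sgv_yz t i : sgv P (fun w => y t i w *: z t i w) L.
Proof.
have [_ [gz [py _]]] := law.
apply: (sgv_sign_blocks HX (S1 := blk_y t i) (S2 := blk_z t i)) (pm1_sqr_full (py t i)) _.
- by apply/pred0P => x /=; rewrite !inE; case: x => [[]|] * /=; rewrite ?andbF.
- by apply: measurable_y; rewrite inE.
- by apply: rvec_z; rewrite inE.
- exact: gaussian_sgv.
Qed.

Lemma sgv_mu t : sgv P (mu t) (Rad ^+ 2 / d%:R)%:M.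
Proof. by case: law => umu _; exact: unif_sphere_sgv. Qed.

Lemma sgv_noise_mean t : sgv P (noise_mean t) (N%:R^-1 *: L).
Proof.
apply: (sgv_signed_mean HX (Sy := blk_y t) (Sz := blk_z t)) => //.
- by move=> i; apply/pred0P => x /=; rewrite !inE; case: x => [[]|] * /=; rewrite ?andbF.
- move=> i j ij; apply/pred0P => x /=; rewrite !inE; apply/negP => /andP[].
  by case/orP=> /eqP-> /orP[]/eqP // [e]; rewrite e eqxx in ij.
- by move=> i; apply: measurable_y; rewrite inE.
- by move=> i; apply: rvec_z; rewrite inE.
- exact: sgv_yz.
Qed.

Lemma rvec_noise_mean (S : {set idx}) t : blk_mean t \subset S ->
  rvec (noise_mean t : blockType X S -> _).
Proof.
move=> /fintype.subsetP sS.
apply: rvecZ; first exact: measurable_cst.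
rewrite (_ : (fun w => _) = fun w => \sum_(i < N.+1)
   (if i != ord_max then y t i w *: z t i w else 0)); last first.
  by apply/funext => w; rewrite big_mkcond.
apply: (@rvec_sum _ _ (blockType X S) d _ _ _
  (fun i (w : blockType X S) => if i != ord_max then y t i w *: z t i w else 0)) => i.
case: (boolP (i != ord_max)) => [imax|_]; last exact: rvec_cst.
apply: rvecZ; first by apply: measurable_y; apply: sS; rewrite inE /= eqxx.
by apply: rvec_z; apply: sS; rewrite inE /= eqxx.
Qed.

Lemma rvec_noise_query (S : {set idx}) t : blk_query t \subset S ->
  rvec (noise_query t : blockType X S -> _).
Proof.
move=> /fintype.subsetP sS; apply: rvecZ.
  by apply: measurable_y; apply: sS; rewrite inE /= !eqxx.
by apply: rvec_z; apply: sS; rewrite inE /= !eqxx.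
Qed.

Lemma disjoint_mu_mean t t' : [disjoint blk_mu t & blk_mean t']%B.
Proof. by apply/pred0P => x /=; rewrite !inE; case: x => [[]|] * /=; rewrite ?andbF. Qed.

Lemma disjoint_mu_query t t' : [disjoint blk_mu t & blk_query t']%B.
Proof. by apply/pred0P => x /=; rewrite !inE; case: x => [[]|] * /=; rewrite ?andbF. Qed.

Lemma disjoint_mean_query t t' : [disjoint blk_mean t & blk_query t']%B.
Proof.
apply/pred0P => x /=; rewrite !inE; case: x => [[//|p]|p];
by rewrite andbACA andNb andbF.
Qed.

Lemma sgv_vec_mean t : sgv P (vec_mean t) ((Rad ^+ 2 / d%:R)%:M + N%:R^-1 *: L).
Proof.
apply: (sgvD_blocks HX (disjoint_mu_mean t t)).
- by apply: rvec_mu; rewrite inE.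
- exact: rvec_noise_mean.
- exact: sgv_mu.
- exact: sgv_noise_mean.
Qed.

Lemma sgv_vec_query t : sgv P (vec_query t) ((Rad ^+ 2 / d%:R)%:M + L).
Proof.
apply: (sgvD_blocks HX (disjoint_mu_query t t)).
- by apply: rvec_mu; rewrite inE.
- exact: rvec_noise_query.
- exact: sgv_mu.
- exact: sgv_yz.
Qed.

Lemma rvec_vec_mean (S : {set idx}) t : (blk_mu t :|: blk_mean t)%SET \subset S ->
  rvec (vec_mean t : blockType X S -> _).
Proof.
rewrite finset.subUset => /andP[s1 s2]; apply: rvecD; last exact: rvec_noise_mean.
by apply: rvec_mu; apply: (fintype.subsetP s1); rewrite inE.
Qed.

Lemma rvec_vec_query (S : {set idx}) t : (blk_mu t :|: blk_query t)%SET \subset S ->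
  rvec (vec_query t : blockType X S -> _).
Proof.
rewrite finset.subUset => /andP[s1 s2]; apply: rvecD; last exact: rvec_noise_query.
by apply: rvec_mu; apply: (fintype.subsetP s1); rewrite inE.
Qed.

End PretrainVectors.

Section PretrainEvent.
Context {R : realType} {dO : measure_display} {O : measurableType dO} (P : probability O R).
Variables (d B N : nat) (L : 'M[R]_d) (Rad : R).
Variables (mu : 'I_B -> O -> 'cV[R]_d) (z : 'I_B -> 'I_N.+1 -> O -> 'cV[R]_d)
  (y : 'I_B -> 'I_N.+1 -> O -> R).
Hypotheses (N0 : (0 < N)%N) (d2 : (1 < d)%N) (pL : posdef L) (R0 : 0 < Rad)
  (law : pretrain_law P Rad L mu z y).

Variables (C delta cB : R).
Local Notation l := (ln (2 * B%:R ^+ 2 / delta)).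
Hypotheses (C64 : 64 <= C) (B0 : (0 < B)%N) (delta01 : 0 < delta < 1) (cB0 : 0 < cB)
  (A1 : C ^+ 2 * Num.sqrt (d%:R * \tr (L *m L)) <= Rad ^+ 2)
  (A2 : cB * d%:R <= B%:R)
  (A3 : C * l ^+ 4 <= d%:R).

Let d0 : 0 < d%:R :> R. Proof. by rewrite ltr0n (ltn_trans _ d2). Qed.
Let B1 : 1 <= B%:R :> R. Proof. by rewrite ler1n. Qed.
Let N1 : 1 <= N%:R :> R. Proof. by rewrite ler1n. Qed.
Let C1 : 0 < C. Proof. by move: C64; lra. Qed.
Let HX : indep_family P (pre_blocks mu z y). Proof. by case: law => _ [_ [_ ?]]. Qed.

(** The argument of the logarithm is at least 2 and exp(1/2) <= 2. The bound lets higher powers of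
    [l] dominate lower ones up to a constant. *)
Lemma log_ge_half : 1/2 <= l.
Proof.
have /andP[e0 e1] := delta01.
have h : 2 <= 2 * B%:R ^+ 2 / delta.
  rewrite ler_pdivlMr//; have := exprn_ege1 2 B1; nra.
rewrite -(@ler_expR R) lnK ?posrE; last by apply: lt_le_trans h.
apply: le_trans h; have := expR_ge1Dx (- (1/2) : R); rewrite expRN => h.
have e0' : 0 < expR (1/2) :> R by exact: expR_gt0.
have : (1 + - (1/2)) * expR (1/2) <= 1 :> R by rewrite -ler_pdivlMr// [leRHS]div1r.
lra.
Qed.

Lemma expR_log : expR (- l) = delta / (2 * B%:R ^+ 2).
Proof.
have /andP[e0 e1] := delta01.
have q : 0 < 2 * B%:R ^+ 2 / delta by rewrite divr_gt0 ?mulr_gt0 ?exprn_gt0 ?(lt_le_trans _ B1).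
by rewrite expRN lnK ?posrE// invf_div.
Qed.

Lemma trace_sqr_bound : d%:R * \tr (L *m L) <= Rad ^+ 4 / C ^+ 4.
Proof.
have s0 : 0 <= d%:R * \tr (L *m L) by rewrite mulr_ge0 ?(ltW d0)// trace_sqr_ge0// pL.1.
rewrite ler_pdivlMr ?exprn_gt0//.
have := A1; rewrite -(@ler_pXn2r _ 2) ?nnegrE ?mulr_ge0 ?exprn_ge0 ?sqrtr_ge0 ?(ltW C1) ?(ltW R0)//.
by rewrite exprMn sqr_sqrtr// -!exprM mulrC.
Qed.

Lemma trace_bound : \tr L <= Rad ^+ 2 / C ^+ 2.
Proof.
rewrite -(@ler_pXn2r _ 2) ?nnegrE ?posdef_trace_ge0// ?divr_ge0 ?exprn_ge0 ?(ltW C1) ?(ltW R0)//.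
apply: le_trans (trace_sqr_le pL.1) _; rewrite expr_div_n -!exprM.
exact: trace_sqr_bound.
Qed.

Lemma Rad4_ge0 : 0 <= Rad ^+ 4. Proof. by rewrite exprn_ge0// ltW. Qed.

Lemma trace_bound1 : \tr L <= Rad ^+ 2.
Proof.
apply: le_trans trace_bound _; rewrite ler_pdivrMr ?exprn_gt0//.
by rewrite ler_peMr ?sqr_ge0// exprn_ege1//; move: C64; lra.
Qed.

Lemma trace_sqr_bound1 : \tr (L *m L) <= Rad ^+ 4 / d%:R.
Proof.
rewrite ler_pdivlMr// mulrC; apply: le_trans trace_sqr_bound _.
rewrite ler_pdivrMr ?exprn_gt0// ler_peMr ?Rad4_ge0// exprn_ege1//; move: C64; lra.
Qed.

(** A common bound on tr(G H) for the three cross pairs formed by mu, the mean noise and the query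
    noise. The factor C^2 comes from [trace_bound]; the pair of noises would even allow C^4. *)
Let V1 := Rad ^+ 4 / (C ^+ 2 * d%:R).

Let V1_gt0 : 0 < V1. Proof. by rewrite divr_gt0 ?mulr_gt0 ?exprn_gt0. Qed.

Lemma invN_le1 : N%:R^-1 <= 1 :> R. Proof. by rewrite invf_le1// (lt_le_trans _ N1). Qed.
Lemma invN_gt0 : 0 < N%:R^-1 :> R. Proof. by rewrite invr_gt0 (lt_le_trans _ N1). Qed.

Lemma cross_mu_query : \tr ((Rad ^+ 2 / d%:R)%:M *m L) <= V1.
Proof.
rewrite mul_scalar_mx linearZ/=.
apply: (@le_trans _ _ (Rad ^+ 2 / d%:R * (Rad ^+ 2 / C ^+ 2))).
  by rewrite ler_wpM2l ?trace_bound// divr_ge0 ?sqr_ge0 ?(ltW d0).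
by rewrite le_eqVlt; apply/orP; left; apply/eqP; rewrite /V1; field; rewrite !gt_eqF.
Qed.

Lemma cross_mu_mean : \tr ((Rad ^+ 2 / d%:R)%:M *m (N%:R^-1 *: L)) <= V1.
Proof.
apply: le_trans cross_mu_query.
rewrite -scalemxAr [X in X <= _]linearZ/= mul_scalar_mx linearZ/= ler_piMl ?invN_le1//.
by rewrite mulr_ge0 ?posdef_trace_ge0// divr_ge0 ?sqr_ge0 ?(ltW d0).
Qed.

Lemma cross_mean_query : \tr ((N%:R^-1 *: L) *m L) <= V1.
Proof.
rewrite -scalemxAl linearZ/=; apply: (@le_trans _ _ (\tr (L *m L))).
  by rewrite ler_piMl ?invN_le1// trace_sqr_ge0// pL.1.
have h := trace_sqr_bound.
rewrite /V1 ler_pdivlMr ?mulr_gt0 ?exprn_gt0//.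
rewrite ler_pdivlMr ?exprn_gt0// in h.
apply: (@le_trans _ _ (d%:R * \tr (L *m L) * C ^+ 4)) => //.
rewrite mulrA [_ * d%:R]mulrC mulrA ler_wpM2l//.
  by rewrite mulr_ge0 ?(ltW d0)// trace_sqr_ge0// pL.1.
by rewrite ler_weXn2l//; move: C64; lra.
Qed.

(** The inequality amounts to C^2 d >= 1024 l^2. By (A3) and l^2 >= 1/4 it follows from C^3 / 4 >=
    1024, which C >= 64 satisfies amply. The target R^2 / 8 is such that three cross terms still
    leave a margin above R^2 / 2. *)
Lemma cross_threshold : 2 * Num.sqrt V1 * (2 * l) <= Rad ^+ 2 / 8.
Proof.
have l0 := log_ge_half.
rewrite -(@ler_pXn2r _ 2) ?nnegrE ?divr_ge0 ?sqr_ge0//; last first.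
  by rewrite !mulr_ge0 ?sqrtr_ge0//; lra.
rewrite !exprMn sqr_sqrtr ?(ltW V1_gt0)// /V1.
have h : 16 * 64 * l ^+ 2 <= C ^+ 2 * d%:R.
  have l2 : 1/4 <= l ^+ 2 by nra.
  have h1 : C * l ^+ 2 / 4 <= d%:R.
    apply: le_trans A3; rewrite (_ : l ^+ 4 = l ^+ 2 * l ^+ 2); last by ring.
    set x := l ^+ 2 in l2 *.
    have : 0 <= C * x * (x - 1/4) by apply: mulr_ge0; [apply: mulr_ge0 (ltW C1) _|]; lra.
    lra.
  have h2 : C ^+ 2 * (C * l ^+ 2 / 4) <= C ^+ 2 * d%:R by rewrite ler_wpM2l ?sqr_ge0.
  apply: le_trans h2; rewrite (_ : C ^+ 2 * (C * l ^+ 2 / 4) = C ^+ 3 / 4 * l ^+ 2); last by field.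
  rewrite ler_wpM2r ?sqr_ge0//.
  have c2 : 64 * 64 <= C * C by apply: ler_pM.
  have c1 : 1 <= C by move: C64; lra.
  have c3 : 64 * 64 * 1 <= C * C * C by apply: ler_pM => //; rewrite mulr_ge0.
  rewrite (_ : C ^+ 3 = C * C * C); last by ring.
  rewrite ler_pdivlMr//; apply: le_trans c3; rewrite mulr1 -!mulrA -natrM mulrC.
  by rewrite -!natrM ler_nat.
have q0 : 0 < C ^+ 2 * d%:R by rewrite mulr_gt0 ?exprn_gt0.
rewrite (_ : 2 ^+ 2 * (Rad ^+ 4 / (C ^+ 2 * d%:R)) * (2 ^+ 2 * l ^+ 2) =
  Rad ^+ 4 / 64 * (16 * 64 * l ^+ 2 / (C ^+ 2 * d%:R))); last by field; rewrite !gt_eqF.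
rewrite (_ : Rad ^+ 2 ^+ 2 * 8^-1 ^+ 2 = Rad ^+ 4 / 64); last by field.
rewrite ler_piMr ?divr_ge0 ?Rad4_ge0// ler_pdivrMr// mul1r//.
Qed.

Lemma dotv_blocks_likely (S1 S2 : {set pre_idx B N}) (u v : O -> 'cV[R]_d)
    (G H : 'M[R]_d) V s t :
  [disjoint S1 & S2]%B ->
  rvec (u : blockType (pre_blocks mu z y) S1 -> _) ->
  rvec (v : blockType (pre_blocks mu z y) S2 -> _) ->
  sgv P u G -> sgv P v H -> psd G -> posdef H -> \tr (G *m H) <= V -> 0 < V ->
  2 * Num.sqrt V * t <= s ->
  likely P [set w | `|dotv (u w) (v w)| < s] (4 * expR (- t)).
Proof.
move=> S12 mu' mv su sv pG pH GHV V0 Vs; have [K eH] := cholesky pH.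
have mO : measurable_fun setT (fun w => `|dotv (u w) (v w)|).
  apply: measurableT_comp => //.
  by apply: measurable_dotv; [exact: (rvec_from_block HX mu')|exact: (rvec_from_block HX mv)].
apply: likely_lt => //.
apply: le_trans (dotv_blocks_tail HX t S12 mu' mv su sv pG eH GHV V0).
apply: le_measure; rewrite ?inE; [exact: measurable_le_cst|exact: measurable_le_cst|].
by move=> w /= h; apply: le_trans h.
Qed.

(** The exponent is 2 l so that each failure has probability of order delta^2 / B^4, and all B^2
    pairs of tasks can be summed. *)
Local Notation eps := (expR (- (2 * l))).

Lemma likely_cross_mu_query t :
  likely P [set w | `|dotv (mu t w) (noise_query z y t w)| < Rad ^+ 2 / 8] (4 * eps).
Proof.
apply: (dotv_blocks_likely (disjoint_mu_query N t t) (V := V1) (G := (Rad ^+ 2 / d%:R)%:M) (H := L)) => //.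
- by apply: rvec_mu; rewrite inE.
- exact: rvec_noise_query.
- exact: (sgv_mu d2 R0 law).
- exact: (sgv_yz pL law).
- by apply: posdef_psd; apply: posdef_scalar; rewrite divr_gt0 ?exprn_gt0.
- exact: cross_mu_query.
- exact: cross_threshold.
Qed.

Lemma likely_cross_mu_mean t :
  likely P [set w | `|dotv (mu t w) (noise_mean z y t w)| < Rad ^+ 2 / 8] (4 * eps).
Proof.
apply: (dotv_blocks_likely (disjoint_mu_mean N t t) (V := V1) (G := (Rad ^+ 2 / d%:R)%:M)
  (H := N%:R^-1 *: L)) => //.
- by apply: rvec_mu; rewrite inE.
- exact: rvec_noise_mean.
- exact: (sgv_mu d2 R0 law).
- exact: (sgv_noise_mean N0 pL law).
- by apply: posdef_psd; apply: posdef_scalar; rewrite divr_gt0 ?exprn_gt0.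
- by apply: posdefZ => //; exact: invN_gt0.
- exact: cross_mu_mean.
- exact: cross_threshold.
Qed.

Lemma likely_cross_mean_query t :
  likely P [set w | `|dotv (noise_mean z y t w) (noise_query z y t w)| < Rad ^+ 2 / 8] (4 * eps).
Proof.
apply: (dotv_blocks_likely (disjoint_mean_query N t t) (V := V1) (G := N%:R^-1 *: L) (H := L)) => //.
- exact: rvec_noise_mean.
- exact: rvec_noise_query.
- exact: (sgv_noise_mean N0 pL law).
- exact: (sgv_yz pL law).
- by apply: posdef_psd; apply: posdefZ => //; exact: invN_gt0.
- exact: cross_mean_query.
- exact: cross_threshold.
Qed.

Let a := Rad ^+ 2 / d%:R.
Let a_gt0 : 0 < a. Proof. by rewrite divr_gt0 ?exprn_gt0. Qed.

Lemma trace_shift c : 0 <= c <= 1 -> \tr (a%:M + c *: L) <= 2 * Rad ^+ 2.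
Proof.
move=> /andP[c0 c1]; rewrite linearD/= mxtrace_scalar linearZ/= -[a *+ d]mulr_natr [a * _]divfK ?gt_eqF//.
have : c * \tr L <= Rad ^+ 2.
  by apply: le_trans trace_bound1; rewrite ler_piMl ?posdef_trace_ge0.
lra.
Qed.

Lemma trace_shift_sqr c : 0 <= c <= 1 ->
  \tr ((a%:M + c *: L) *m (a%:M + c *: L)) <= 4 * Rad ^+ 4 / d%:R.
Proof.
move=> /andP[c0 c1].
have -> : \tr ((a%:M + c *: L) *m (a%:M + c *: L)) =
    a ^+ 2 * d%:R + 2 * a * (c * \tr L) + c ^+ 2 * \tr (L *m L).
  rewrite mulmxDl !mulmxDr -scalar_mxM mul_scalar_mx mul_mx_scalar -scalemxAl -scalemxAr.
  by rewrite !linearD/= mxtrace_scalar !linearZ/= -[_ *+ d]mulr_natr; ring.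
have h1 : c * \tr L <= Rad ^+ 2.
  by apply: le_trans trace_bound1; rewrite ler_piMl ?posdef_trace_ge0.
have h2 : c ^+ 2 * \tr (L *m L) <= Rad ^+ 4 / d%:R.
  apply: le_trans trace_sqr_bound1; rewrite ler_piMl ?trace_sqr_ge0 ?pL.1//.
  by rewrite exprn_ile1.
have h3 : 2 * a * (c * \tr L) <= 2 * a * Rad ^+ 2 by rewrite ler_wpM2l// mulr_ge0// ltW.
(* Here 4 = 1 + 2 + 1: the scalar part, the mixed part and the noise part contribute in these
   proportions. *)
have -> : 4 * Rad ^+ 4 / d%:R = a ^+ 2 * d%:R + 2 * a * Rad ^+ 2 + Rad ^+ 4 / d%:R.
  by rewrite /a; field; rewrite gt_eqF.
by rewrite !lerD.
Qed.

Let V3 := 4 * Rad ^+ 4 / d%:R.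
Let V3_gt0 : 0 < V3. Proof. by rewrite divr_gt0 ?mulr_gt0 ?exprn_gt0. Qed.

Lemma pair_threshold : 2 * Num.sqrt V3 * (2 * l) = 8 * Rad ^+ 2 * l / Num.sqrt d%:R.
Proof.
have -> : Num.sqrt V3 = 2 * Rad ^+ 2 / Num.sqrt d%:R.
  rewrite /V3 (_ : 4 * Rad ^+ 4 / d%:R = (2 * Rad ^+ 2) ^+ 2 * d%:R^-1); last by ring.
  rewrite sqrtrM ?sqr_ge0// sqrtr_sqr sqrtrV// ger0_norm// mulr_ge0//.
  by rewrite sqr_ge0.
ring.
Qed.

Lemma posdef_shift c : 0 < c -> posdef (a%:M + c *: L).
Proof. by move=> c0; apply: posdefD; [exact: posdef_scalar|exact: posdefZ]. Qed.

Lemma likely_norm_mean t :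
  likely P [set w | dotv (vec_mean mu z y t w) (vec_mean mu z y t w) < 32 * Rad ^+ 2 * l] (2 * eps).
Proof.
have rv : rvec (vec_mean mu z y t).
  by apply: (rvec_from_block HX (S := finset.setT)); apply: rvec_vec_mean; exact: finset.subsetT.
apply: likely_lt; first exact: measurable_dotv.
rewrite (_ : 32 * Rad ^+ 2 * l = 8 * (2 * Rad ^+ 2) * (2 * l)); last by ring.
apply: (sgv_normsq_tail _ rv (sgv_vec_mean N0 d2 pL R0 law t)).
- by apply: posdef_psd; apply: posdef_shift; exact: invN_gt0.
- by apply: trace_shift; rewrite ltW ?invN_gt0 ?invN_le1.
- by rewrite mulr_gt0 ?exprn_gt0.
Qed.

Lemma likely_norm_query t :
  likely P [set w | dotv (vec_query mu z y t w) (vec_query mu z y t w) < 32 * Rad ^+ 2 * l] (2 * eps).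
Proof.
have rv : rvec (vec_query mu z y t).
  by apply: (rvec_from_block HX (S := finset.setT)); apply: rvec_vec_query; exact: finset.subsetT.
apply: likely_lt; first exact: measurable_dotv.
rewrite (_ : 32 * Rad ^+ 2 * l = 8 * (2 * Rad ^+ 2) * (2 * l)); last by ring.
have := sgv_vec_query d2 pL R0 law t; rewrite -[X in _ + X]scale1r => sv.
apply: (sgv_normsq_tail _ rv sv).
- by apply: posdef_psd; apply: posdef_shift.
- by apply: trace_shift; rewrite ler01 lexx.
- by rewrite mulr_gt0 ?exprn_gt0.
Qed.

Lemma likely_pair_mean t t' : t != t' ->
  likely P [set w | `|dotv (vec_mean mu z y t w) (vec_mean mu z y t' w)|
     < 8 * Rad ^+ 2 * l / Num.sqrt d%:R] (4 * eps).
Proof.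
move=> tt'; rewrite -pair_threshold.
apply: (dotv_blocks_likely (S1 := (blk_mu N t :|: blk_mean N t)%SET)
  (S2 := (blk_mu N t' :|: blk_mean N t')%SET) (V := V3)
  (G := a%:M + N%:R^-1 *: L) (H := a%:M + N%:R^-1 *: L)) => //.
- apply/pred0P => x /=; rewrite !inE; apply/negP => /andP[].
  case: x => [[s|p]|p] /=; rewrite ?orbF ?orFb.
  + by move=> /eqP[->] /eqP[e]; rewrite e eqxx in tt'.
  + by move=> /andP[/eqP-> _] /andP[/eqP e _]; rewrite e eqxx in tt'.
  + by move=> /andP[/eqP-> _] /andP[/eqP e _]; rewrite e eqxx in tt'.
- exact: rvec_vec_mean.
- exact: rvec_vec_mean.
- exact: (sgv_vec_mean N0 d2 pL R0 law t).
- exact: (sgv_vec_mean N0 d2 pL R0 law t').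
- by apply: posdef_psd; apply: posdef_shift; exact: invN_gt0.
- by apply: posdef_shift; exact: invN_gt0.
- by apply: trace_shift_sqr; rewrite ltW ?invN_gt0 ?invN_le1.
Qed.

Lemma likely_pair_query t t' : t != t' ->
  likely P [set w | `|dotv (vec_query mu z y t w) (vec_query mu z y t' w)|
     < 8 * Rad ^+ 2 * l / Num.sqrt d%:R] (4 * eps).
Proof.
move=> tt'; rewrite -pair_threshold.
have sv s : sgv P (vec_query mu z y s) (a%:M + 1 *: L).
  by rewrite scale1r; exact: sgv_vec_query d2 pL R0 law s.
apply: (dotv_blocks_likely (S1 := (blk_mu N t :|: blk_query N t)%SET)
  (S2 := (blk_mu N t' :|: blk_query N t')%SET) (V := V3)
  (G := a%:M + 1 *: L) (H := a%:M + 1 *: L)) => //.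
- apply/pred0P => x /=; rewrite !inE; apply/negP => /andP[].
  case: x => [[s|p]|p] /=; rewrite ?orbF ?orFb.
  + by move=> /eqP[->] /eqP[e]; rewrite e eqxx in tt'.
  + by move=> /andP[/eqP-> _] /andP[/eqP e _]; rewrite e eqxx in tt'.
  + by move=> /andP[/eqP-> _] /andP[/eqP e _]; rewrite e eqxx in tt'.
- exact: rvec_vec_query.
- exact: rvec_vec_query.
- by apply: posdef_psd; apply: posdef_shift.
- exact: posdef_shift.
- by apply: trace_shift_sqr; rewrite ler01 lexx.
Qed.

(** The squares of the labels and the norms of the centres, fixed only almost surely, are included
    so that every statement about the max-margin matrix is deterministic in [w]. *)
Definition pretrain_good (w : O) : Prop :=
  [/\ forall p : 'I_B * 'I_N.+1, y p.1 p.2 w ^+ 2 = 1,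
      forall t, vnorm (mu t w) = Rad,
      forall t, [/\ `|dotv (mu t w) (noise_query z y t w)| < Rad ^+ 2 / 8,
                    `|dotv (mu t w) (noise_mean z y t w)| < Rad ^+ 2 / 8 &
                    `|dotv (noise_mean z y t w) (noise_query z y t w)| < Rad ^+ 2 / 8],
      forall t, dotv (vec_mean mu z y t w) (vec_mean mu z y t w) < 32 * Rad ^+ 2 * l /\
                dotv (vec_query mu z y t w) (vec_query mu z y t w) < 32 * Rad ^+ 2 * l &
      forall p : 'I_B * 'I_B, p.1 != p.2 ->
         `|dotv (vec_mean mu z y p.1 w) (vec_mean mu z y p.2 w)| < 8 * Rad ^+ 2 * l / Num.sqrt d%:R /\
         `|dotv (vec_query mu z y p.1 w) (vec_query mu z y p.2 w)| < 8 * Rad ^+ 2 * l / Num.sqrt d%:R].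

Lemma likely_pretrain_good : likely P [set w | pretrain_good w] (10 * delta).
Proof.
have [umu [_ [py _]]] := law.
have e0 : 0 <= eps by exact: expR_ge0.
pose E1 := [set w | forall p : 'I_B * 'I_N.+1, y p.1 p.2 w ^+ 2 = 1].
have l1 : likely P E1 (#|{: 'I_B * 'I_N.+1}|%:R * 0).
  apply: (likely_forall (E := fun p : 'I_B * 'I_N.+1 => [set w | y p.1 p.2 w ^+ 2 = 1])) => p.
  apply: likely_full; last exact: pm1_sqr_full (py p.1 p.2).
  exact: measurable_sqr1 (py p.1 p.2).1.
pose E2 := [set w | forall t, vnorm (mu t w) = Rad].
have l2 : likely P E2 (#|'I_B|%:R * 0).
  apply: (likely_forall (E := fun t => [set w | vnorm (mu t w) = Rad])) => t.
  have [mmu [u1 _]] := umu t.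
  apply: likely_full => //.
  rewrite (_ : [set w | _] = (fun w => vnorm (mu t w)) @^-1` [set Rad])//.
  by rewrite -[X in measurable X]setTI; exact: (measurable_vnorm mmu).
have l3 := likely_forall likely_cross_mu_query.
have l4 := likely_forall likely_cross_mu_mean.
have l5 := likely_forall likely_cross_mean_query.
have l6 := likely_forall likely_norm_mean.
have l7 := likely_forall likely_norm_query.
pose F8 (p : 'I_B * 'I_B) := [set w | p.1 != p.2 ->
  `|dotv (vec_mean mu z y p.1 w) (vec_mean mu z y p.2 w)| < 8 * Rad ^+ 2 * l / Num.sqrt d%:R].
have l8 : likely P [set w | forall p, F8 p w] (#|{: 'I_B * 'I_B}|%:R * (4 * eps)).
  apply: likely_forall => -[t t']; have [tt'|tt'] := eqVneq t t'.
    by apply: likelyT; [rewrite mulr_ge0|apply/seteqP; split => // w _ /=; rewrite /F8/= tt' eqxx].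
  rewrite (_ : F8 _ = [set w | `|dotv (vec_mean mu z y t w) (vec_mean mu z y t' w)|
     < 8 * Rad ^+ 2 * l / Num.sqrt d%:R]); first exact: likely_pair_mean.
  by apply/seteqP; split => w; rewrite /F8/= tt' => h //; exact: h.
pose F9 (p : 'I_B * 'I_B) := [set w | p.1 != p.2 ->
  `|dotv (vec_query mu z y p.1 w) (vec_query mu z y p.2 w)| < 8 * Rad ^+ 2 * l / Num.sqrt d%:R].
have l9 : likely P [set w | forall p, F9 p w] (#|{: 'I_B * 'I_B}|%:R * (4 * eps)).
  apply: likely_forall => -[t t']; have [tt'|tt'] := eqVneq t t'.
    by apply: likelyT; [rewrite mulr_ge0|apply/seteqP; split => // w _ /=; rewrite /F9/= tt' eqxx].
  rewrite (_ : F9 _ = [set w | `|dotv (vec_query mu z y t w) (vec_query mu z y t' w)|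
     < 8 * Rad ^+ 2 * l / Num.sqrt d%:R]); first exact: likely_pair_query.
  by apply/seteqP; split => w; rewrite /F9/= tt' => h //; exact: h.
have := likelyI l1 (likelyI l2 (likelyI l3 (likelyI l4 (likelyI l5 (likelyI l6 (likelyI l7 (likelyI l8 l9))))))).
rewrite (_ : _ `&` _ = [set w | pretrain_good w]); last first.
  apply/seteqP; split => w /=.
    move=> [h1 [h2 [h3 [h4 [h5 [h6 [h7 [h8 h9]]]]]]]]; split => //.
    by move=> p pp; split; [exact: h8|exact: h9].
  move=> [h1 h2 h3 h4 h5]; do 2 (split => //).
  split; first by move=> t; have [] := h3 t.
  split; first by move=> t; have [] := h3 t.
  split; first by move=> t; have [] := h3 t.
  split; first by move=> t; have [] := h4 t.
  split; first by move=> t; have [] := h4 t.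
  by split => p /h5 [].
apply: likely_le.
have -> : eps = (delta / (2 * B%:R ^+ 2)) ^+ 2.
  by rewrite -expR_log -expRM_natl; congr expR; ring.
rewrite !card_prod !card_ord !natrM !mulr0 !add0r.
have /andP[dl0 dl1] := delta01.
have b0 : 0 < B%:R :> R by exact: lt_le_trans B1.
have b1 := B1; set b := B%:R in b1 b0 *.
(* Per task, three cross events with prefactor 4 and two norm events with prefactor 2 give 16 b; two
   events with prefactor 4 per ordered pair give 8 b^2. The total is at most 6 delta^2. *)
rewrite (_ : _ + _ = (16 * b + 8 * b ^+ 2) * (delta / (2 * b ^+ 2)) ^+ 2); last by ring.
rewrite (_ : _ * _ ^+ 2 = delta * delta * (4 / b ^+ 3 + 2 / b ^+ 2)); last by field; rewrite gt_eqF.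
have i3 : 4 / b ^+ 3 <= 4 by rewrite ler_pdivrMr ?exprn_gt0// ler_peMr// exprn_ege1.
have i2 : 2 / b ^+ 2 <= 2 by rewrite ler_pdivrMr ?exprn_gt0// ler_peMr// exprn_ege1.
have dd : delta * delta <= delta by rewrite ler_piMl ?(ltW dl0) ?(ltW dl1).
apply: (@le_trans _ _ (delta * 6)).
  apply: ler_pM => //; first by rewrite mulr_ge0 ?(ltW dl0).
    by rewrite addr_ge0 ?divr_ge0 ?exprn_ge0 ?(ltW b0).
  lra.
lra.
Qed.

End PretrainEvent.

(** * Deterministic consequences of the pre-training event *)

Section PretrainConclusion.
Context {R : realType} {dO : measure_display} {O : measurableType dO}.
Variables (d B N : nat) (Rad : R).
Variables (mu : 'I_B -> O -> 'cV[R]_d) (z : 'I_B -> 'I_N.+1 -> O -> 'cV[R]_d)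
  (y : 'I_B -> 'I_N.+1 -> O -> R).
Hypotheses (N0 : (0 < N)%N) (d0 : (0 < d)%N) (R0 : 0 < Rad) (B0 : (0 < B)%N).
Variables (delta cB : R).
Local Notation l := (ln (2 * B%:R ^+ 2 / delta)).
Hypotheses (cB0 : 0 < cB) (l0 : 1/2 <= l) (A2 : cB * d%:R <= B%:R).
Variable w : O.
Hypothesis good : pretrain_good Rad mu z y delta w.

Lemma good_pre_muhat t : pre_muhat mu z y t w = vec_mean mu z y t w.
Proof.
have [y1 _ _ _ _] := good.
rewrite /pre_muhat /vec_mean /noise_mean.
have -> : \sum_(i < N.+1 | i != ord_max) y t i w *: pre_x mu z y t i w =
    N%:R *: mu t w + \sum_(i < N.+1 | i != ord_max) y t i w *: z t i w.
  rewrite (eq_bigr (fun i => mu t w + y t i w *: z t i w)) => [|i _]; last first.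
    by rewrite /pre_x scalerDr scalerA -expr2 (y1 (t, i)) scale1r.
  by rewrite big_split/= sumr_const cardC1 card_ord scaler_nat.
by rewrite scalerDr scalerA mulVf ?scale1r// pnatr_eq0 -lt0n.
Qed.

Lemma good_query t : y t ord_max w *: pre_x mu z y t ord_max w = vec_query mu z y t w.
Proof.
have [y1 _ _ _ _] := good.
by rewrite /pre_x scalerDr scalerA -expr2 (y1 (t, ord_max)) scale1r.
Qed.

(** The main term is |mu|^2 = R^2, and the three cross terms remove at most 3 R^2 / 8. *)
Lemma good_margin t : Rad ^+ 2 / 2 <= dotv (vec_mean mu z y t w) (vec_query mu z y t w).
Proof.
have [_ nmu cr _ _] := good; have [h1 h2 h3] := cr t.
rewrite /vec_mean /vec_query dotvDl !dotvDr -(vnorm_sqr (mu t w)) nmu.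
rewrite [dotv (noise_mean _ _ _ _) (mu t w)]dotvC.
move: h1 h2 h3; rewrite !ltr_norml => /andP[a1 _] /andP[a2 _] /andP[a3 _].
move: a1 a2 a3; move: (dotv (mu t w) (noise_query z y t w)) (dotv (mu t w) (noise_mean z y t w))
  (dotv (noise_mean z y t w) (noise_query z y t w)) => x1 x2 x3; have := sqr_ge0 Rad; move: (Rad ^+ 2) => r2; lra.
Qed.

(** With M = 32 R^2 l, a diagonal term is at most M^2 and an off-diagonal one at most M^2 / d, after
    relaxing the constant 8 of the pair bounds to 32. *)
Lemma good_pair_sum :
  \sum_t \sum_t' dotv (vec_mean mu z y t w) (vec_mean mu z y t' w) *
     dotv (vec_query mu z y t w) (vec_query mu z y t' w) <=
  (32 * Rad ^+ 2 * l) ^+ 2 * (B%:R + B%:R ^+ 2 / d%:R).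
Proof.
have [_ _ _ nm pr] := good.
have dd : 0 < d%:R :> R by rewrite ltr0n.
have s0 : 0 < Num.sqrt d%:R :> R by rewrite sqrtr_gt0.
set M := 32 * Rad ^+ 2 * l.
have l0' : 0 <= l by move: l0; lra.
have M0 : 0 <= M by apply: mulr_ge0 l0'; rewrite mulr_ge0// sqr_ge0.
have bound t t' : dotv (vec_mean mu z y t w) (vec_mean mu z y t' w) *
     dotv (vec_query mu z y t w) (vec_query mu z y t' w) <=
     (t == t')%:R * M ^+ 2 + M ^+ 2 / d%:R.
  have [<-|tt'] := eqVneq t t'.
    have [h1 h2] := nm t; rewrite mul1r.
    apply: (@le_trans _ _ (M ^+ 2)); last by rewrite lerDl divr_ge0 ?sqr_ge0// ltW.
    by rewrite expr2 ler_pM ?dotvv_ge0// ltW.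
  have [h1 h2] := pr (t, t') tt'.
  rewrite mul0r add0r; apply: le_trans (ler_norm _) _; rewrite normrM.
  have hM : 8 * Rad ^+ 2 * l / Num.sqrt d%:R <= M / Num.sqrt d%:R.
    rewrite ler_wpM2r ?invr_ge0 ?(ltW s0)// /M.
    by rewrite ler_wpM2r// ler_wpM2r ?sqr_ge0// ler_nat.
  rewrite (_ : M ^+ 2 / d%:R = M / Num.sqrt d%:R * (M / Num.sqrt d%:R)); last first.
    by rewrite -expr2 expr_div_n sqr_sqrtr// ltW.
  by rewrite ler_pM// (le_trans (ltW _) hM).
apply: (@le_trans _ _ (\sum_(t < B) (M ^+ 2 + B%:R * (M ^+ 2 / d%:R)))).
  apply: ler_sum => t _; apply: (@le_trans _ _ (\sum_t' ((t == t')%:R * M ^+ 2 + M ^+ 2 / d%:R))).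
    by apply: ler_sum => t' _.
  by rewrite big_split/= sum_indicator sumr_const card_ord mulr_natl.
rewrite sumr_const card_ord -mulr_natl le_eqVlt; apply/orP; left; apply/eqP; ring.
Qed.

Let rho := Num.min cB 1 / l ^+ 2.

(** With cm = min(cB, 1), the pair sum forces |W|_F^2 to be at least of order cm d / (R^4 l^2).
    Multiplying |W|_F by the margin R^2 / 2 cancels R, and tr W / |W|_F is at least of order sqrt(cm
    d) / l. Since cm <= 1 and l >= 1/2, this may be weakened to cm sqrt d / l^2, which is rho sqrt
    d. *)
Theorem pretrain_good_max_margin
  (muh := fun t => pre_muhat mu z y t w) (yq := fun t => y t ord_max w)
  (xq := fun t => pre_x mu z y t ord_max w) :
  (exists W, is_max_margin muh yq xq W) /\
  forall W, is_max_margin muh yq xq W ->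
    0 < frob2 W /\ rho * Num.sqrt d%:R / 200 * Num.sqrt (frob2 W) <= \tr W.
Proof.
have mg t : Rad ^+ 2 / 2 <= dotv (muh t) (yq t *: xq t).
  by rewrite /muh /yq /xq good_pre_muhat good_query good_margin.
have m0 : 0 < Rad ^+ 2 / 2 by rewrite divr_gt0 ?exprn_gt0.
split.
  apply: (@max_margin_exists _ _ _ _ _ _ ((Rad ^+ 2 / 2)^-1 *: 1%:M)) => t.
  by rewrite bilZm bil_scalar mul1r mulrC ler_pdivlMr// mul1r.
move=> W mmW.
have trW := max_margin_trace mmW m0 mg.
set F := frob2 W in trW *.
have b0 : 0 < B%:R :> R by rewrite ltr0n.
have dd : 0 < d%:R :> R by rewrite ltr0n.
set M := 32 * Rad ^+ 2 * l.
have hF : B%:R ^+ 2 <= F * (M ^+ 2 * (B%:R + B%:R ^+ 2 / d%:R)).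
  apply: (max_margin_frob B0 mmW).
  apply: le_trans good_pair_sum.
  rewrite le_eqVlt; apply/orP; left; apply/eqP; apply: eq_bigr => t _; apply: eq_bigr => t' _.
  by rewrite /muh /yq /xq !good_pre_muhat !good_query.
have lp : 0 < l by move: l0; lra.
have F0 : 0 < F.
  rewrite lt_neqAle frob2_ge0 andbT; apply/eqP => e; move: hF; rewrite -e mul0r.
  by rewrite leNgt exprn_gt0.
split => //.
set cm := Num.min cB 1.
have cm0 : 0 < cm by rewrite lt_min cB0 ltr01.
have cm1 : cm <= 1 by rewrite ge_min lexx orbT.
have cmd : cm * d%:R <= B%:R.
  by apply: le_trans A2; rewrite ler_wpM2r ?(ltW dd)// ge_min lexx.
(* from [1/B + 1/d <= 2 / (cm d)] *)
have h1 : cm * d%:R <= F * (2 * M ^+ 2).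
  have : B%:R * (cm * d%:R) <= F * (2 * M ^+ 2) * B%:R; last by rewrite mulrC ler_pM2r.
  have h2 : B%:R ^+ 2 * (cm * d%:R) <= F * (M ^+ 2 * (B%:R + B%:R ^+ 2 / d%:R)) * (cm * d%:R).
    by rewrite ler_wpM2r// mulr_ge0// ltW.
  have h3 : (B%:R + B%:R ^+ 2 / d%:R) * (cm * d%:R) <= 2 * B%:R ^+ 2.
    rewrite mulrDl (_ : B%:R ^+ 2 / d%:R * (cm * d%:R) = cm * B%:R ^+ 2); last by field; rewrite gt_eqF.
    have : B%:R * (cm * d%:R) <= B%:R ^+ 2 by rewrite expr2 ler_wpM2l// ltW.
    have : cm * B%:R ^+ 2 <= B%:R ^+ 2 by rewrite ler_piMl ?sqr_ge0.
    lra.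
  rewrite -(ler_pM2l b0).
  rewrite (_ : B%:R * (B%:R * (cm * d%:R)) = B%:R ^+ 2 * (cm * d%:R)); last by ring.
  apply: le_trans h2 _.
  have fm : 0 <= F * M ^+ 2 by rewrite mulr_ge0 ?sqr_ge0// ltW.
  apply: le_trans (_ : F * M ^+ 2 * (2 * B%:R ^+ 2) <= _); last first.
    by rewrite le_eqVlt; apply/orP; left; apply/eqP; ring.
  by apply: le_trans (ler_wpM2l fm h3); rewrite le_eqVlt; apply/orP; left; apply/eqP; ring.
apply: le_trans trW.
have sF : F = Num.sqrt F * Num.sqrt F by rewrite -expr2 sqr_sqrtr// ltW.
have sF0 : 0 < Num.sqrt F by rewrite sqrtr_gt0.
rewrite [in leRHS]sF mulrA ler_pM2r//.
have sd0 : 0 < Num.sqrt d%:R :> R by rewrite sqrtr_gt0.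
rewrite -(@ler_pXn2r _ 2) ?nnegrE ?mulr_ge0 ?invr_ge0 ?(ltW cm0) ?(ltW sd0) ?(ltW sF0) ?sqr_ge0 ?(ltW R0)//.
rewrite /rho -/cm [leRHS]exprMn [in leRHS]expr_div_n [in leRHS]sqr_sqrtr ?(ltW F0)//.
have -> : (cm / l ^+ 2 * Num.sqrt d%:R / 200) ^+ 2 = cm ^+ 2 * Num.sqrt d%:R ^+ 2 / l ^+ 4 / (200 * 200).
  by field; rewrite gt_eqF.
rewrite sqr_sqrtr ?(ltW dd)//.
have l2 : 1/4 <= l ^+ 2 by have l0c := l0; nra.
have l20 : 0 < l ^+ 2 by rewrite exprn_gt0.
have l40 : 0 < l ^+ 4 by rewrite exprn_gt0.
have r4 : 0 < Rad ^+ 2 ^+ 2 by rewrite !exprn_gt0.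
have h4 : cm ^+ 2 * d%:R <= F * (2 * M ^+ 2).
  by apply: le_trans h1; rewrite expr2 -mulrA ler_piMl// mulr_ge0// ltW.
rewrite ler_pdivrMr ?mulr_gt0// ler_pdivrMr//; apply: le_trans h4 _.
rewrite /M (_ : F * (2 * (32 * Rad ^+ 2 * l) ^+ 2) = (Rad ^+ 2 ^+ 2 * F) * (l ^+ 2 * (2 * 32 * 32))); last by ring.
rewrite (_ : Rad ^+ 2 ^+ 2 / 2 ^+ 2 * F * (200 * 200) * l ^+ 4 = (Rad ^+ 2 ^+ 2 * F) * (l ^+ 2 * (l ^+ 2 * (100 * 100)))); last first.
  by field.
apply: ler_wpM2l; first by rewrite mulr_ge0 ?(ltW r4) ?(ltW F0).
apply: ler_wpM2l; first exact: ltW.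
(* The comparison is 2 * 32^2 = 2048 <= 2500 = 100^2 / 4, using l^2 >= 1/4. The 100 is half of the
   200 in the statement, the half being that of the margin R^2 / 2. *)
apply: (@le_trans _ _ (1/4 * (100 * 100))); last by rewrite ler_wpM2r.
rewrite (_ : 1/4 * (100 * 100) = 50 * 50); last by field.
by rewrite -!natrM ler_nat.
Qed.

End PretrainConclusion.

(** * The test error *)

Section SignConcentration.
Context {R : realType} {dO : measure_display} {O : measurableType dO} (P : probability O R).

Lemma measurable_eq_cst (f : O -> R) (c : R) : measurable_fun setT f ->
  measurable [set w | f w = c].
Proof.
move=> mf; rewrite (_ : [set w | _] = f @^-1` [set c])//.
by rewrite -[X in measurable X]setTI; exact: mf.
Qed.

Lemma pm1_mgf (y : O -> R) q t : pm1_rv P q y -> 0 <= q <= 1/2 -> 0 <= t <= 1/2 ->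
  (\int[P]_w (expR (- t * y w))%:E <= (expR (- (1 - 2 * q) * t + 2 * t ^+ 2))%:E)%E.
Proof.
move=> hy /andP[q0 q1] /andP[t0 t1]; have [my [y1 yN1]] := hy.
have mG := measurable_sqr1 my; have G1 := pm1_sqr_full hy.
pose A := [set w | y w = 1]; pose B := [set w | y w = -1].
have mA : measurable A by exact: measurable_eq_cst.
have mB : measurable B by exact: measurable_eq_cst.
have e0 x : 0 <= expR x :> R by exact: expR_ge0.
pose g w := (expR (- t) * \1_A w)%:E + (expR t * \1_B w)%:E : \bar R.
have mgA : measurable_fun setT (fun w => (expR (- t) * \1_A w)%:E).
  by apply/measurable_EFinP; apply: measurable_funM => //; exact: measurable_indic.
have mgB : measurable_fun setT (fun w => (expR t * \1_B w)%:E).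
  by apply/measurable_EFinP; apply: measurable_funM => //; exact: measurable_indic.
rewrite (_ : (\int[P]_w _ = \int[P]_w ((expR (- t) * \1_A w)%:E + (expR t * \1_B w)%:E))%E); last first.
  apply: ae_eq_integral => //.
  - by apply: measurable_expR_comp; exact: measurable_funM.
  - exact: emeasurable_funD.
  - exists (~` [set w | y w ^+ 2 = 1]); split; first exact: measurableC.
      exact: (prob_setC_full mG G1).
    move=> w /= hw Gw; apply: hw => _.
    have : y w = 1 \/ y w = -1.
      by move/eqP: Gw; rewrite sqrf_eq1 => /orP[]/eqP; [left|right].
    rewrite -EFinD !indicE; case=> yw.
      rewrite yw mulr1 mem_set// memNset ?mulr1 ?mulr0 ?addr0//.
      by move=> yN; have : y w = -1 := yN; rewrite yw; lra.
    rewrite yw mulrN1 opprK [w \in B]mem_set// memNset ?mulr1 ?mulr0 ?add0r//.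
    by move=> yP; have : y w = 1 := yP; rewrite yw; lra.
rewrite ge0_integralD//.
have intI c (D : set O) : 0 <= c -> measurable D ->
    (\int[P]_w (c * \1_D w)%:E = c%:E * P D)%E.
  move=> c0 mD; under eq_integral do rewrite EFinM.
  rewrite ge0_integralZl_EFin//; last by apply/measurable_EFinP; exact: measurable_indic.
  by rewrite integral_indic// setIT.
rewrite !intI// y1 yN1 -!EFinM -EFinD lee_fin.
(* From exp(-t) <= 1 / (1 + t). *)
have et : expR (- t) <= 1 - t + t ^+ 2.
  have h := expR_ge1Dx t; rewrite expRN -[leLHS]div1r ler_pdivrMr ?expR_gt0//.
  have h2 : 0 <= 1 - t + t ^+ 2 by nra.
  have := ler_wpM2l h2 h; nra.
(* From exp(t) <= 1 / (1 - t); the coefficient 2 suffices because t <= 1/2. *)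
have et' : expR t <= 1 + t + 2 * t ^+ 2.
  have h := expR_ge1Dx (- t).
  have h2 : 0 <= 1 + t + 2 * t ^+ 2 by nra.
  rewrite -[t in leLHS]opprK expRN -[leLHS]div1r ler_pdivrMr ?expR_gt0//.
  have := ler_wpM2l h2 h; nra.
apply: (@le_trans _ _ (1 + (- (1 - 2 * q) * t + 2 * t ^+ 2))); last exact: expR_ge1Dx.
have h1 : expR (- t) * (1 - q) <= (1 - t + t ^+ 2) * (1 - q) by rewrite ler_wpM2r//; lra.
have h2 : expR t * q <= (1 + t + 2 * t ^+ 2) * q by rewrite ler_wpM2r.
nra.
Qed.

Lemma pm1_sum_tail (I : finType) (m : I -> nat) (Z : forall i, O -> 'cV[R]_(m i))
    (HZ : indep_family P Z) (M : nat) (S : 'I_M.+1 -> {set I}) (f : 'I_M.+1 -> O -> R) q c :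
  (forall i j, i != j -> [disjoint S i & S j]%B) ->
  (forall i, measurable_fun setT (f i : blockType Z (S i) -> R)) ->
  (forall i, pm1_rv P q (f i)) -> 0 <= q -> q = 1/2 - c -> 0 < c <= 1/2 ->
  likely P [set w | - (\sum_(i < M.+1 | i != ord_max) f i w) < - (c * M%:R)]
    (expR (- (c ^+ 2 / 8 * M%:R))).
Proof.
move=> dS mf hf q0 qc /andP[c0 c1].
pose s := [seq i <- index_enum 'I_M.+1 | i != ord_max].
have us : uniq s by rewrite filter_uniq// index_enum_uniq.
have ss : size s = M.
  rewrite /s size_filter -sum1_count big_mkcond/= -big_mkcond/= sum1_card.
  by rewrite cardC1 card_ord.
(* The mean of the sum is 2 c M and the threshold c M, so the exponent per sample is -c t + 2 t^2,
   minimal at t = c / 4 with value -c^2 / 8. *)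
pose t := c / 4.
have t01 : 0 <= t <= 1/2 by rewrite /t; apply/andP; split; lra.
have q01 : 0 <= q <= 1/2 by apply/andP; split; lra.
pose k := expR (- (1 - 2 * q) * t + 2 * t ^+ 2).
have [m1 m2] := @expectation_prod_blocks _ _ _ P I m Z HZ 'I_M.+1 s S
  (fun i w => expR (- t * f i w)) (fun=> k) us (fun i j _ _ => dS i j)
  (fun i => measurableT_comp (@measurable_expR R) (measurable_funM (measurable_cst (- t)) (mf i)))
  (fun i w => expR_ge0 _) (fun i => pm1_mgf (hf i) q01 t01).
have mfO i : measurable_fun setT (f i) by case: (hf i).
have mS : measurable_fun setT (fun w => - (\sum_(i < M.+1 | i != ord_max) f i w)).
  by apply: measurable_funN; apply: measurable_sumr.
apply: likely_lt => //.
have t0 : 0 < t by rewrite divr_gt0.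
have := @expR_markov _ _ _ P _ t (- (c * M%:R)) (k ^+ M) mS t0.
rewrite (_ : k ^+ M * expR (- (t * - (c * M%:R))) = expR (- (c ^+ 2 / 8 * M%:R))); last first.
  rewrite /k -expRM_natl -expRD; congr expR.
  by rewrite qc /t; field.
apply; move: m2; rewrite big_const_seq count_predT ss iter_mulr_1.
apply: le_trans; rewrite le_eqVlt; apply/orP; left; apply/eqP.
apply: eq_integral => w _; congr (_%:E).
by rewrite -expR_sum big_filter mulrN -mulNr mulr_sumr.
Qed.

End SignConcentration.

(** * Signal and noise in the test prediction *)

Section TestEvent.
Context {R : realType} {dT : measure_display} {T : measurableType dT} (Q : probability T R).
Variables (d M : nat) (L : 'M[R]_d) (Rt cp : R).
Variables (mu : T -> 'cV[R]_d) (z : 'I_M.+1 -> T -> 'cV[R]_d) (yt f : 'I_M.+1 -> T -> R).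
Hypotheses (M0 : (0 < M)%N) (d2 : (1 < d)%N) (pL : posdef L) (Rt0 : 0 < Rt)
  (cp0 : 0 < cp) (cp1 : cp <= 1/2).
Local Notation p := (1/2 - cp).
Hypothesis law : test_law Q Rt p L mu z yt f.
Variables (W : 'M[R]_d) (kappa : R).
Hypotheses (F0 : 0 < frob2 W) (kappa0 : 0 < kappa)
  (trW : kappa * Num.sqrt (frob2 W) <= \tr W).

Local Notation X := (test_blocks mu z yt f).
Local Notation idx := (test_idx M).

Let HX : indep_family Q X. Proof. by case: law => _ [_ [_ [_ ?]]]. Qed.
Let d0 : 0 < d%:R :> R. Proof. by rewrite ltr0n (ltn_trans _ d2). Qed.
Let M1 : 0 < M%:R :> R. Proof. by rewrite ltr0n. Qed.

Definition tblk_yt i : {set idx} := [set inl (inl (inl i))]%SET.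
Definition tblk_f i : {set idx} := [set inl (inl (inr i))]%SET.
Definition tblk_z i : {set idx} := [set inl (inr i)]%SET.
Definition tblk_mu : {set idx} := [set inr tt]%SET.
Definition tblk_mean : {set idx} :=
  [set x | match x with inl (inl (inl i)) => i != ord_max | inl (inl (inr i)) => i != ord_max
           | inl (inr i) => i != ord_max | inr _ => false end]%SET.
(** The flip of the query label is left out, since the query vector depends on the clean label
    only. *)
Definition tblk_query : {set idx} :=
  [set x | match x with inl (inl (inl i)) => i == ord_max | inl (inl (inr i)) => false
           | inl (inr i) => i == ord_max | inr _ => false end]%SET.

Lemma measurable_yt (S : {set idx}) i : inl (inl (inl i)) \in S ->
  measurable_fun setT (yt i : blockType X S -> R).
Proof.
move=> iS; have := rvec_block (Z := X) iS 0.
by rewrite /= /scal; under eq_fun do rewrite mxE.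
Qed.

Lemma measurable_f (S : {set idx}) i : inl (inl (inr i)) \in S ->
  measurable_fun setT (f i : blockType X S -> R).
Proof.
move=> iS; have := rvec_block (Z := X) iS 0.
by rewrite /= /scal; under eq_fun do rewrite mxE.
Qed.

Lemma rvec_tz (S : {set idx}) i : inl (inr i) \in S -> rvec (z i : blockType X S -> _).
Proof. by move=> iS; exact: (rvec_block (Z := X) iS). Qed.

Lemma rvec_tmu (S : {set idx}) : inr tt \in S -> rvec (mu : blockType X S -> _).
Proof. by move=> iS; exact: (rvec_block (Z := X) iS). Qed.

Definition tnoise_mean v := M%:R^-1 *: \sum_(i < M.+1 | i != ord_max) test_y yt f i v *: z i v.
Definition tnoise_query v := yt ord_max v *: z ord_max v.

Lemma sgv_tnoise_query : sgv Q tnoise_query L.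
Proof.
have [_ [gz [py _]]] := law.
apply: (sgv_sign_blocks HX (S1 := tblk_yt ord_max) (S2 := tblk_z ord_max)) (pm1_sqr_full (py _)) _.
- by apply/pred0P => x /=; rewrite !inE; case: x => [[[]|]|] * /=; rewrite ?andbF.
- by apply: measurable_yt; rewrite inE.
- by apply: rvec_tz; rewrite inE.
- exact: gaussian_sgv.
Qed.

Lemma sign_full : Q [set v | forall i, yt i v ^+ 2 = 1 /\ f i v ^+ 2 = 1] = 1%E /\
  measurable [set v | forall i, yt i v ^+ 2 = 1 /\ f i v ^+ 2 = 1].
Proof.
have [_ [_ [py [pf _]]]] := law.
have : likely Q [set v | forall i, ([set v | yt i v ^+ 2 = 1] `&` [set v | f i v ^+ 2 = 1]) v]
    (#|'I_M.+1|%:R * (0 + 0)).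
  apply: likely_forall => i; apply: likelyI.
    by apply: likely_full; [exact: measurable_sqr1 (py i).1|exact: pm1_sqr_full (py i)].
  by apply: likely_full; [exact: measurable_sqr1 (pf i).1|exact: pm1_sqr_full (pf i)].
rewrite addr0 mulr0 => h; split; last by case: h.
apply/eqP; rewrite eq_le; have := likely_prob h; rewrite subr0 => ->; rewrite andbT.
by apply: probability_le1; case: h.
Qed.

Lemma sgv_tyz i : sgv Q (fun v => test_y yt f i v *: z i v) L.
Proof.
have [_ [gz [py [pf _]]]] := law.
apply: (sgv_sign_blocks HX (S1 := (tblk_yt i :|: tblk_f i)%SET) (S2 := tblk_z i)).
- by apply/pred0P => x /=; rewrite !inE; case: x => [[[]|]|] * /=; rewrite ?andbF.
- by apply: measurable_funM; [apply: measurable_f|apply: measurable_yt]; rewrite !inE eqxx ?orbT.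
- by apply: rvec_tz; rewrite inE.
- have [s1 ms] := sign_full.
  have my : measurable_fun setT (test_y yt f i) by apply: measurable_funM; [exact: (pf i).1|exact: (py i).1].
  rewrite -(prob_setI_full ms s1 (measurable_sqr1 my)) -[RHS]s1; congr (Q _).
  by apply/seteqP; split => v /=; [case|move=> h; split => //; rewrite /test_y exprMn; case: (h i) => -> ->; rewrite mulr1].
- exact: gaussian_sgv.
Qed.

Lemma sgv_tnoise_mean : sgv Q tnoise_mean (M%:R^-1 *: L).
Proof.
apply: (sgv_signed_mean HX (Sy := fun i => (tblk_yt i :|: tblk_f i)%SET) (Sz := tblk_z)) => //.
- by move=> i; apply/pred0P => x /=; rewrite !inE; case: x => [[[]|]|] * /=; rewrite ?andbF.
- move=> i j ij; apply/pred0P => x /=; rewrite !inE; apply/negP => /andP[].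
  by case/orP=> [/orP[]|] /eqP-> /orP[/orP[]|] /eqP // [e]; rewrite e eqxx in ij.
- by move=> i; apply: measurable_funM; [apply: measurable_f|apply: measurable_yt]; rewrite !inE eqxx ?orbT.
- by move=> i; apply: rvec_tz; rewrite inE.
- exact: sgv_tyz.
Qed.

Lemma rvec_tnoise_mean : rvec (tnoise_mean : blockType X tblk_mean -> _).
Proof.
apply: rvecZ; first exact: measurable_cst.
rewrite (_ : (fun w => _) = fun w => \sum_(i < M.+1)
   (if i != ord_max then test_y yt f i w *: z i w else 0)); last first.
  by apply/funext => w; rewrite big_mkcond.
apply: (@rvec_sum _ _ (blockType X tblk_mean) d _ _ _
  (fun i (w : blockType X tblk_mean) => if i != ord_max then test_y yt f i w *: z i w else 0)) => i.
case: (boolP (i != ord_max)) => [imax|_]; last exact: rvec_cst.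
apply: rvecZ; last by apply: rvec_tz; rewrite inE.
by apply: measurable_funM; [apply: measurable_f|apply: measurable_yt]; rewrite inE.
Qed.

Lemma rvec_tnoise_query : rvec (tnoise_query : blockType X tblk_query -> _).
Proof.
apply: rvecZ; first by apply: measurable_yt; rewrite inE /=.
by apply: rvec_tz; rewrite inE /=.
Qed.

Let rv_mean : rvec tnoise_mean. Proof. exact: (rvec_from_block HX rvec_tnoise_mean). Qed.
Let rv_query : rvec tnoise_query. Proof. exact: (rvec_from_block HX rvec_tnoise_query). Qed.
Let rv_mu : rvec mu. Proof. by case: law => -[]. Qed.

Local Notation F := (frob2 W).
Let sF0 : 0 < Num.sqrt F. Proof. by rewrite sqrtr_gt0. Qed.
Let tr0 : 0 < \tr W. Proof. by apply: lt_le_trans trW; rewrite mulr_gt0. Qed.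
Let op0 : 0 < opnorm L.
Proof. by move: d2 L pL; case: d => [|d'] // _ L' pL'; exact: opnorm_gt0. Qed.

Let Tm := Rt ^+ 2 * \tr W / d%:R.
Let Tm0 : 0 < Tm. Proof. by rewrite divr_gt0 ?mulr_gt0 ?exprn_gt0. Qed.
(** The signal is at least cp Tm / 2, and three noise terms of size [s] take away 3 cp Tm / 8. *)
Let s := cp * Tm / 8.

Lemma tail_bilinear (S1 S2 : {set idx}) (A : 'M[R]_d) (u v : T -> 'cV[R]_d) (G H : 'M[R]_d) V t :
  [disjoint S1 & S2]%B ->
  rvec (u : blockType X S1 -> _) -> rvec (v : blockType X S2 -> _) ->
  sgv Q u G -> sgv Q v H -> psd G -> posdef H -> \tr (A *m G *m A^T *m H) <= V -> 0 < V ->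
  2 * Num.sqrt V * t <= s ->
  likely Q [set w | `|dotv (A *m u w) (v w)| < s] (4 * expR (- t)).
Proof.
move=> S12 mu' mv su sv pG pH GHV V0 Vs; have [K eH] := cholesky pH.
have mAu : rvec ((fun w => A *m u w) : blockType X S1 -> _) by exact: rvec_mulmx.
have mO : measurable_fun setT (fun w => `|dotv (A *m u w) (v w)|).
  apply: measurableT_comp => //.
  by apply: measurable_dotv; [exact: (rvec_from_block HX mAu)|exact: (rvec_from_block HX mv)].
apply: likely_lt => //.
have h := dotv_blocks_tail HX t S12 mAu mv (sgv_mulmx A su) sv (psd_conj A pG) eH GHV V0.
apply: le_trans h.
apply: le_measure; rewrite ?inE; [exact: measurable_le_cst|exact: measurable_le_cst|].
by move=> w /= h; apply: le_trans h.
Qed.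

(** [t2] and [t3] are the values at which 2 sqrt V t equals [s] once tr W is replaced by kappa
    |W|_F; the norm of [W] cancels. [V2] serves the two pairs containing mu, [V30] the pair of
    noises, whose mean carries the factor 1 / M. *)
Let t2 := cp * kappa * Rt / (16 * (Num.sqrt d%:R * Num.sqrt (opnorm L))).
Let t3 := cp * kappa * Rt ^+ 2 * Num.sqrt M%:R / (16 * (d%:R * opnorm L)).
Let V2 := Rt ^+ 2 / d%:R * (opnorm L * F).
Let V30 := opnorm L ^+ 2 * F / M%:R.
Let V20 : 0 < V2. Proof. by rewrite mulr_gt0 ?divr_gt0 ?exprn_gt0 ?mulr_gt0. Qed.
Let V300 : 0 < V30. Proof. by rewrite divr_gt0 ?mulr_gt0 ?exprn_gt0. Qed.

Lemma threshold2 : 2 * Num.sqrt V2 * t2 <= s.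
Proof.
have sd0 : 0 < Num.sqrt d%:R :> R by rewrite sqrtr_gt0.
have so0 : 0 < Num.sqrt (opnorm L) by rewrite sqrtr_gt0.
have dd : d%:R = Num.sqrt d%:R ^+ 2 :> R by rewrite sqr_sqrtr// ltW.
have -> : Num.sqrt V2 = Rt / Num.sqrt d%:R * (Num.sqrt (opnorm L) * Num.sqrt F).
  rewrite /V2 sqrtrM ?divr_ge0 ?sqr_ge0 ?(ltW d0)// [Num.sqrt (_ * F)]sqrtrM ?(ltW op0)//.
  by rewrite sqrtrM ?sqr_ge0// sqrtr_sqr sqrtrV ?(ltW d0)// ger0_norm// ltW.
rewrite (_ : _ * t2 = cp * Rt ^+ 2 / (8 * Num.sqrt d%:R ^+ 2) * (kappa * Num.sqrt F)); last first.
  by rewrite /t2; field; rewrite !gt_eqF.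
rewrite (_ : s = cp * Rt ^+ 2 / (8 * Num.sqrt d%:R ^+ 2) * \tr W); last first.
  by rewrite /s /Tm {1}dd; field; rewrite !gt_eqF.
by rewrite ler_wpM2l// divr_ge0 ?mulr_ge0 ?sqr_ge0// ltW.
Qed.

Lemma threshold3 : 2 * Num.sqrt V30 * t3 <= s.
Proof.
have sm0 : 0 < Num.sqrt M%:R :> R by rewrite sqrtr_gt0.
have -> : Num.sqrt V30 = opnorm L * Num.sqrt F / Num.sqrt M%:R.
  have p1 : 0 <= opnorm L ^+ 2 * F by rewrite mulr_ge0 ?sqr_ge0 ?(ltW F0).
  rewrite /V30 (sqrtrM _ p1) (sqrtrM _ (sqr_ge0 _)) sqrtr_sqr.
  by rewrite sqrtrV ?(ltW M1)// ger0_norm// ltW.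
rewrite (_ : _ * t3 = cp * Rt ^+ 2 / (8 * d%:R) * (kappa * Num.sqrt F)); last first.
  by rewrite /t3; field; rewrite !gt_eqF.
rewrite (_ : s = cp * Rt ^+ 2 / (8 * d%:R) * \tr W); last first.
  by rewrite /s /Tm; field; rewrite !gt_eqF.
by rewrite ler_wpM2l// divr_ge0 ?mulr_ge0 ?sqr_ge0// ltW.
Qed.

Lemma sgv_tmu : sgv Q mu (Rt ^+ 2 / d%:R)%:M.
Proof. by case: law => umu _; exact: unif_sphere_sgv. Qed.

Let invM : 0 < (M%:R^-1 : R) <= 1.
Proof. by rewrite invr_gt0 M1 invf_le1// ler1n. Qed.

Lemma likely_mu_query : likely Q [set v | `|bil (mu v) W (tnoise_query v)| < s] (4 * expR (- t2)).
Proof.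
rewrite (_ : [set v | _] = [set v | `|dotv (W *m tnoise_query v) (mu v)| < s]); last first.
  by apply/seteqP; split => v /=; rewrite bil_dotv dotvC.
apply: (tail_bilinear (S1 := tblk_query) (S2 := tblk_mu) (V := V2) (G := L) (H := (Rt ^+ 2 / d%:R)%:M)).
- by apply/pred0P => x /=; rewrite !inE; case: x => [[[]|]|] * /=; rewrite ?andbF.
- exact: rvec_tnoise_query.
- by apply: rvec_tmu; rewrite inE.
- exact: sgv_tnoise_query.
- exact: sgv_tmu.
- exact: posdef_psd.
- by apply: posdef_scalar; rewrite divr_gt0 ?exprn_gt0.
- rewrite mul_mx_scalar linearZ/= ler_wpM2l ?trace_conj_le//.
  by rewrite divr_ge0 ?sqr_ge0// ltW.
- exact: V20.
- exact: threshold2.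
Qed.

Lemma likely_mean_mu : likely Q [set v | `|bil (tnoise_mean v) W (mu v)| < s] (4 * expR (- t2)).
Proof.
have /andP[i0 i1] := invM.
rewrite (_ : [set v | _] = [set v | `|dotv (W^T *m tnoise_mean v) (mu v)| < s]); last first.
  by apply/seteqP; split => v /=; rewrite bil_dotv dotv_mulmxr.
apply: (tail_bilinear (S1 := tblk_mean) (S2 := tblk_mu) (V := V2) (G := M%:R^-1 *: L)
   (H := (Rt ^+ 2 / d%:R)%:M)).
- by apply/pred0P => x /=; rewrite !inE; case: x => [[[]|]|] * /=; rewrite ?andbF.
- exact: rvec_tnoise_mean.
- by apply: rvec_tmu; rewrite inE.
- exact: sgv_tnoise_mean.
- exact: sgv_tmu.
- by apply: posdef_psd; exact: posdefZ.
- by apply: posdef_scalar; rewrite divr_gt0 ?exprn_gt0.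
- rewrite mul_mx_scalar linearZ/= ler_wpM2l ?divr_ge0 ?sqr_ge0 ?(ltW d0)//.
  rewrite -scalemxAr -scalemxAl linearZ/=; apply: (@le_trans _ _ (\tr (W^T *m L *m W^T^T))).
    rewrite ler_piMl// trace_conj_sum sumr_ge0// => i _; exact: posdef_ge0.
  by apply: le_trans (trace_conj_le _ _) _; rewrite frob2_tr.
- exact: V20.
- exact: threshold2.
Qed.

Lemma likely_mean_query :
  likely Q [set v | `|bil (tnoise_mean v) W (tnoise_query v)| < s] (4 * expR (- t3)).
Proof.
have /andP[i0 i1] := invM.
rewrite (_ : [set v | _] = [set v | `|dotv (W^T *m tnoise_mean v) (tnoise_query v)| < s]); last first.
  by apply/seteqP; split => v /=; rewrite bil_dotv dotv_mulmxr.
apply: (tail_bilinear (S1 := tblk_mean) (S2 := tblk_query) (V := V30) (G := M%:R^-1 *: L) (H := L)) => //.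
- apply/pred0P => x /=; rewrite !inE; case: x => [[[i|i]|i]|[]] //=; rewrite ?andbF// andbC; exact: andbN.
- exact: rvec_tnoise_mean.
- exact: rvec_tnoise_query.
- exact: sgv_tnoise_mean.
- exact: sgv_tnoise_query.
- by apply: posdef_psd; exact: posdefZ.
- rewrite -scalemxAr -!scalemxAl linearZ/= /V30 [leRHS]mulrC ler_wpM2l ?(ltW i0)//.
  (* Writing L = K K^T turns the trace into a conjugation of [L] by K^T W^T. The operator norm is
     then extracted twice, the squared Frobenius norm of W K being tr(W L W^T). *)
  have [K eL] := cholesky pL.
  have -> : \tr (W^T *m L *m W^T^T *m L) = \tr ((K^T *m W^T) *m L *m (K^T *m W^T)^T).
    by rewrite {2}eL mulmxA [in LHS]mxtrace_mulC trmx_mul !trmxK !mulmxA.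
  apply: le_trans (trace_conj_le _ _) _; rewrite expr2 -mulrA ler_wpM2l ?(ltW op0)//.
  rewrite -frob2_tr trmx_mul !trmxK frob2_trace trmx_mul mulmxA -[W *m K *m _]mulmxA -eL.
  exact: trace_conj_le.
- exact: threshold3.
Qed.

(** The quadratic tail is available for symmetric matrices. The symmetric part has the same
    quadratic form and trace, and no larger Frobenius norm. *)
Let Sy : 'M[R]_d := 2^-1 *: (W + W^T).

Lemma frob2_sym : frob2 Sy <= F.
Proof.
have := frobdot_cauchy_schwarz W W^T; rewrite frob2_tr => cs.
have {}cs : frobdot W W^T <= F.
  move: cs F0; move: (frobdot _ _) (F) => x g cs g0.
  by rewrite leNgt; apply/negP => gx; have := mulr_gt0 g0 g0; nra.
rewrite /Sy frob2Z frob2D frob2_tr mulr2n.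
by rewrite (_ : 2^-1 ^+ 2 = 1 / 4 :> R); [lra|field].
Qed.

(** A failure is a deviation of Tm / 2 from the mean Tm. In units of Rt^2 |W|_F / d this is tr W /
    (2 |W|_F) >= kappa / 2, so neither Rt nor the scale of [W] remains; 64 e becomes 128 e. *)
Lemma likely_mu_mu : likely Q [set v | - bil (mu v) W (mu v) < - (Tm / 2)]
  (2 * expR (- (kappa / (128 * expR 1)))).
Proof.
have [umu _] := law.
have SyT : Sy^T = Sy by rewrite /Sy linearZ/= linearD/= trmxK addrC.
have trSy : \tr Sy = \tr W by rewrite /Sy linearZ/= linearD/= mxtrace_tr; field.
have bSy u : bil u Sy u = bil u W u.
  have e : bil u W^T u = bil u W u by rewrite !bil_dotv dotv_mulmxr trmxK dotvC.
  by rewrite /Sy bilZm bilDm e; field.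
have mb : measurable_fun setT (fun v => bil (mu v) W (mu v)) by exact: measurable_bil.
have s0 : 0 <= Tm / 2 by rewrite divr_ge0// ltW.
have h := unif_sphere_quad_tail d2 Rt0 umu SyT frob2_sym F0 s0.
apply: likely_lt; first exact: measurable_funN.
apply: (@le_trans _ _ (2 * expR (- (Tm / 2 / (64 * expR 1 * (Rt ^+ 2 * Num.sqrt F / d%:R)))))%:E); last first.
  have e1 : 0 < expR 1 :> R by exact: expR_gt0.
  rewrite lee_fin ler_pM2l// ler_expR lerN2.
  rewrite (_ : Tm / 2 / _ = \tr W / Num.sqrt F / (128 * expR 1)); last first.
    by rewrite /Tm; field; rewrite !gt_eqF.
  by rewrite ler_wpM2r ?invr_ge0 ?mulr_ge0 ?(ltW e1)// ler_pdivlMr.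
apply: le_trans h; apply: le_measure; rewrite ?inE.
- by apply: measurable_le_cst; exact: measurable_funN.
- apply: measurable_le_cst; apply: measurableT_comp => //.
  by apply: measurable_funB => //; exact: measurable_bil.
- move=> v /=; rewrite bSy trSy -/Tm => hv; rewrite ler0_norm; lra.
Qed.

(** When p = 0 every flip equals 1 almost surely and the failure probability is 0: this is the
    origin of the indicator of p > 0 in the final bound. *)
Lemma likely_labels :
  likely Q ([set v | f ord_max v = 1] `&`
            [set v | - (\sum_(i < M.+1 | i != ord_max) f i v) < - (cp * M%:R)])
    (if 0 < p then p + expR (- (cp ^+ 2 / 8 * M%:R)) else 0).
Proof.
have [_ [_ [_ [pf _]]]] := law.
have mf i : measurable_fun setT (f i) by case: (pf i).
case: ifPn => [p0|pN].
  apply: likelyI.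
    split; first exact: measurable_eq_cst.
    rewrite probability_setC; last exact: measurable_eq_cst.
    by rewrite (pf _).2.1 -EFinB lee_fin; lra.
  apply: (pm1_sum_tail HX (S := tblk_f) (q := p)) => //.
  - by move=> i j ij; apply/pred0P => x /=; rewrite !inE; apply/negP => /andP[/eqP-> /eqP[e]]; rewrite e eqxx in ij.
  - by move=> i; apply: measurable_f; rewrite inE.
  - exact: ltW.
  - by rewrite cp0.
have p0 : p = 0 by move: pN; rewrite -leNgt; have := cp1; lra.
have : likely Q [set v | forall i, [set v | f i v = 1] v] (#|'I_M.+1|%:R * 0).
  apply: likely_forall => i; apply: likely_full; first exact: measurable_eq_cst.
  by rewrite (pf i).2.1 p0 subr0.
rewrite mulr0 => -[mA hA].
have mB : measurable ([set v | f ord_max v = 1] `&`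
    [set v | - (\sum_(i < M.+1 | i != ord_max) f i v) < - (cp * M%:R)]).
  apply: measurableI; first exact: measurable_eq_cst.
  by apply: measurable_lt_cst; apply: measurable_funN; exact: measurable_sumr.
split=> //; apply: le_trans hA; apply: le_measure; rewrite ?inE; [exact: measurableC|exact: measurableC|].
apply: subsetC => v /= hv; split; first exact: hv.
rewrite (eq_bigr (fun=> 1)) => [|i _]; last exact: hv.
rewrite sumr_const (_ : #|_| = M); last by rewrite cardC1 card_ord.
have := M1; have := cp1; rewrite ltrN2; nra.
Qed.

Lemma test_yhatE v : (forall i, yt i v ^+ 2 = 1 /\ f i v ^+ 2 = 1) ->
  test_yhat W mu z yt f v = yt ord_max v *
    bil ((M%:R^-1 * \sum_(i < M.+1 | i != ord_max) f i v) *: mu v + tnoise_mean v) W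
        (mu v + tnoise_query v).
Proof.
move=> sq; rewrite /test_yhat -bilZr; congr (bil _ W _).
  rewrite /tnoise_mean -scalerA -scalerDr scaler_suml -big_split/=; congr (_ *: _).
  apply: eq_bigr => i _; rewrite /test_x scalerDr scalerA /test_y -mulrA -expr2.
  by rewrite (sq i).1 mulr1.
by rewrite /test_x /tnoise_query scalerDr scalerA -expr2 (sq _).1 scale1r.
Qed.

Lemma sg_test_yhat v : (forall i, yt i v ^+ 2 = 1 /\ f i v ^+ 2 = 1) ->
  f ord_max v = 1 -> - (\sum_(i < M.+1 | i != ord_max) f i v) < - (cp * M%:R) ->
  - bil (mu v) W (mu v) < - (Tm / 2) ->
  `|bil (mu v) W (tnoise_query v)| < s ->
  `|bil (tnoise_mean v) W (mu v)| < s ->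
  `|bil (tnoise_mean v) W (tnoise_query v)| < s ->
  Num.sg (test_yhat W mu z yt f v) = test_y yt f ord_max v.
Proof.
move=> sq fmax fsum hmm hmq hnm hnq; rewrite (test_yhatE sq) /test_y fmax mul1r sgrM.
set fb := _ * \sum_(i < _ | _) _.
have fb_ge : cp <= fb.
  by rewrite /fb mulrC ler_pdivlMr//; move: fsum; rewrite ltrN2; exact: ltW.
have fb_le : fb <= 1.
  rewrite /fb mulrC ler_pdivrMr// mul1r; apply: (@le_trans _ _ (\sum_(i < M.+1 | i != ord_max) 1)).
    by apply: ler_sum => i _; have := (sq i).2; nra.
  by rewrite sumr_const (_ : #|_| = M)//; rewrite cardC1 card_ord.
have pos : 0 < bil (fb *: mu v + tnoise_mean v) W (mu v + tnoise_query v).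
  rewrite bilDl !bilDr !(bilZl fb).
  move: hmq hnm hnq hmm; rewrite !ltr_norml !ltrN2.
  move: (bil (mu v) W (mu v)) (bil (mu v) W (tnoise_query v)) (bil (tnoise_mean v) W (mu v))
    (bil (tnoise_mean v) W (tnoise_query v)) => a b c e.
  move=> /andP[b0 _] /andP[c0 _] /andP[e0 _] a0.
  have s0 : s = cp * Tm / 8 by [].
  have h1 : cp * (Tm / 2) <= fb * a.
    by apply: ler_pM => //; [exact: ltW|rewrite divr_ge0// ltW|exact: ltW].
  (* Uses fb <= 1: the mean flip must not amplify this noise term. *)
  have h2 : - s <= fb * b.
    have t0 : 0 < s by have := mulr_gt0 cp0 Tm0; rewrite s0; lra.
    have := cp0; nra.
  have := mulr_gt0 cp0 Tm0; lra.
rewrite (gtr0_sg pos) mulr1; have /eqP := (sq ord_max).1.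
by rewrite sqrf_eq1 => /orP[]/eqP->; rewrite ?sgrN sgr1.
Qed.

Lemma measurable_sg_eq (g k : T -> R) : measurable_fun setT g -> measurable_fun setT k ->
  measurable [set v | Num.sg (g v) = k v].
Proof.
move=> mg mk; rewrite (_ : [set v | _] =
  (([set v | - g v < 0] `&` [set v | k v = 1]) `|` ([set v | g v < 0] `&` [set v | k v = -1])
      `|` ([set v | g v = 0] `&` [set v | k v = 0]))); last first.
  apply/seteqP; split => v /=; rewrite oppr_lt0; case: sgrP => gv kv.
  - by right.
  - by left; left.
  - by left; right.
  - by move: kv => [[[]|[]]|[_ ->]].
  - by move: kv gv => [[[_ ->]|[]]|[-> _]]//; rewrite ltxx.
  - by move: kv gv => [[[]|[_ ->]]|[-> _]]//; rewrite ltxx.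
apply: measurableU; first apply: measurableU; apply: measurableI;
  by [exact: measurable_eq_cst|apply: measurable_lt_cst => //; exact: measurable_funN].
Qed.

(** The 8 is 4 + 4, as mu is paired both with the query noise and with the mean noise. The last two
    prefactors are twice those of the theorem, which is what [expR_absorb] repairs. *)
Lemma likely_test_correct :
  likely Q [set v | Num.sg (test_yhat W mu z yt f v) = test_y yt f ord_max v]
   ((if 0 < p then p + expR (- (cp ^+ 2 / 8 * M%:R)) else 0)
    + 2 * expR (- (kappa / (128 * expR 1))) + 8 * expR (- t2) + 4 * expR (- t3)).
Proof.
have [s1 ms] := sign_full; have [_ [_ [py [pf _]]]] := law.
have myt i : measurable_fun setT (yt i) by case: (py i).
have mf i : measurable_fun setT (f i) by case: (pf i).
have my i : measurable_fun setT (test_y yt f i) by exact: measurable_funM.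
have rz i : rvec (z i) by have [_ [gz _]] := law; case: (gz i).
have rx i : rvec (test_x mu z yt i) by apply: rvecD => //; exact: rvecZ.
have myhat : measurable_fun setT (test_yhat W mu z yt f).
  apply: measurable_bil => //; apply: rvecZ; first exact: measurable_cst.
  rewrite (_ : (fun w => _) = fun w => \sum_(i < M.+1)
     (if i != ord_max then test_y yt f i w *: test_x mu z yt i w else 0)); last first.
    by apply/funext => w; rewrite big_mkcond.
  apply: (@rvec_sum _ _ T d _ _ _
    (fun i w => if i != ord_max then test_y yt f i w *: test_x mu z yt i w else 0)) => i.
  by case: (i != ord_max); [exact: rvecZ|exact: rvec_cst].
have [mG hG] := likelyI (likelyI (likelyI likely_labels likely_mu_mu)
   (likelyI likely_mu_query likely_mean_mu)) (likelyI likely_mean_query (likely_full ms s1)).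
have mE : measurable [set v | Num.sg (test_yhat W mu z yt f v) = test_y yt f ord_max v].
  exact: measurable_sg_eq.
split=> //; apply: le_trans (le_trans _ hG) _; last by rewrite lee_fin; lra.
apply: le_measure; rewrite ?inE; [exact: measurableC|exact: measurableC|].
apply: subsetC => v /= [[[[h1 h2] h3] [h4 h5]] [h6 h7]]; exact: sg_test_yhat.
Qed.

End TestEvent.

(* The first alternative is harmless, since the right-hand side bounds a probability. *)
Lemma expR_absorb {R : realType} (a x t : R) : 2 <= a -> 2 * x <= t ->
  1 <= a * expR (- x) \/ 2 * a * expR (- t) <= a * expR (- x).
Proof.
move=> a2 xt; have [h|h] := leP 1 (a * expR (- x)); first by left.
right; have e0 := expR_gt0 (- x).
have ht : expR (- t) <= expR (- x) * expR (- x) by rewrite -expRD ler_expR; lra.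
have hx : expR (- x) * 2 <= 1 by nra.
have : 2 * a * expR (- t) <= 2 * a * (expR (- x) * expR (- x)) by rewrite ler_wpM2l//; lra.
by move/le_trans; apply; nra.
Qed.

(** * Numerical constants of the rates *)

Section RateConstants.
Context {R : realType}.
Variables (cp : R).
Hypotheses (cp0 : 0 < cp) (cp1 : cp <= 1/2).

(** The 200 is that of [kappa], 128 e comes from the quadratic tail in [likely_mu_mu], and cp^2 from
    the concentration of the flips. The value is small enough to leave the factor 2 that
    [expR_absorb] requires of the last two terms. *)
Definition rate : R := cp ^+ 2 / (200 * (128 * expR 1)).

Let e2 : 2 <= expR 1 :> R. Proof. by have := expR_ge1Dx (1 : R); lra. Qed.
Let e0 : 0 < expR 1 :> R. Proof. exact: expR_gt0. Qed.

Lemma rate_gt0 : 0 < rate.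
Proof. by rewrite divr_gt0 ?exprn_gt0// !mulr_gt0. Qed.

Let cp21 : cp ^+ 2 <= 1. Proof. by have h := cp0; have h' := cp1; nra. Qed.

Lemma rate_labels : rate <= cp ^+ 2 / 8.
Proof.
rewrite ler_wpM2l ?sqr_ge0// lef_pV2 ?posrE ?mulr_gt0//.
have := e2; lra.
Qed.

Variables (rho d op Rt M : R).
Hypotheses (rho0 : 0 <= rho) (d0 : 0 < d) (op0 : 0 < op) (Rt0 : 0 < Rt) (M0 : 0 < M).
Local Notation kappa := (rho * Num.sqrt d / 200).
Let sd0 : 0 < Num.sqrt d. Proof. by rewrite sqrtr_gt0. Qed.
Let so0 : 0 < Num.sqrt op. Proof. by rewrite sqrtr_gt0. Qed.
Let dd : d = Num.sqrt d ^+ 2. Proof. by rewrite sqr_sqrtr// ltW. Qed.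

Lemma rate_signal : rate * rho * Num.sqrt d <= kappa / (128 * expR 1).
Proof.
rewrite (_ : kappa / _ = (200 * (128 * expR 1))^-1 * (rho * Num.sqrt d)); last first.
  by field; rewrite gt_eqF.
rewrite -mulrA ler_wpM2r ?mulr_ge0 ?(ltW sd0)// /rate ler_piMl//.

Qed.

Let rate2 : 2 * rate <= cp / (200 * 16).
Proof.
have -> : 2 * rate = cp / (200 * 16) * (cp / 4 / expR 1).
  by rewrite /rate; field; rewrite gt_eqF.
rewrite ler_piMr ?divr_ge0 ?(ltW cp0)// ler_pdivrMr// mul1r.
have := cp1; have := e2; lra.
Qed.

(** The factor 2 on the left is the hypothesis of [expR_absorb]; the right-hand side is the exponent
    [t2] of the test event. *)
Lemma rate_cross : 2 * (rate * rho * Rt / Num.sqrt op) <=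
  cp * kappa * Rt / (16 * (Num.sqrt d * Num.sqrt op)).
Proof.
rewrite [leRHS](_ : _ = cp / (200 * 16) * (rho * Rt / Num.sqrt op)); last first.
  by field; rewrite !gt_eqF.
rewrite [leLHS](_ : _ = 2 * rate * (rho * Rt / Num.sqrt op)); last by field; rewrite gt_eqF.
by rewrite ler_wpM2r// divr_ge0 ?mulr_ge0// ltW.
Qed.

Lemma rate_noise : 2 * (rate * rho * Num.sqrt M * Rt ^+ 2 / (op * Num.sqrt d)) <=
  cp * kappa * Rt ^+ 2 * Num.sqrt M / (16 * (d * op)).
Proof.
rewrite [leRHS](_ : _ = cp / (200 * 16) * (rho * Num.sqrt M * Rt ^+ 2 / (op * Num.sqrt d))); last first.
  by rewrite [X in _ / (16 * (X * _))]dd; field; rewrite !gt_eqF.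
rewrite [leLHS](_ : _ = 2 * rate * (rho * Num.sqrt M * Rt ^+ 2 / (op * Num.sqrt d))); last first.
  by field; rewrite !gt_eqF.
by rewrite ler_wpM2r// divr_ge0 ?mulr_ge0 ?sqr_ge0 ?sqrtr_ge0// ltW.
Qed.

End RateConstants.

Theorem mainTheorem1 (R : realType) (cp : R) :
  0 < cp -> cp <= 1/2 ->
  exists C c : R, 1 < C /\ 0 < c /\
  forall (d B N M : nat) (L : 'M[R]_d) (Rad Rt delta cB : R)
    (dO : measure_display) (O : measurableType dO) (P : probability O R)
    (mu : 'I_B -> O -> 'cV[R]_d) (z : 'I_B -> 'I_N.+1 -> O -> 'cV[R]_d)
    (y : 'I_B -> 'I_N.+1 -> O -> R),
  (0 < B)%N -> (0 < N)%N -> (0 < M)%N ->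
  posdef L -> 0 < Rad -> 0 < Rt -> 0 < delta < 1 -> 0 < cB ->
  (* (A1) *)
  (C ^+ 2 * Num.sqrt (d%:R * \tr (L *m L)) <= Rad ^+ 2 /\
   C ^+ 2 * Num.max (Num.max (\tr L / d%:R) (Num.sqrt (\tr (L *m L) / N%:R)))
                    (opnorm L) * ln (2 * B%:R / delta) <= Rad ^+ 2) ->
  (* (A2) *)
  cB * d%:R <= B%:R ->
  (* (A3) *)
  C * ln (2 * B%:R ^+ 2 / delta) ^+ 4 <= d%:R ->
  pretrain_law P Rad L mu z y ->
  let p := 1/2 - cp in
  let rho := Num.min cB 1 / ln (2 * B%:R ^+ 2 / delta) ^+ 2 in
  let bound :=
    (if 0 < p then p + 2 * expR (- (c * M%:R)) else 0)
    + 2 * expR (- (c * rho * Num.sqrt d%:R))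
    + 4 * expR (- (c * rho * Rt / Num.sqrt (opnorm L)))
    + 2 * expR (- (c * rho * Num.sqrt M%:R * Rt ^+ 2
                   / (opnorm L * Num.sqrt d%:R))) in
  exists E : set O, measurable E /\ ((1 - 10 * delta)%:E <= P E)%E /\
  forall w, E w ->
    let muh := fun t => pre_muhat mu z y t w in
    let yq := fun t => y t ord_max w in
    let xq := fun t => pre_x mu z y t ord_max w in
    (exists W, is_max_margin muh yq xq W) /\
    forall W, is_max_margin muh yq xq W ->
    forall (dT : measure_display) (T : measurableType dT) (Q : probability T R)
      (mut : T -> 'cV[R]_d) (zt : 'I_M.+1 -> T -> 'cV[R]_d)
      (yt f : 'I_M.+1 -> T -> R),
    test_law Q Rt p L mut zt yt f ->
    (Q [set v | Num.sg (test_yhat W mut zt yt f v) != test_y yt f ord_max v]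
       <= bound%:E)%E.

Proof.
(* [C] can be absolute: it keeps the pre-training cross terms below R^2 / 8 and makes (A3) force d >
   1. Only [rate] depends on [cp]. *)
move=> cp0 cp1; exists 64, (rate cp); split; [lra|split; first exact: rate_gt0].
move=> d B N M L Rad Rt delta cB dO O P mu z y B0 N0 M0 pL R0 Rt0 delta01 cB0 [A1 _] A2 A3 law.
move=> p rho bound.
have l0 := log_ge_half B0 delta01.
(* (A3) with C = 64 and l >= 1/2 gives d >= 4; the moment recursions on the sphere need d > 1. *)
have d2 : (1 < d)%N.
  rewrite -(ltr_nat R); apply: lt_le_trans A3.
  have : (1/2) ^+ 4 <= ln (2 * B%:R ^+ 2 / delta) ^+ 4 :> R by rewrite ler_pXn2r ?nnegrE//; lra.
  by rewrite (_ : (1/2) ^+ 4 = 1/16 :> R); [lra|field].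
have d0 : (0 < d)%N := ltnW d2.
have dR : 0 < d%:R :> R by rewrite ltr0n.
have MR : 0 < M%:R :> R by rewrite ltr0n.
have op0 : 0 < opnorm L.
  by clear - d0 pL; case: d d0 L pL => [|d'] // _ L pL; exact: opnorm_gt0.
have rho0 : 0 < rho by rewrite divr_gt0 ?exprn_gt0 ?lt_min ?cB0//; lra.
have lG := likely_pretrain_good N0 d2 pL R0 law (lexx 64) B0 delta01 A1 A3.
exists [set w | pretrain_good Rad mu z y delta w].
split; first by case: lG.
split; first exact: likely_prob.
move=> w good muh yq xq.
have [exW mmW] := pretrain_good_max_margin N0 d0 R0 B0 cB0 l0 A2 good.
split; first exact: exW.
move=> W /mmW[F0 trW] dT T Q mut zt yt f tlaw.
have sd0 : 0 < Num.sqrt d%:R :> R by rewrite sqrtr_gt0.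
have k0 : 0 < rho * Num.sqrt d%:R / 200 by apply: divr_gt0 => //; exact: mulr_gt0.
have [mE hE] := likely_test_correct M0 d2 pL Rt0 cp0 cp1 tlaw F0 k0 trW.
set err := [set v | _]; have eE : err = ~` [set v | Num.sg (test_yhat W mut zt yt f v) = test_y yt f ord_max v].
  by apply/seteqP; split => v /= /eqP.
(* Needed for the first alternative of [expR_absorb], in which a single term of the bound already
   reaches 1. *)
have : (Q err <= 1)%E by rewrite eE; apply: probability_le1; exact: measurableC.
move: hE; rewrite -eE.
have fE : Q err \is a fin_num by rewrite eE; apply: fin_num_measure; exact: measurableC.
rewrite -(fineK fE) !lee_fin => hE hE1.
have hs : 2 * expR (- (rho * Num.sqrt d%:R / 200 / (128 * expR 1))) <=
    2 * expR (- (rate cp * rho * Num.sqrt d%:R)).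
  by rewrite ler_pM2l// ler_expR lerN2; apply: rate_signal => //; exact: ltW.
have hl : (if 0 < p then p + expR (- (cp ^+ 2 / 8 * M%:R)) else 0) <=
    (if 0 < p then p + 2 * expR (- (rate cp * M%:R)) else 0).
  case: ifP => // _; rewrite lerD2l; apply: (@le_trans _ _ (expR (- (rate cp * M%:R)))).
    by rewrite ler_expR lerN2 ler_wpM2r ?(ltW MR)// rate_labels.
  by have := expR_ge0 (- (rate cp * M%:R)); lra.
have pl0 : 0 <= (if 0 < p then p + 2 * expR (- (rate cp * M%:R)) else 0).
  by case: ifP => // p0; rewrite addr_ge0 ?mulr_ge0 ?expR_ge0// ltW.
have ge1 x : 0 <= expR x :> R by exact: expR_ge0.
rewrite /bound.
have e1 := ge1 (- (rate cp * rho * Num.sqrt d%:R)).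
have e2 := ge1 (- (rate cp * rho * Rt / Num.sqrt (opnorm L))).
have e3 := ge1 (- (rate cp * rho * Num.sqrt M%:R * Rt ^+ 2 / (opnorm L * Num.sqrt d%:R))).
have a4 : 2 <= 4 :> R by rewrite ler_nat.
have [h2|h2] := expR_absorb a4 (rate_cross cp0 cp1 (ltW rho0) dR op0 Rt0).
  by move: pl0 e1 e2 e3 h2 hE1; lra.
have [h3|h3] := expR_absorb (lexx 2) (rate_noise cp0 cp1 M%:R (ltW rho0) dR op0 Rt0).
  by move: pl0 e1 e2 e3 h3 hE1; lra.
apply: le_trans hE _; apply: lerD; first apply: lerD; first apply: lerD.
- exact: hl.
- exact: hs.
- by apply: le_trans h2; rewrite -natrM.
- by apply: le_trans h3; rewrite -natrM.
Qed.
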